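(* Let $\mathscr{R}$ be a noetherian Banach $K$-algebra with a triangular decomposition $(R,A,B,H,\partial)$, such that the closures $\mathscr{A},\mathscr{B}$ of $A,B$ in $\mathscr{R}$ are noetherian Banach $K$-algebras. Let $M$ be a finitely generated $\mathscr{R}$-module. The following are equivalent: (i) $M\in\widehat{\mathcal{O}}$. (ii) There is an epimorphism $\bigoplus_{i=1}^r\widehat{\Delta}(W_i)_{n_i}\to M$ for some $W_i\in\mathrm{Irr}(H)$ and $n_i\ge0$. (iii) There is a finite family $\{W_i\}_{i=1}^n\subset\mathrm{Irr}(H)$ such that $\Lambda(M)\subset\bigcup_{i=1}^n(c(W_i)+\mathbb{Z}^{\ge0})$, each $M^\lambda$ is finite-dimensional, and $M$ admits a weight space decomposition. (iv) The action of $B$ on $M^{\mathrm{ws}}$ is locally nilpotent, and $M^{\mathrm{ws}}$ is dense in $M$.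
   Context: $K$ is a complete discretely valued extension of $\mathbb{Q}_p$. Modules are left modules. **Algebraic triangular decomposition.** A triangular decomposition of a noetherian $\mathbb{Z}$-graded $K$-algebra $R$ is a tuple $(A,B,H,\partial)$ of graded subalgebras $A,B,H\subset R$ and an element $\partial\in R_0$ such that: (1) multiplication gives $R=A\otimes_K H\otimes_K B$ as $K$-vector spaces; (2) $B\cdot H=H\cdot B$ and $H\cdot A=A\cdot H$; (3) $A=\bigoplus_{n\ge 0}A_n$, $B=\bigoplus_{n\le 0}B_n$, $A_0=B_0=K$, $H\subset R_0$; (4) all $A_n,B_n$ are finite-dimensional; (5) $H$ is a finite-dimensional split semisimple $K$-algebra; (6) $R_n=\{x\in R\mid[\partial,x]=nx\}$. Put $B^n=B_{-n}$, $B^{>n}=\bigoplus_{m>n}B^m$, $BH^{>n}=B^{>n}\otimes_KH$. $B$ acts locally nilpotently on $N$ if for every $m\in N$ there is $n\ge0$ with $B^{>n}m=0$. $\mathrm{Irr}(H)$ is the set of isomorphism classes of irreducible $H$-modules. Write $\partial=\partial'+\partial_0$ with $\partial'\in A\otimes_KH\otimes_KB^{>0}$ and $\partial_0\in Z(H)$; for $W\in\mathrm{Irr}(H)$, $c(W)\in K$ is the scalar by which $\partial_0$ acts on $W$ (so $\partial$ acts on $A_n\otimes W$ inside the Verma module $A\otimes_KW=R\otimes_{BH}W$ by $c(W)+n$). **Weight spaces.** For a locally convex $K$-vector space $V$ with a continuous endomorphism $\partial$ and $\lambda\in K$, put $V^\lambda=\{v\mid(\partial-\lambda)^nv=0\text{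 for }n\gg0\}$, $\Lambda(V)=\{\lambda\in K\mid V^\lambda\neq0\}$ and $V^{\mathrm{ws}}=\bigoplus_{\lambda\in\Lambda(V)}V^\lambda$. $V$ admits a weight space decomposition (with respect to $I\subset\Lambda(V)$) if every $v\in V$ is a convergent sum $v=\sum_{\lambda\in I}v_\lambda$ with $v_\lambda\in V^\lambda$. It is semi-simple if $\partial$ acts on $V^\lambda$ as multiplication by $\lambda$ for each $\lambda\in I$. **Banach triangular decomposition.** A triangular decomposition of a noetherian Banach $K$-algebra $\mathscr{R}$ is a tuple $(R,A,B,H,\partial)$ where $R\subset\mathscr{R}$ is a dense graded subalgebra with algebraic triangular decomposition $(A,B,H,\partial)$, such that, with $\mathscr{A},\mathscr{B}$ the closures of $A,B$ in $\mathscr{R}$ and $\mathrm{ad}(\partial)=[\partial,-]$: (1) $\mathscr{R}=\mathscr{A}\widehat{\otimes}_KH\widehat{\otimes}_K\mathscr{B}$ as Banach spaces; (2) $\mathscr{A}$ and $\mathscr{B}$ have semi-simple weight space decompositions for $\mathrm{ad}(\partial)$, with $\mathscr{A}^{\mathrm{ws}}=A$ and $\mathscr{B}^{\mathrm{ws}}=B$. **Modules.** Finitely generated $\mathscr{R}$-modules carry their canonical Banach topology, and weight spaces of modules are with respect to $\partial$. With $\mathscr{B}H=\mathscr{B}\widehat\otimes_KH\subset\mathscr{R}$ and $\mathscr{B}H^{>n}$ its two-sided ideal generated by $BH^{>n}$, $\widehat{\Delta}(W)_n=\mathscr{R}\widehat\otimes_{\mathscr{B}H}(\mathscr{B}H/\mathscr{B}H^{>n}\widehat\otimes_HW)=\mathscr{A}\widehat\otimes_K(B/B^{>n}\otimes_KW)$.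 $\widehat{\mathcal{O}}$ is the full subcategory of finitely generated $\mathscr{R}$-modules which are finite over $\mathscr{A}$ and admit a weight space decomposition with respect to $\partial$. *)

(* Defs.v *)
(* The norms of MathComp-Analysis are valued in the scalar field itself, so
   nonarchimedean norms are introduced here as plain real-valued functions.
   All modules are left modules. *)
From HB Require Import structures.
From mathcomp Require Import all_boot all_order all_algebra.
From mathcomp Require Import finmap.
From mathcomp Require Import boolp classical_sets reals.

Set Implicit Arguments.
Unset Strict Implicit.
Unset Printing Implicit Defensive.

Import Order.TTheory GRing.Theory Num.Theory.

Local Open Scope classical_set_scope.
Local Open Scope ring_scope.

Section Metric.
Variables (Rl : realType) (V : zmodType) (nV : V -> Rl).

Definition cauchy_seq (u : nat -> V) : Prop :=
  forall e : Rl, 0 < e -> exists N : nat,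
    forall m n, (N <= m)%N -> (N <= n)%N -> nV (u m - u n) < e.

Definition tends_to (u : nat -> V) (l : V) : Prop :=
  forall e : Rl, 0 < e -> exists N : nat,
    forall n, (N <= n)%N -> nV (u n - l) < e.

Definition norm_complete : Prop :=
  forall u, cauchy_seq u -> exists l, tends_to u l.

Definition norm_nbhs (x : V) : set (set V) :=
  [set O | exists2 e : Rl, 0 < e & forall y, nV (y - x) < e -> O y].

End Metric.

(* Closure and density with respect to a system of neighbourhoods. *)
Definition clos (T : Type) (nb : T -> set (set T)) (X : set T) : set T :=
  [set x | forall O, nb x O -> exists2 y, X y & O y].

Definition dense_in (T : Type) (nb : T -> set (set T)) (X : set T) : Prop :=
  forall x, clos nb X x.

Section ValuedField.
Variables (Rl : realType) (K : fieldType) (abs : K -> Rl).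

Definition nonarch_abs : Prop :=
  [/\ forall x, 0 <= abs x,
      forall x, abs x = 0 <-> x = 0,
      forall x y, abs (x * y) = abs x * abs y
    & forall x y, abs (x + y) <= Num.max (abs x) (abs y)].

Definition discrete_abs : Prop :=
  exists w : K, [/\ 0 < abs w, abs w < 1
    & forall x, x != 0 -> exists n : int, abs x = abs w ^ n].

(* The normalized absolute value of K restricts to the p-adic one on the image
   of nat, hence on Q; as K is complete, the closure of Q in K is then Q_p. *)
Definition extends_padic (p : nat) : Prop :=
  forall n : nat, (0 < n)%N -> abs n%:R = (p%:R ^+ logn p n)^-1.

Record complete_dv_ext_of_Qp (p : nat) : Prop := {
  dv_abs : nonarch_abs;
  dv_complete : norm_complete abs;
  dv_discrete : discrete_abs;
  dv_padic : extends_padic p }.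

Definition banach (V : lmodType K) (nV : V -> Rl) : Prop :=
  [/\ forall v, 0 <= nV v,
      forall v, nV v = 0 -> v = 0,
      forall a v, nV (a *: v) = abs a * nV v,
      forall u v, nV (u + v) <= Num.max (nV u) (nV v)
    & norm_complete nV].

Definition banach_alg (S : algType K) (nS : S -> Rl) : Prop :=
  banach nS /\ forall x y, nS (x * y) <= nS x * nS y.

End ValuedField.

Section Noetherian.
Variable (S : pzRingType).

Definition ideal_for (mul : S -> S -> S) (D I : set S) : Prop :=
  [/\ I `<=` D, I 0, forall x y, I x -> I y -> I (x + y)
    & forall s x, D s -> I x -> I (mul s x)].

Definition fg_ideal_for (mul : S -> S -> S) (D I : set S) : Prop :=
  exists (k : nat) (g : 'I_k -> S), (forall i, I (g i)) /\
    forall x, I x -> exists a : 'I_k -> S,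
      (forall i, D (a i)) /\ x = \sum_i mul (a i) (g i).

(* The subring D of S is left and right noetherian. *)
Definition noetherian (D : set S) : Prop :=
  (forall I, ideal_for *%R D I -> fg_ideal_for *%R D I) /\
  (forall I, ideal_for (fun s x => x * s) D I ->
             fg_ideal_for (fun s x => x * s) D I).

End Noetherian.

Section Modules.

Definition submodule (S : pzRingType) (M : lmodType S) (N : set M) : Prop :=
  [/\ N 0, forall x y, N x -> N y -> N (x + y)
    & forall s x, N x -> N (s *: x)].

Definition irreducible (S : pzRingType) (M : lmodType S) : Prop :=
  (exists x : M, x <> 0) /\
  forall N : set M, submodule N -> N = [set 0] \/ N = setT.

Definition semisimple_alg (K : fieldType) (S : algType K) : Prop :=
  forall I : set S^o, submodule I -> exists J : set S^o,
    [/\ submodule J, I `&` J = [set 0]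
      & forall x, exists y z, [/\ I y, J z & x = y + z]].

Definition split_alg (K : fieldType) (S : algType K) : Prop :=
  forall W : lmodType S, irreducible W ->
  forall f : {linear W -> W}, exists c : K, forall w, f w = (c%:A : S) *: w.

(* Generation by finitely many elements with coefficients in D. *)
Definition generates (S : pzRingType) (M : lmodType S) (D : set S) (k : nat)
    (g : 'I_k -> M) : Prop :=
  forall m, exists a : 'I_k -> S,
    (forall i, D (a i)) /\ m = \sum_i a i *: g i.

Definition finite_over (S : pzRingType) (M : lmodType S) (D : set S) : Prop :=
  exists (k : nat) (g : 'I_k -> M), generates D g.

(* For X a subspace. *)
Definition findim (K : fieldType) (U : lmodType K) (X : set U) : Prop :=
  exists (k : nat) (e : 'I_k -> U), (forall i, X (e i)) /\
    forall x, X x -> exists c : 'I_k -> K, x = \sum_i c i *: e i.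

End Modules.

(* The K-vector space underlying a module over a K-algebra. *)
Definition restr (K : fieldType) (S : algType K) (M : lmodType S) : Type := M.

Section Restr.
Variables (K : fieldType) (S : algType K) (M : lmodType S).
HB.instance Definition _ := GRing.Zmodule.on (restr M).

Definition restr_scale (c : K) (m : restr M) : restr M := (c%:A : S) *: (m : M).

Fact restr_scaleA a b v :
  restr_scale a (restr_scale b v) = restr_scale (a * b) v.
Proof. by rewrite /restr_scale scalerA mulr_algl scalerA. Qed.
Fact restr_scale1 : left_id 1 restr_scale.
Proof. by move=> v; rewrite /restr_scale !scale1r. Qed.
Fact restr_scaleDr : right_distributive restr_scale +%R.
Proof. by move=> a u v; rewrite /restr_scale scalerDr. Qed.
Fact restr_scaleDl v : {morph restr_scale^~ v : a b / a + b}.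
Proof. by move=> a b; rewrite /restr_scale !scalerDl. Qed.

HB.instance Definition _ := GRing.Zmodule_isLmodule.Build K (restr M)
  restr_scaleA restr_scale1 restr_scaleDr restr_scaleDl.
End Restr.

(* The K-algebra underlying a subalgebra. *)
Record subalg (K : fieldType) (S : algType K) (D : subalgClosed S) : Type :=
  Subalg { subalg_val : S; subalg_valP : subalg_val \in D }.

Section Subalg.
Variables (K : fieldType) (S : algType K) (D : subalgClosed S).
HB.instance Definition _ := [isSub for @subalg_val K S D].
HB.instance Definition _ := [Choice of subalg D by <:].
HB.instance Definition _ := [SubChoice_isSubAlgebra of subalg D by <:].
End Subalg.

Section Sums.
Variables (K : fieldType) (U : lmodType K) (I : choiceType).

(* The subspace \sum_(i in P) V_ i of U. *)
Definition sum_of (P : set I) (V_ : I -> set U) : set U :=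
  [set x | exists (F : {fset I}) (x_ : I -> U),
     (forall i, i \in F -> P i /\ V_ i (x_ i)) /\ x = \sum_(i <- F) x_ i].

Definition independent (V_ : I -> set U) : Prop :=
  forall (F : {fset I}) (x_ : I -> U), (forall i, i \in F -> V_ i (x_ i)) ->
    \sum_(i <- F) x_ i = 0 -> forall i, i \in F -> x_ i = 0.

End Sums.

Section Products.
Variables (S : pzRingType).

(* X.Y: the finite sums of products x * y. *)
Definition prodset (X Y : set S) : set S :=
  [set z | exists (k : nat) (x y : 'I_k -> S),
     (forall i, X (x i) /\ Y (y i)) /\ z = \sum_i x i * y i].

Definition ideal_gen (D X : set S) : set S := prodset D (prodset X D).

End Products.

Section Weights.
(* V is a subspace of U stable under f, carrying the topology induced by nb. *)
Variables (K : fieldType) (U : lmodType K) (nb : U -> set (set U)).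
Variables (V : set U) (f : U -> U).

Definition wspace (l : K) : set U :=
  [set v | V v /\ exists n0 : nat, forall n, (n0 <= n)%N ->
     iter n (fun x => f x - l *: x) v = 0].

Definition weights : set K := [set l | exists2 v, wspace l v & v <> 0].

(* The sum is direct, generalized eigenspaces being independent. *)
Definition wsum : set U := sum_of weights wspace.

Definition converges_to (I : set K) (v_ : K -> U) (v : U) : Prop :=
  forall O, nb v O -> exists F0 : {fset K}, [set` F0] `<=` I /\
    forall F : {fset K}, [set` F0] `<=` [set` F] -> [set` F] `<=` I ->
      O (\sum_(l <- F) v_ l).

Definition wdecomp_for (I : set K) : Prop :=
  I `<=` weights /\
  forall v, V v -> exists v_ : K -> U,
    (forall l, I l -> wspace l (v_ l)) /\ converges_to I v_ v.

Definition wdecomp : Prop := exists I, wdecomp_for I.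

Definition ss_wdecomp : Prop := exists I, wdecomp_for I /\
  forall l v, I l -> wspace l v -> f v = l *: v.

End Weights.

Section Tensor.
Variables (Rl : realType) (K : fieldType) (abs : K -> Rl).

Definition bounded_map (X Y : lmodType K) (nX : X -> Rl) (nY : Y -> Rl)
    (f : X -> Y) : Prop :=
  exists C : Rl, forall x, nY (f x) <= C * nX x.

Definition bilin (X Y Z : lmodType K) (f : X -> Y -> Z) : Prop :=
  (forall y, linear (f^~ y)) /\ (forall x, linear (f x)).

Definition bounded_map2 (X Y Z : lmodType K) (nX : X -> Rl) (nY : Y -> Rl)
    (nZ : Z -> Rl) (f : X -> Y -> Z) : Prop :=
  exists C : Rl, forall x y, nZ (f x y) <= C * (nX x * nY y).

Definition balanced (T : Type) (D : set T) (X Y Z : Type)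
    (xr : X -> T -> X) (yl : T -> Y -> Y) (f : X -> Y -> Z) : Prop :=
  forall x t y, D t -> f (xr x t) y = f x (yl t y).

(* tau : X * Y -> Z exhibits the Banach space Z as the completed tensor product
   of X and Y over D, where D acts on X from the right by xr and on Y from the
   left by yl. *)
Definition is_ctensor (T : Type) (D : set T) (X Y Z : lmodType K)
    (nX : X -> Rl) (nY : Y -> Rl) (nZ : Z -> Rl)
    (xr : X -> T -> X) (yl : T -> Y -> Y) (tau : X -> Y -> Z) : Prop :=
  [/\ banach abs nZ, bilin tau, bounded_map2 nX nY nZ tau, balanced D xr yl tau
    & forall (V : lmodType K) (nV : V -> Rl), banach abs nV ->
      forall f : X -> Y -> V,
        bilin f -> bounded_map2 nX nY nV f -> balanced D xr yl f ->
      exists! g : Z -> V,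
        [/\ linear g, bounded_map nZ nV g & forall x y, g (tau x y) = f x y]].

Definition lin_on (X Y : lmodType K) (D : set X) (f : X -> Y) : Prop :=
  forall k x y, D x -> D y -> f (k *: x + y) = k *: f x + f y.

Variables (S : algType K) (nS : S -> Rl).

Definition trilin_on (A H B : set S) (V : lmodType K) (f : S -> S -> S -> V) :=
  [/\ forall h b, H h -> B b -> lin_on A (fun a => f a h b),
      forall a b, A a -> B b -> lin_on H (fun h => f a h b)
    & forall a h, A a -> H h -> lin_on B (fun b => f a h b)].

Definition on_products (A H B : set S) (V : Type) (f : S -> S -> S -> V)
    (g : S -> V) : Prop :=
  forall a h b, A a -> H h -> B b -> g (a * h * b) = f a h b.

(* (a, h, b) |-> a * h * b exhibits R as the tensor product of A, H and B over K. *)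
Definition is_tensor3 (R A H B : set S) : Prop :=
  forall (V : lmodType K) (f : S -> S -> S -> V), trilin_on A H B f ->
    (exists g : S -> V, lin_on R g /\ on_products A H B f g) /\
    (forall g1 g2 : S -> V,
       lin_on R g1 -> on_products A H B f g1 ->
       lin_on R g2 -> on_products A H B f g2 -> forall x, R x -> g1 x = g2 x).

(* Likewise, S is the completed tensor product of its closed subspaces A, H, B,
   as a Banach space (that is, up to bounded isomorphism). *)
Definition is_ctensor3 (A H B : set S) : Prop :=
  forall (V : lmodType K) (nV : V -> Rl), banach abs nV ->
  forall f : S -> S -> S -> V, trilin_on A H B f ->
    (exists C : Rl, forall a h b, A a -> H h -> B b ->
       nV (f a h b) <= C * (nS a * nS h * nS b)) ->
    exists! g : S -> V,
      [/\ linear g, bounded_map nS nV g & on_products A H B f g].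

End Tensor.

Section AlgebraicDecomposition.
Variables (K : fieldType) (S : algType K).
(* R and its graded pieces gr n live in an ambient algebra S. *)
Variables (R : subalgClosed S) (gr : int -> set S).
Variables (A B H : subalgClosed S) (d : S).

Definition graded_alg : Prop :=
  [/\ forall n k x y, gr n x -> gr n y -> gr n (k *: x + y),
      gr 0 1,
      forall m n x y, gr m x -> gr n y -> gr (m + n) (x * y),
      [set` R] = sum_of setT gr
    & independent gr].

Definition piece (D : subalgClosed S) (n : int) : set S := [set` D] `&` gr n.

(* B^n and B^{>n}, with the sign convention B^n = B_{-n}. *)
Definition Bup (n : nat) : set S := piece B (- n%:Z).
Definition Bgt (n : nat) : set S := sum_of [set m : nat | (n < m)%N] Bup.

Record alg_tri_decomp : Prop := {
  td_graded : graded_alg;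
  td_noeth : noetherian [set` R];
  td_subA : [set` A] `<=` [set` R];
  td_subB : [set` B] `<=` [set` R];
  td_subH : [set` H] `<=` gr 0;
  td_deg0 : gr 0 d;
  td_tensor : is_tensor3 [set` R] [set` A] [set` H] [set` B];
  td_BH : prodset [set` B] [set` H] = prodset [set` H] [set` B];
  td_HA : prodset [set` H] [set` A] = prodset [set` A] [set` H];
  td_gradA : [set` A] = sum_of [set n : int | 0 <= n] (piece A);
  td_gradB : [set` B] = sum_of [set n : int | n <= 0] (piece B);
  td_A0 : piece A 0 = [set x | exists k : K, x = k%:A];
  td_B0 : piece B 0 = [set x | exists k : K, x = k%:A];
  td_findim : forall n, findim (piece A n) /\ findim (piece B n);
  td_Hfin : findim [set` H];
  td_Hss : semisimple_alg (subalg H);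
  td_Hsplit : split_alg (subalg H);
  td_weight : forall n : int,
    gr n = [set x | x \in R /\ d * x - x * d = n%:~R *: x] }.

(* c = c(W): the scalar by which the component d0 in Z(H) of
   d = d' + d0, with d' in A.H.B^{>0}, acts on W. *)
Definition is_c (W : lmodType (subalg H)) (c : K) : Prop :=
  exists (d' : S) (d0 : subalg H),
    [/\ d = d' + val d0,
        prodset [set` A] (prodset [set` H] (Bgt 0)) d',
        forall h, d0 * h = h * d0
      & forall w : W, d0 *: w = (c%:A : subalg H) *: w].

Definition loc_nilpotent (M : lmodType S) (N : set M) : Prop :=
  forall m, N m -> exists n : nat, forall b, Bgt n b -> b *: m = 0.

End AlgebraicDecomposition.

Section BanachDecomposition.
(* S is the Banach algebra, and R its dense graded subalgebra. *)
Variables (Rl : realType) (K : fieldType) (abs : K -> Rl).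
Variables (S : algType K) (nS : S -> Rl).
Variables (R : subalgClosed S) (gr : int -> set S).
Variables (A B H : subalgClosed S) (d : S).

Definition closure_of (D : subalgClosed S) : set S :=
  clos (norm_nbhs nS) [set` D].

Definition ad (x : S) : S := d * x - x * d.

Record banach_tri_decomp : Prop := {
  btd_alg : alg_tri_decomp R gr A B H d;
  btd_dense : dense_in (norm_nbhs nS) [set` R];
  btd_tensor : is_ctensor3 abs nS (closure_of A) [set` H] (closure_of B);
  btd_wsA : ss_wdecomp (norm_nbhs nS) (closure_of A) ad;
  btd_wsB : ss_wdecomp (norm_nbhs nS) (closure_of B) ad;
  btd_wsumA : wsum (closure_of A) ad = [set` A];
  btd_wsumB : wsum (closure_of B) ad = [set` B] }.

(* The completed tensor product of (closure of B) and H, as a closed subspace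
   of S, and its two-sided ideal generated by BH^{>n} = B^{>n}.H. *)
Definition cBH : set S :=
  clos (norm_nbhs nS) (prodset (closure_of B) [set` H]).
Definition cBHgt (n : nat) : set S :=
  ideal_gen cBH (prodset (Bgt gr B n) [set` H]).

(* A model of the completed Verma module hatDelta(W)_n, in three steps:
   Q = cBH / cBH^{>n} with its quotient norm and right H-action,
   N = Q \hat\otimes_H W with its left cBH-action, and
   S \hat\otimes_cBH N with its left S-module structure.
   The maps pi and act are only meaningful on cBH.  As W is finite
   dimensional and K complete, all norms on W are equivalent. *)
Record hatDelta (W : lmodType (subalg H)) (n : nat) : Type := HatDelta {
  hd_nW : restr W -> Rl;
  hd_nWP : banach abs hd_nW;

  hd_Q : lmodType K;
  hd_nQ : hd_Q -> Rl;
  hd_nQP : banach abs hd_nQ;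
  hd_pi : S -> hd_Q;
  hd_pi_lin : lin_on cBH hd_pi;
  hd_pi_surj : forall q, exists2 x, cBH x & q = hd_pi x;
  hd_pi_ker : forall x, cBH x -> (hd_pi x = 0 <-> cBHgt n x);
  hd_pi_norm : forall x, cBH x ->
    hd_nQ (hd_pi x) = inf [set nS (x + y) | y in cBHgt n];
  hd_Qr : hd_Q -> subalg H -> hd_Q;
  hd_QrP : forall x h, cBH x -> hd_Qr (hd_pi x) h = hd_pi (x * val h);

  hd_N : lmodType K;
  hd_nN : hd_N -> Rl;
  hd_tau : hd_Q -> restr W -> hd_N;
  hd_tauP : is_ctensor abs setT hd_nQ hd_nW hd_nN hd_Qr
              (fun h (w : restr W) => (h *: (w : W) : restr W)) hd_tau;
  hd_act : S -> hd_N -> hd_N;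
  hd_actP : forall x, cBH x ->
    linear (hd_act x) /\ bounded_map hd_nN hd_nN (hd_act x);
  hd_act_tau : forall x y w, cBH x -> cBH y ->
    hd_act x (hd_tau (hd_pi y) w) = hd_tau (hd_pi (x * y)) w;

  hd_mod :> lmodType S;
  hd_nmod : restr hd_mod -> Rl;
  hd_sigma : S -> hd_N -> restr hd_mod;
  hd_sigmaP : is_ctensor abs cBH nS hd_nN hd_nmod *%R hd_act hd_sigma;
  hd_mod_bounded : exists C : Rl, forall (x : S) (v : hd_mod),
    hd_nmod (x *: v) <= C * (nS x * hd_nmod v);
  hd_mod_sigma : forall (x y : S) (v : hd_N),
    x *: (hd_sigma y v : hd_mod) = hd_sigma (x * y) v }.

Variable M : lmodType S.

(* Neighbourhoods for the canonical topology of a finitely generated module: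
   the quotient topology of S^k -> M for a generating family g (it does not
   depend on g). *)
Definition can_nbhs (m : restr M) : set (set (restr M)) :=
  [set O | forall (k : nat) (g : 'I_k -> M), generates setT g ->
     exists2 e : Rl, 0 < e & forall a : 'I_k -> S, (forall i, nS (a i) < e) ->
       O ((m : M) + \sum_i a i *: g i)].

Definition mod_op (m : restr M) : restr M := d *: (m : M).

Definition mod_weights : set K := weights [set: restr M] mod_op.
Definition mod_wspace : K -> set (restr M) := wspace [set: restr M] mod_op.
Definition mod_wsum : set (restr M) := wsum [set: restr M] mod_op.
Definition mod_wdecomp : Prop := wdecomp can_nbhs [set: restr M] mod_op.

Definition in_hatO : Prop :=
  [/\ finite_over M setT, finite_over M (closure_of A) & mod_wdecomp].

End BanachDecomposition.

(* Main.v *)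
Require Import Defs.
From HB Require Import structures.
From mathcomp Require Import all_boot all_order all_algebra.
From mathcomp Require Import finmap.
From mathcomp Require Import boolp classical_sets reals.
From mathcomp Require Import lra.

Set Implicit Arguments.
Unset Strict Implicit.
Unset Printing Implicit Defensive.

Import Order.TTheory GRing.Theory Num.Theory.

Local Open Scope classical_set_scope.
Local Open Scope ring_scope.

(** Everything rests on the fact that left ideals of S, of the closure cA of A
    and of the closure cB of B are closed (noetherian_closed): a finite system
    of generators of the closure of an ideal can be perturbed into the ideal,
    by the open mapping theorem and a Neumann series. In particular the
    annihilators of vectors of S-modules are closed.

    Generation over cA. If B^{>n} kills m, then S m is generated over cA by
    finitely many vectors h b m, with h in H and b in B homogeneous
    (killed_generated): the annihilator of m in cB is closed and contains
    B^{>n}, so it has finite codimension in cB, coordinates modulo it are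
    continuous, and the decomposition of S as a completed tensor product turns
    them into coefficients in cA.

    Weights over cA. Let M be generated over cA by weight vectors g_j of weights
    mu_j. Expanding the coefficients into homogeneous series gives a convergent
    weight decomposition of M (generated_wdecomp). The weights of M lie in the
    union of the sets mu_j + N and have finite multiplicities
    (generated_weights). Indeed, adding one vector at a time leads to the
    quotients cA / J by a left ideal J stable under ad(d), which is closed and
    hence contains the homogeneous components of its elements (components_in).
    These components are recovered as limits of polynomials in ad(d): the product
    of the l + i - ad(d) for 0 < i <= m, divided by m!, is 1 in degree l,
    vanishes in degrees l + 1 to l + m, and acts in higher degrees by binomial
    coefficients, up to sign. These are integers, so of absolute value at most 1.

    (i) implies (ii): M^ws is dense by the weight decomposition, so it contains
    generators of M over S (dense_generators), and they may be taken to be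
    weight vectors y. As M is finite over the noetherian ring cA, the cA-module
    generated by B y is finitely generated, so its weights are bounded below and
    some B^{>n} kills y (nilpotent_wt). The algebra H is a sum of simple left
    ideals H e, and e y is the image of the generator of the completed Verma
    module attached to H e and n (hatDelta_exists).

    (ii) implies (iii): a completed Verma module is generated by a vector killed
    by B^{>n} (hatDelta_cyclic), so M is generated over cA by vectors killed by
    some B^{>n}. On writing d = d' + d0, with d' in A H B^{>0}, induction on n
    shows that these are sums of weight vectors of weights c(W) + k
    (killed_wtsum). The results on weights over cA then apply.

    (iii) implies (iv): B^j lowers weights by j, and the weights of M are bounded
    below in each class modulo the integers.

    (iv) implies (i): by density, M is generated over S by weight vectors killed
    by some B^{>n}, hence over cA by the weight vectors h b y, and it has a
    convergent weight decomposition.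

    The completed Verma modules, characterized by universal properties, are
    constructed as quotients by closed subspaces with their quotient norms; the
    ideal of the completion of B H generated by B^{>n} H is closed because cB is
    noetherian (cBHgtE). *)

(** * Subspaces, norms and limits *)

Definition subspace (K : fieldType) (V : lmodType K) (X : set V) : Prop :=
  X 0 /\ forall k x y, X x -> X y -> X (k *: x + y).

Section Subspaces.
Variables (K : fieldType) (V : lmodType K) (X : set V).
Hypothesis hX : subspace X.

Lemma subspace0 : X 0. Proof. by case: hX. Qed.
Lemma subspaceD x y : X x -> X y -> X (x + y).
Proof. by move=> /(proj2 hX 1) h /h; rewrite scale1r. Qed.
Lemma subspaceZ k x : X x -> X (k *: x).
Proof. by move=> h; rewrite -[_ *: _]addr0; apply: (proj2 hX) => //; case: hX. Qed.
Lemma subspaceN x : X x -> X (- x).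
Proof. by rewrite -scaleN1r; apply: subspaceZ. Qed.
Lemma subspaceB x y : X x -> X y -> X (x - y).
Proof. by move=> hx hy; apply: subspaceD => //; apply: subspaceN. Qed.
Lemma subspace_sum (I : Type) (r : seq I) (P : pred I) (F : I -> V) :
  (forall i, P i -> X (F i)) -> X (\sum_(i <- r | P i) F i).
Proof. by move=> h; apply: big_ind => //; [exact: subspace0 | exact: subspaceD]. Qed.
End Subspaces.

Lemma subspace_zero (K : fieldType) (V : lmodType K) : subspace [set 0 : V].
Proof. by split=> // c x y -> ->; rewrite scaler0 addr0. Qed.

Lemma subspace_setT (K : fieldType) (V : lmodType K) : subspace [set: V].
Proof. by []. Qed.

Section Absolute.
Variables (Rl : realType) (K : fieldType) (abs : K -> Rl).
Hypothesis habs : nonarch_abs abs.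

Lemma abs_ge0 x : 0 <= abs x. Proof. by case: habs. Qed.
Lemma abs0 : abs 0 = 0. Proof. by case: habs => _ h _ _; apply/h. Qed.
Lemma absM x y : abs (x * y) = abs x * abs y. Proof. by case: habs. Qed.
Lemma abs_gt0 x : x != 0 -> 0 < abs x.
Proof.
move=> xn0; rewrite lt_neqAle abs_ge0 andbT eq_sym; apply/eqP.
by case: habs => _ h _ _ /h /eqP; apply/negP.
Qed.
Lemma abs1 : abs 1 = 1.
Proof.
have h : abs 1 * abs 1 = abs 1 * 1 by rewrite -absM !mulr1.
by apply: (mulfI _ h); rewrite gt_eqF ?abs_gt0 ?oner_neq0.
Qed.
Lemma absV x : abs x^-1 = (abs x)^-1.
Proof.
have [->|xn0] := eqVneq x 0; first by rewrite invr0 abs0 invr0.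
have h := abs_gt0 xn0.
by apply: (mulfI (lt0r_neq0 h)); rewrite -absM !divff ?abs1 ?lt0r_neq0.
Qed.
Lemma absX x n : abs (x ^+ n) = abs x ^+ n.
Proof. by elim: n => [|n IH]; rewrite ?expr0 ?abs1 // !exprS absM IH. Qed.
Lemma absN1 : abs (-1) = 1.
Proof.
have /eqP : abs (-1) ^+ 2 = 1 by rewrite -absX sqrrN expr1n abs1.
by rewrite sqrp_eq1 ?abs_ge0 // => /eqP.
Qed.
Lemma absD_le e x y : abs x <= e -> abs y <= e -> abs (x + y) <= e.
Proof.
move=> hx hy; case: habs => _ _ _ /(_ x y) /le_trans; apply.
by rewrite ge_max hx hy.
Qed.
Lemma abs_nat_le1 n : abs n%:R <= 1.
Proof.
by elim: n => [|n IH]; rewrite ?abs0 // -natr1; apply: absD_le => //; rewrite abs1.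
Qed.
End Absolute.

(** The absolute value of a nonzero integer is a power of p. *)
Lemma padic_char0 (Rl : realType) (p : nat) (K : fieldType) (abs : K -> Rl) :
  prime p -> complete_dv_ext_of_Qp abs p -> forall n : nat, n%:R = 0 :> K -> n = 0%N.
Proof.
move=> hp hK [//|n] e; have := dv_padic hK (ltn0Sn n); rewrite e (abs0 (dv_abs hK)) => /esym/eqP.
by rewrite invr_eq0 expf_eq0 pnatr_eq0 => /andP[_ /eqP p0]; rewrite p0 in hp.
Qed.

Section Norms.
Variables (Rl : realType) (K : fieldType) (abs : K -> Rl).
Hypothesis habs : nonarch_abs abs.
Variables (V : lmodType K) (nV : V -> Rl).
Hypothesis hV : banach abs nV.

Lemma norm_ge0 x : 0 <= nV x. Proof. by case: hV. Qed.
Lemma normZ a x : nV (a *: x) = abs a * nV x. Proof. by case: hV. Qed.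
Lemma norm_eq0 x : nV x = 0 -> x = 0. Proof. by case: hV => _ h _ _ _; apply: h. Qed.
Lemma norm0 : nV 0 = 0.
Proof. by rewrite -[0](scale0r 0) normZ (abs0 habs) mul0r. Qed.
Lemma normN x : nV (- x) = nV x.
Proof. by rewrite -scaleN1r normZ (absN1 habs) mul1r. Qed.
Lemma normBC x y : nV (x - y) = nV (y - x).
Proof. by rewrite -normN opprB. Qed.
Lemma normD_le e x y : nV x <= e -> nV y <= e -> nV (x + y) <= e.
Proof.
move=> hx hy; case: hV => _ _ _ /(_ x y) /le_trans h _; apply: h.
by rewrite ge_max hx hy.
Qed.
Lemma normD_lt e x y : nV x < e -> nV y < e -> nV (x + y) < e.
Proof.
move=> hx hy; case: hV => _ _ _ /(_ x y) /le_lt_trans h _; apply: h.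
by rewrite gt_max hx hy.
Qed.
Lemma normB_lt e x y : nV x < e -> nV y < e -> nV (x - y) < e.
Proof. by move=> hx hy; apply: normD_lt; rewrite ?normN. Qed.
Lemma normB_le e x y : nV x <= e -> nV y <= e -> nV (x - y) <= e.
Proof. by move=> hx hy; apply: normD_le; rewrite ?normN. Qed.
Lemma norm_trans_lt e y x z : nV (x - y) < e -> nV (y - z) < e -> nV (x - z) < e.
Proof.
by move=> h1 h2; have -> : x - z = (x - y) + (y - z); [rewrite addrA subrK | exact: normD_lt].
Qed.
Lemma norm_sum_le (I : Type) (r : seq I) (P : pred I) (F : I -> V) e : 0 <= e ->
  (forall i, P i -> nV (F i) <= e) -> nV (\sum_(i <- r | P i) F i) <= e.
Proof.
move=> e0 h; apply: (big_ind (fun x => nV x <= e)) => //; first by rewrite norm0.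
exact: normD_le.
Qed.
Lemma norm_sum_lt (I : Type) (r : seq I) (P : pred I) (F : I -> V) e : 0 < e ->
  (forall i, P i -> nV (F i) < e) -> nV (\sum_(i <- r | P i) F i) < e.
Proof.
move=> e0 h; apply: (big_ind (fun x => nV x < e)) => //; first by rewrite norm0.
exact: normD_lt.
Qed.
Lemma norm_small0 x : (forall e, 0 < e -> nV x < e) -> x = 0.
Proof.
move=> h; apply: norm_eq0; apply/eqP; rewrite eq_le norm_ge0 andbT leNgt.
by apply/negP => /h; rewrite ltxx.
Qed.

Lemma tends_cst x : tends_to nV (fun _ => x) x.
Proof. by move=> e e0; exists 0%N => n _; rewrite subrr norm0. Qed.
Lemma tendsD u v x y : tends_to nV u x -> tends_to nV v y ->
  tends_to nV (fun n => u n + v n) (x + y).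
Proof.
move=> hu hv e e0; have [N1 h1] := hu e e0; have [N2 h2] := hv e e0.
exists (maxn N1 N2) => n; rewrite geq_max => /andP[n1 n2].
rewrite opprD addrACA; apply: normD_lt; [exact: h1 | exact: h2].
Qed.
Lemma tends_ext u v x : (forall n, u n = v n) -> tends_to nV u x -> tends_to nV v x.
Proof. by move=> h; have -> : v = u by apply/funext => n; rewrite h. Qed.
Lemma tendsB u v x y : tends_to nV u x -> tends_to nV v y ->
  tends_to nV (fun n => u n - v n) (x - y).
Proof.
move=> hu hv; apply: tendsD => // e /hv[N hN]; exists N => n /hN.
by rewrite -opprD normN.
Qed.
Lemma tends_sum (I : Type) (r : seq I) (P : pred I) (u : I -> nat -> V) (l : I -> V) :
  (forall i, P i -> tends_to nV (u i) (l i)) ->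
  tends_to nV (fun n => \sum_(i <- r | P i) u i n) (\sum_(i <- r | P i) l i).
Proof.
move=> h; elim: r => [|i r IH].
  by apply: (@tends_ext (fun _ => 0)) => [n|]; rewrite big_nil //; apply: tends_cst.
rewrite big_cons; case: ifP => Pi.
  apply: (@tends_ext (fun n => u i n + \sum_(j <- r | P j) u j n)) => [n|].
    by rewrite big_cons Pi.
  by apply: tendsD => //; apply: h.
by apply: tends_ext IH => n; rewrite big_cons Pi.
Qed.
Lemma tends_uniq u x y : tends_to nV u x -> tends_to nV u y -> x = y.
Proof.
move=> hx hy; apply/eqP; rewrite -subr_eq0; apply/eqP; apply: norm_small0 => e e0.
have [N1 h1] := hx e e0; have [N2 h2] := hy e e0.
apply: (@norm_trans_lt _ (u (maxn N1 N2))).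
  by rewrite normBC; apply: h1; apply: leq_maxl.
by apply: h2; apply: leq_maxr.
Qed.
Lemma tends_norm_le u x e N :
  (forall n, (N <= n)%N -> nV (u n) <= e) -> tends_to nV u x -> nV x <= e.
Proof.
move=> h hu; rewrite leNgt; apply/negP => hlt.
have e0 : 0 < nV x by apply: le_lt_trans hlt; apply: le_trans (h _ (leqnn N)); apply: norm_ge0.
have [N2 h2] := hu _ e0.
have := h2 _ (leq_maxr N N2); have := h _ (leq_maxl N N2).
set z := u _ => hz; rewrite ltNge => /negP; apply.
have -> : nV x = Num.max (nV x) (nV z).
  by rewrite max_l //; apply/ltW; apply: le_lt_trans hlt.
rewrite leNgt; apply/negP; rewrite max_l; last by apply/ltW; apply: le_lt_trans hlt.
move=> hzx; have : nV x < nV x; last by rewrite ltxx.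
have -> : x = z - (z - x) by rewrite opprB addrCA subrr addr0.
rewrite {2}opprB addrCA subrr addr0.
by apply: normB_lt => //; apply: le_lt_trans hlt.
Qed.
Lemma tends_shift u x N : tends_to nV u x -> tends_to nV (fun n => u (n + N)%N) x.
Proof.
by move=> h e /h [M hM]; exists M => n hn; apply: hM; apply: leq_trans (leq_addr _ _).
Qed.

(** By the ultrametric inequality the partial sums form a Cauchy sequence as
    soon as the terms tend to 0. *)
Lemma series_cvg (z : nat -> V) : tends_to nV z 0 ->
  exists x, tends_to nV (fun n => \sum_(i < n) z i) x.
Proof.
move=> hz; case: hV => _ _ _ _; apply=> e e0.
have [N hN] := hz e e0; exists N.
have key m n : (N <= m)%N -> (m <= n)%N ->
    nV (\sum_(i < n) z i - \sum_(i < m) z i) < e.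
  move=> Nm mn; rewrite -!(big_mkord xpredT) (@big_cat_nat _ _ _ m) //= addrAC subrr add0r.
  rewrite big_seq; apply: norm_sum_lt => // i; rewrite mem_index_iota => /andP[mi _].
  by rewrite -[z i]subr0; apply: hN; apply: leq_trans mi.
move=> m n Nm Nn; case/orP: (leq_total m n) => h; last exact: key.
by rewrite normBC; apply: key.
Qed.
Lemma series_tail_le (z : nat -> V) x k e : 0 <= e ->
  tends_to nV (fun n => \sum_(i < n) z i) x -> (forall i, (k <= i)%N -> nV (z i) <= e) ->
  nV (x - \sum_(i < k) z i) <= e.
Proof.
move=> e0 hx hz; apply: (@tends_norm_le (fun n => \sum_(i < n) z i - \sum_(i < k) z i) _ _ k).
  move=> n kn; rewrite -!(big_mkord xpredT) (@big_cat_nat _ _ _ k) //= addrAC subrr add0r.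
  rewrite big_seq; apply: norm_sum_le => // i; rewrite mem_index_iota => /andP[ki _].
  exact: hz.
by apply: tendsD => //; apply: tends_cst.
Qed.

(** * Closed sets *)

Definition is_closed (X : set V) : Prop := clos (norm_nbhs nV) X `<=` X.
Local Notation closure X := (clos (norm_nbhs nV) X).

Lemma closP X x : closure X x <-> forall e, 0 < e -> exists2 y, X y & nV (y - x) < e.
Proof.
split=> [h e e0|h O [e e0 he]]; first by apply: h; exists e.
by have [y Xy hy] := h e e0; exists y => //; apply: he.
Qed.
Lemma sub_clos X : X `<=` closure X.
Proof. by move=> x Xx; apply/closP => e e0; exists x; rewrite // subrr norm0. Qed.
Lemma closS X Y : X `<=` Y -> closure X `<=` closure Y.
Proof.
move=> h x /closP hx; apply/closP => e /hx [y Xy hy]; exists y => //; exact: h.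
Qed.
Lemma clos_closed X : is_closed (closure X).
Proof.
move=> x /closP hx; apply/closP => e e0; have [y /closP hy yx] := hx e e0.
by have [z Xz zy] := hy e e0; exists z => //; apply: norm_trans_lt yx.
Qed.
Lemma clos_min X Y : is_closed Y -> X `<=` Y -> closure X `<=` Y.
Proof. by move=> cY /closS h; apply: subset_trans h cY. Qed.
Lemma closed_tends X u x : is_closed X -> (forall n, X (u n)) -> tends_to nV u x -> X x.
Proof.
move=> cX hu hx; apply/cX/closP => e /hx [N hN]; exists (u N) => //; exact: hN.
Qed.
Lemma clos_seq X x : closure X x -> exists2 u, (forall n, X (u n)) & tends_to nV u x.
Proof.
move=> /closP h.
have /choice[u hu] : forall n : nat, exists y, X y /\ nV (y - x) < n.+1%:R^-1.
  by move=> n; have [|y Xy hy] := h n.+1%:R^-1; [rewrite invr_gt0 ltr0n | exists y].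
exists u => [n|e e0]; first by case: (hu n).
exists (Num.bound e^-1) => n hn; apply: lt_trans (proj2 (hu n)) _.
rewrite invf_plt ?posrE ?ltr0n //.
apply: lt_le_trans (archi_boundP _) _; first by rewrite invr_ge0 ltW.
by rewrite ler_nat; apply: leq_trans hn _.
Qed.
Lemma closed_zero : is_closed [set 0].
Proof.
by move=> x /closP hx; apply: norm_small0 => e /hx[y ->]; rewrite sub0r normN.
Qed.
Lemma closed_setT : is_closed setT. Proof. by []. Qed.
Lemma closedI X Y : is_closed X -> is_closed Y -> is_closed (X `&` Y).
Proof.
by move=> hX hY x hx; split; [apply/hX/(closS _ hx) | apply/hY/(closS _ hx)] => y [].
Qed.
Lemma clos_subspace X : subspace X -> subspace (closure X).
Proof.
move=> hX; split; first by apply: sub_clos; apply: subspace0.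
move=> k x y /clos_seq[u Xu ux] /closP hy; apply/closP => e e0.
have [y' Xy' hy'] := hy e e0.
have [kn0|kn0] := eqVneq k 0.
  by exists y' => //; rewrite kn0 scale0r add0r.
have ak := abs_gt0 habs kn0.
have [|N hN] := ux (e / abs k); first exact: divr_gt0.
exists (k *: u N + y'); first by case: hX => _; apply.
rewrite opprD addrACA -scalerBr; apply: normD_lt => //.
by rewrite normZ mulrC -ltr_pdivlMr //; apply: hN.
Qed.

End Norms.

(** * Quotients of submodules *)

Section SubmoduleFacts.
Variables (R : pzRingType) (M : lmodType R) (N : set M).
Hypothesis hN : submodule N.
Lemma submodule0 : N 0. Proof. by case: hN. Qed.
Lemma submoduleD x y : N x -> N y -> N (x + y). Proof. by case: hN => _ h _; apply: h. Qed.
Lemma submoduleZ s x : N x -> N (s *: x). Proof. by case: hN => _ _ h; apply: h. Qed.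
Lemma submoduleN x : N x -> N (- x).
Proof. by rewrite -scaleN1r; apply: submoduleZ. Qed.
Lemma submoduleB x y : N x -> N y -> N (x - y).
Proof. by move=> hx hy; apply: submoduleD => //; apply: submoduleN. Qed.
End SubmoduleFacts.

Lemma submodule_setT (R : pzRingType) (M : lmodType R) : submodule [set: M].
Proof. by []. Qed.

Section Subquotient.
Variables (R : pzRingType) (M : lmodType R) (P N : set M).
Hypotheses (hP : submodule P) (hN : submodule N).

Definition coset_repr (x : M) : M := xget 0 [set y | P y /\ N (y - x)].

Lemma coset_reprP x : P x -> P (coset_repr x) /\ N (coset_repr x - x).
Proof.
move=> Px; have := @xgetPex _ 0 [set y | P y /\ N (y - x)].
by apply; exists x; split; rewrite // subrr; apply: submodule0.
Qed.
Lemma coset_repr_eq x y : N (x - y) -> coset_repr x = coset_repr y.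
Proof.
move=> Nxy; congr xget; apply/seteqP; split=> z [Pz Nz]; split => //.
  by rewrite -(subrK x z) -addrA; apply: submoduleD.
by rewrite -(subrK y z) -addrA; apply: submoduleD => //; rewrite -opprB; apply: submoduleN.
Qed.

(** The image of P in M / N, whose elements are encoded by canonical
    representatives chosen in P; N need not be contained in P. *)
Record subquotient (hP' : submodule P) (hN' : submodule N) : Type :=
  SubQuot { sq_rep : M; sq_repP : `[< P sq_rep /\ coset_repr sq_rep = sq_rep >] }.
Local Notation subquot := (subquotient hP hN).

HB.instance Definition _ := [isSub of subquot for @sq_rep hP hN].
HB.instance Definition _ := [Choice of subquot by <:].

Lemma sq_repI (q : subquot) : P (sq_rep q). Proof. by have [] := asboolW (sq_repP q). Qed.

Definition or0 (x : M) : M := if `[< P x >] then x else 0.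
Lemma or0P x : P (or0 x).
Proof. by rewrite /or0; case: asboolP => // _; apply: submodule0. Qed.
Lemma or0_id x : P x -> or0 x = x.
Proof. by move=> Px; rewrite /or0; case: asboolP. Qed.

Lemma sq_pi_subproof x : `[< P (coset_repr (or0 x)) /\ coset_repr (coset_repr (or0 x)) = coset_repr (or0 x) >].
Proof.
have [h1 h2] := coset_reprP (or0P x).
by apply/asboolP; split => //; apply: coset_repr_eq.
Qed.
Definition sq_pi (x : M) : subquot := @SubQuot hP hN _ (sq_pi_subproof x).

Lemma sq_rep_pi x : P x -> sq_rep (sq_pi x) = coset_repr x.
Proof. by move=> Px /=; rewrite or0_id. Qed.
Lemma sq_piP x : P x -> N (sq_rep (sq_pi x) - x).
Proof. by move=> Px; rewrite sq_rep_pi //; have [] := coset_reprP Px. Qed.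
Lemma sq_repK (q : subquot) : sq_pi (sq_rep q) = q.
Proof.
apply/val_inj; rewrite [LHS]/= or0_id; last exact: sq_repI.
by have [] := asboolW (sq_repP q).
Qed.
Lemma sq_surj (q : subquot) : exists2 x, P x & q = sq_pi x.
Proof. by exists (sq_rep q); [apply: sq_repI | rewrite sq_repK]. Qed.
Lemma sq_pi_eq x y : P x -> P y -> sq_pi x = sq_pi y <-> N (x - y).
Proof.
move=> Px Py; split=> [e|Nxy]; last first.
  by apply/val_inj; rewrite [LHS]/= [RHS]/= !or0_id //; apply: coset_repr_eq.
have := sq_piP Px; rewrite e => h1; have h2 := sq_piP Py.
by have := submoduleB hN h2 h1; rewrite opprB addrC addrA subrK.
Qed.

Definition sq_add (q r : subquot) := sq_pi (sq_rep q + sq_rep r).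
Definition sq_opp (q : subquot) := sq_pi (- sq_rep q).
Definition sq_scale (s : R) (q : subquot) := sq_pi (s *: sq_rep q).

Lemma sq_piD' x y : P x -> P y -> sq_add (sq_pi x) (sq_pi y) = sq_pi (x + y).
Proof.
move=> Px Py; apply/sq_pi_eq; try by apply: submoduleD => //; apply: sq_repI.
by rewrite opprD addrACA; apply: submoduleD => //; apply: sq_piP.
Qed.
Lemma sq_piN' x : P x -> sq_opp (sq_pi x) = sq_pi (- x).
Proof.
move=> Px; apply/sq_pi_eq; try by apply: submoduleN => //; apply: sq_repI.
by rewrite -opprD; apply: submoduleN => //; apply: sq_piP.
Qed.
Lemma sq_piZ' s x : P x -> sq_scale s (sq_pi x) = sq_pi (s *: x).
Proof.
move=> Px; apply/sq_pi_eq; try by apply: submoduleZ => //; apply: sq_repI.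
by rewrite -scalerBr; apply: submoduleZ => //; apply: sq_piP.
Qed.

Fact sq_addA : associative sq_add.
Proof.
move=> q r s; have [x Px ->] := sq_surj q; have [y Py ->] := sq_surj r.
have [z Pz ->] := sq_surj s; rewrite !sq_piD' ?addrA //; exact: submoduleD.
Qed.
Fact sq_addC : commutative sq_add.
Proof. by move=> q r; rewrite /sq_add addrC. Qed.
Fact sq_add0 : left_id (sq_pi 0) sq_add.
Proof.
move=> q; have [x Px ->] := sq_surj q; rewrite sq_piD' ?add0r //; exact: submodule0.
Qed.
Fact sq_addN : left_inverse (sq_pi 0) sq_opp sq_add.
Proof.
move=> q; have [x Px ->] := sq_surj q; rewrite sq_piN' // sq_piD' ?addNr //.
exact: submoduleN.
Qed.
HB.instance Definition _ :=
  GRing.isZmodule.Build subquot sq_addA sq_addC sq_add0 sq_addN.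

Fact sq_scaleA a b q : sq_scale a (sq_scale b q) = sq_scale (a * b) q.
Proof.
have [x Px ->] := sq_surj q; rewrite !sq_piZ' ?scalerA //; exact: submoduleZ.
Qed.
Fact sq_scale1 : left_id 1 sq_scale.
Proof. by move=> q; have [x Px ->] := sq_surj q; rewrite sq_piZ' ?scale1r. Qed.
Fact sq_scaleDr : right_distributive sq_scale +%R.
Proof.
move=> s q r; have [x Px ->] := sq_surj q; have [y Py ->] := sq_surj r.
rewrite [_ + _]sq_piD' // !sq_piZ' //; last exact: submoduleD.
rewrite [RHS]sq_piD' ?scalerDr //; exact: submoduleZ.
Qed.
Fact sq_scaleDl q : {morph sq_scale^~ q : a b / a + b}.
Proof.
move=> a b; have [x Px ->] := sq_surj q; rewrite !sq_piZ' //.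
rewrite [RHS]sq_piD' ?scalerDl //; exact: submoduleZ.
Qed.
HB.instance Definition _ := GRing.Zmodule_isLmodule.Build R subquot
  sq_scaleA sq_scale1 sq_scaleDr sq_scaleDl.

Lemma sq_piD x y : P x -> P y -> sq_pi (x + y) = sq_pi x + sq_pi y.
Proof. by move=> Px Py; rewrite [RHS]sq_piD'. Qed.
Lemma sq_piZ s x : P x -> sq_pi (s *: x) = s *: sq_pi x.
Proof. by move=> Px; rewrite [RHS]sq_piZ'. Qed.
Lemma sq_pi0 : sq_pi 0 = 0. Proof. by []. Qed.
Lemma sq_pi_lin s x y : P x -> P y -> sq_pi (s *: x + y) = s *: sq_pi x + sq_pi y.
Proof. by move=> Px Py; rewrite sq_piD ?sq_piZ //; apply: submoduleZ. Qed.
Lemma sq_pi_eq0 x : P x -> sq_pi x = 0 <-> N x.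
Proof.
move=> Px; rewrite -sq_pi0 sq_pi_eq ?subr0 //; exact: submodule0.
Qed.
End Subquotient.

Lemma subspace_submodule (K : fieldType) (V : lmodType K) (X : set V) :
  subspace X -> submodule X.
Proof.
move=> hX; split; [exact: subspace0 | exact: subspaceD |].
by move=> k x; apply: subspaceZ.
Qed.

Lemma lin_on0 (K : fieldType) (U V : lmodType K) (P : set U) (f : U -> V) :
  subspace P -> lin_on P f -> f 0 = 0.
Proof.
move=> hP hf; have /= := hf (-1) 0 0 (subspace0 hP) (subspace0 hP).
by rewrite scaler0 addr0 scaleN1r addNr.
Qed.
Lemma lin_onD (K : fieldType) (U V : lmodType K) (P : set U) (f : U -> V) x y :
  lin_on P f -> P x -> P y -> f (x + y) = f x + f y.
Proof. by move=> hf hx hy; have := hf 1 x y hx hy; rewrite !scale1r. Qed.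
Lemma lin_onZ (K : fieldType) (U V : lmodType K) (P : set U) (f : U -> V) k x :
  subspace P -> lin_on P f -> P x -> f (k *: x) = k *: f x.
Proof.
move=> hP hf hx; have := hf k x 0 hx (subspace0 hP).
by rewrite !addr0 (lin_on0 hP hf) addr0.
Qed.
Lemma lin_onB (K : fieldType) (U V : lmodType K) (P : set U) (f : U -> V) x y :
  subspace P -> lin_on P f -> P x -> P y -> f (x - y) = f x - f y.
Proof.
move=> hP hf hx hy; rewrite (lin_onD hf) //; last exact: subspaceN.
by rewrite -!scaleN1r (lin_onZ _ hP hf).
Qed.
Lemma lin_on_sum (K : fieldType) (U V : lmodType K) (P : set U) (f : U -> V)
    (I : Type) (r : seq I) (Q : pred I) (F : I -> U) :
  subspace P -> lin_on P f -> (forall i, Q i -> P (F i)) ->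
  f (\sum_(i <- r | Q i) F i) = \sum_(i <- r | Q i) f (F i).
Proof.
move=> hP hf hF; elim: r => [|i r IH]; first by rewrite !big_nil (lin_on0 hP hf).
rewrite !big_cons; case: ifP => // Qi.
by rewrite (lin_onD hf) ?IH //; [apply: hF | apply: subspace_sum].
Qed.

(** * Quotient norms *)

Section GeometricSequences.
Variable Rl : realType.
Implicit Types (a b e C : Rl).

Lemma geometric_small C e : 0 < e ->
  exists N, forall n, (N <= n)%N -> C / 2 ^+ n < e.
Proof.
move=> e0; exists (Num.bound (C / e)) => n hn.
rewrite ltr_pdivrMr ?exprn_gt0 // mulrC -ltr_pdivrMr //.
apply: le_lt_trans (ler_norm _) _; have := archi_boundP (normr_ge0 (C / e)).
have -> : Num.bound `|C / e| = Num.bound (C / e) by rewrite /Num.bound normr_id.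
move/lt_trans; apply; rewrite -natrX ltr_nat.
exact: leq_trans (ltn_expl _ _) (leq_pexp2l _ hn).
Qed.

Lemma expr_unbounded b e : 1 < b -> exists n, e < b ^+ n.
Proof.
move=> b1; have c0 : 0 < b - 1 by rewrite subr_gt0.
have h n : n%:R * (b - 1) < b ^+ n.
  elim: n => [|n IH]; first by rewrite mul0r expr0.
  have : 1 <= b ^+ n by apply: exprn_ege1; apply: ltW.
  rewrite exprS -natr1; nra.
exists (Num.bound (e / (b - 1))); apply: lt_trans (h _).
rewrite -ltr_pdivrMr //; apply: le_lt_trans (ler_norm _) _.
have := archi_boundP (normr_ge0 (e / (b - 1))).
by have -> : Num.bound `|e / (b - 1)| = Num.bound (e / (b - 1)) by rewrite /Num.bound normr_id.
Qed.
End GeometricSequences.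

Section Completeness.
Variables (Rl : realType) (K : fieldType) (abs : K -> Rl).
Hypothesis habs : nonarch_abs abs.

Section QuotientNorm.
Variables (U V : lmodType K) (nU : U -> Rl) (P : set U) (p : U -> V).
Hypotheses (hU : banach abs nU) (hP : subspace P) (cP : is_closed nU P).
Hypotheses (hp : lin_on P p) (sp : forall v, exists2 x, P x & p x = v).
Hypothesis kp : is_closed nU [set x | P x /\ p x = 0].

Definition qnorm (v : V) : Rl := inf [set nU x | x in [set x | P x /\ p x = v]].

Lemma qnorm_has_inf v : has_inf [set nU x | x in [set x | P x /\ p x = v]].
Proof.
split; first by have [x Px px] := sp v; exists (nU x), x.
by exists 0 => _ [x _ <-]; apply: norm_ge0 hU _.
Qed.
Lemma qnorm_le x : P x -> qnorm (p x) <= nU x.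
Proof. by move=> Px; apply: ge_inf; [case: (qnorm_has_inf (p x)) | exists x]. Qed.
Lemma qnorm_lift v e : qnorm v < e -> exists x, [/\ P x, p x = v & nU x < e].
Proof.
move=> h; have e0 : 0 < e - qnorm v by rewrite subr_gt0.
have [_ [x [Px px] <-]] := inf_adherent e0 (qnorm_has_inf v).
by rewrite -/(qnorm v) addrCA subrr addr0; exists x.
Qed.
Lemma le_qnorm v e : (forall x, P x -> p x = v -> e <= nU x) -> e <= qnorm v.
Proof.
move=> h; apply: lb_le_inf; first by case: (qnorm_has_inf v).
by move=> _ [x [Px px] <-]; apply: h.
Qed.
Lemma qnorm_ge0 v : 0 <= qnorm v.
Proof. by apply: le_qnorm => x _ _; apply: norm_ge0 hU _. Qed.

Lemma qnormD u v : qnorm (u + v) <= Num.max (qnorm u) (qnorm v).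
Proof.
rewrite leNgt; apply/negP; rewrite gt_max => /andP[hu hv].
have [x [Px px lx]] := qnorm_lift hu; have [y [Py py ly]] := qnorm_lift hv.
have h : p (x + y) = u + v by rewrite (lin_onD hp) // px py.
have := qnorm_le (subspaceD hP Px Py); rewrite h leNgt => /negP; apply.
exact: normD_lt hU _ _ _ lx ly.
Qed.

Lemma qnormZ_le a v : qnorm (a *: v) <= abs a * qnorm v.
Proof.
have [->|an0] := eqVneq a 0.
  rewrite scale0r (abs0 habs) mul0r -(lin_on0 hP hp).
  by apply: le_trans (qnorm_le (subspace0 hP)) _; rewrite (norm0 habs hU).
rewrite mulrC -ler_pdivrMr ?(abs_gt0 habs) //.
apply: le_qnorm => x Px px; rewrite ler_pdivrMr ?(abs_gt0 habs) // mulrC.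
rewrite -(normZ hU) -px -(lin_onZ _ hP hp) //.
by apply: qnorm_le; apply: subspaceZ.
Qed.

(** A Cauchy sequence has a subsequence whose increments lift to vectors of
    geometrically decreasing norm in P. The series of these lifts converges in
    P, and the image of its sum is the limit sought. *)
Theorem banach_qnorm : banach abs qnorm.
Proof.
have nZ a v : qnorm (a *: v) = abs a * qnorm v.
  apply/le_anti; rewrite qnormZ_le /=; have [->|an0] := eqVneq a 0.
    by rewrite (abs0 habs) mul0r qnorm_ge0.
  rewrite mulrC -ler_pdivlMr ?(abs_gt0 habs) // mulrC -(absV habs).
  by apply: le_trans (qnormZ_le _ _); rewrite scalerA mulVf // scale1r.
split; [exact: qnorm_ge0 | | exact: nZ | exact: qnormD |].
  move=> v v0; have [x Px px] := sp v; rewrite -px.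
  suff: [set x | P x /\ p x = 0] x by case.
  apply/kp/(closP nU) => e e0.
  have [|y [Py py hy]] := @qnorm_lift v e; first by rewrite v0.
  exists (x - y); last by rewrite addrAC subrr add0r (normN habs hU).
  by split; [apply: subspaceB | rewrite (lin_onB hP hp) // px py subrr].
move=> u hu.
have /choice[N hN] : forall k : nat, exists N, forall m n, (N <= m)%N -> (N <= n)%N ->
    qnorm (u m - u n) < 1 / 2 ^+ k.
  by move=> k; apply: hu; rewrite divr_gt0 // exprn_gt0.
pose M k := (\max_(i < k.+1) N i)%N.
have NM k : (N k <= M k)%N by apply: (leq_bigmax (ord_max : 'I_k.+1)).
have MM k : (M k <= M k.+1)%N by rewrite {2}/M big_ord_recr /= leq_maxl.
have /choice[z hz] : forall k : nat, exists z, [/\ P z, p z = u (M k.+1) - u (M k)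
    & nU z < 1 / 2 ^+ k].
  by move=> k; apply: qnorm_lift; apply: hN; apply: leq_trans (NM _) _.
have z0 : tends_to nU z 0.
  move=> e /(geometric_small 1)[k hk]; exists k => n /hk; rewrite subr0.
  by apply: lt_trans; have [] := hz n.
have [X hX] := series_cvg habs hU z0.
have PX : P X.
  by apply: closed_tends cP _ hX => n; apply: subspace_sum => // i _; have [] := hz i.
have [x0 Px0 px0] := sp (u (M 0%N)).
have psum k : p (\sum_(i < k) z i) = u (M k) - u (M 0%N).
  elim: k => [|k IH]; first by rewrite big_ord0 (lin_on0 hP hp) subrr.
  rewrite big_ord_recr (lin_onD hp) ?IH; first by have [_ -> _] := hz k; rewrite addrC addrA subrK.
    by apply: subspace_sum => // i _; have [] := hz i.
  by have [] := hz k.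
exists (p (x0 + X)) => e e0; have [k hk] := geometric_small 1 e0; exists (M k) => n hn.
have -> : u n - p (x0 + X) = (u n - u (M k)) + p (\sum_(i < k) z i - X).
  rewrite (lin_onD hp) // (lin_onB hP hp) ?psum ?px0 //.
    by rewrite opprD !addrA subrK addrAC.
  by apply: subspace_sum => // i _; have [] := hz i.
apply: le_lt_trans (hk _ (leqnn k)); apply: le_trans (qnormD _ _) _.
rewrite ge_max; apply/andP; split.
  by apply: ltW; apply: hN => //; apply: leq_trans hn.
apply: le_trans (qnorm_le _) _.
  by apply: subspaceB => //; apply: subspace_sum => // i _; have [] := hz i.
rewrite (normBC habs hU); apply: (series_tail_le habs hU _ hX) => [|i ki].
  by rewrite divr_ge0 ?exprn_ge0.
have [_ _ /ltW/le_trans] := hz i; apply.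
by rewrite ler_pM2l // lef_pV2 ?posrE ?exprn_gt0 // ler_weXn2l // ler1n.
Qed.
End QuotientNorm.
End Completeness.

(** * The open mapping theorem *)

Section OpenMapping.
Variables (Rl : realType) (K : fieldType) (abs : K -> Rl).
Hypothesis habs : nonarch_abs abs.
Variable w : K.
Hypotheses (w0 : 0 < abs w) (w1 : abs w < 1).

(** Norms can only be rescaled by elements of K, so that a prescribed value e
    is reached up to the factor abs w. *)
Lemma scale_into (s e : Rl) : 0 < s -> 0 < e ->
  exists2 c : K, c != 0 & e * abs w < abs c * s <= e.
Proof.
move=> s0 e0; have wn0 : w != 0 by apply: contraTneq w0 => ->; rewrite (abs0 habs) ltxx.
have b1 : 1 < (abs w)^-1 by rewrite invf_gt1.
have [M hM] := expr_unbounded (e / s) b1.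
have [n0 hn0] := expr_unbounded ((abs w)^-1 ^+ M * s / e) b1.
pose c n := w ^+ n * w^-1 ^+ M.
have ac n : abs (c n) = abs w ^+ n * (abs w)^-1 ^+ M.
  by rewrite (absM habs) !(absX habs) (absV habs).
have cn0 n : c n != 0 by rewrite mulf_neq0 // expf_neq0 // invr_eq0.
have ex : exists n, abs (c n) * s <= e.
  exists n0; rewrite ac -mulrA mulrC -ler_pdivlMr ?exprn_gt0 //.
  by move: hn0; rewrite ltr_pdivrMr // -exprVn [_ * e]mulrC => /ltW.
case: (ex_minnP ex) => n hn nmin; exists (c n); rewrite // hn andbT.
case: n hn nmin => [|n] hn nmin.
  by move: hn; rewrite ac expr0 mul1r leNgt -ltr_pdivrMr // hM.
have : ~~ (abs (c n) * s <= e) by apply/negP => /nmin; rewrite ltnn.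
by rewrite -ltNge !ac exprS -!mulrA [e * _]mulrC ltr_pM2l.
Qed.

Variables (U V : lmodType K) (nU : U -> Rl) (nV : V -> Rl).
Hypotheses (hU : banach abs nU) (hV : banach abs nV).
Variables (D : set U) (E : set V) (f : U -> V) (C0 : Rl).
Hypotheses (hD : subspace D) (cD : is_closed nU D).
Hypotheses (hE : subspace E) (cE : is_closed nV E).
Hypotheses (hf : lin_on D f) (bf : forall x, D x -> nV (f x) <= C0 * nU x).
Hypotheses (fE : forall x, D x -> E (f x)) (sf : forall y, E y -> exists2 x, D x & f x = y).

Let norm_geV := norm_ge0 hV.

(** Baire: E is the union over n of the images of the balls of radius n, so one
    of these images is dense in some ball of E. *)
Lemma image_dense_ball : exists (n : nat) (y0 : V) (d : Rl), [/\ E y0, 0 < d &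
  forall y, E y -> nV (y - y0) <= d -> forall e, 0 < e ->
    exists x, [/\ D x, nU x <= n%:R & nV (y - f x) < e]].
Proof.
apply: contrapT => H.
have /choice[step hstep] : forall t : nat * (V * Rl), exists s : V * Rl,
    E t.2.1 -> 0 < t.2.2 -> [/\ E s.1, nV (s.1 - t.2.1) <= t.2.2, 0 < s.2, s.2 <= t.2.2 / 2
      & forall x, D x -> nU x <= t.1%:R -> s.2 < nV (s.1 - f x)].
  move=> [n [y0 d]] /=; apply: contrapT => G; apply: H; exists n, y0, d.
  have [Ey0 d0] : E y0 /\ 0 < d.
    by split; apply: contrapT => nh; apply: G; exists (y0, d) => /=.
  split => // y Ey hy e e0; apply: contrapT => F; apply: G.
  have m0 : 0 < Num.min e d by rewrite lt_min e0.
  exists (y, Num.min e d / 2) => _ _ /=; split => //.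
  - by rewrite divr_gt0.
  - by rewrite ler_pM2r ?invr_gt0 // ge_min lexx orbT.
  move=> x Dx lx; apply: lt_le_trans (_ : e <= _).
    have : Num.min e d <= e by rewrite ge_min lexx.
    by move: m0; lra.
  by rewrite leNgt; apply/negP => hlt; apply: F; exists x.
pose s := fix s (n : nat) : V * Rl := if n is m.+1 then step (m, s m) else (0, 1).
have inv n : E (s n).1 /\ 0 < (s n).2.
  elim: n => [|n [IH1 IH2]] /=; first by split; [apply: subspace0 | ].
  by have [] := hstep (n, s n) IH1 IH2.
have st n := hstep (n, s n) (proj1 (inv n)) (proj2 (inv n)).
have dec n k : (s (n + k)%N).2 <= (s n).2.
  elim: k => [|k IH]; first by rewrite addn0.
  rewrite addnS; have [_ _ _ h _] := st (n + k)%N; apply: le_trans IH.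
  by apply: le_trans h _; rewrite ler_pdivrMr // ler_peMr ?ler1n //; case: (inv (n + k)%N) => _ /ltW.
have small n : (s n).2 <= 1 / 2 ^+ n.
  elim: n => [|n IH]; first by rewrite expr0 divr1.
  have [_ _ _ h _] := st n; apply: le_trans h _.
  by rewrite exprSr invfM mulrA ler_pM2r // invr_gt0.
pose z n := (s n.+1).1 - (s n).1.
have hz n : nV (z n) <= (s n).2 by have [_ ? _ _ _] := st n.
have z0 : tends_to nV z 0.
  move=> e /(geometric_small 1)[k hk]; exists k => n /hk; rewrite subr0.
  by apply: le_lt_trans; apply: le_trans (hz n) (small n).
have [y hy] := series_cvg habs hV z0.
have sz n : \sum_(i < n) z i = (s n).1.
  elim: n => [|n IH]; first by rewrite big_ord0.
  by rewrite big_ord_recr [LHS]/= IH /z addrC subrK.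
have Ey : E y by apply: closed_tends cE _ hy => n; rewrite sz; case: (inv n).
have near n : nV (y - (s n).1) <= (s n).2.
  rewrite -sz; apply: (series_tail_le habs hV _ hy); first by case: (inv n) => _ /ltW.
  by move=> i ni; apply: le_trans (hz i) _; rewrite -(subnKC ni); apply: dec.
have [x Dx fx] := sf Ey.
have := archi_boundP (norm_ge0 hU x) => /ltW hx.
have [_ _ _ _ /(_ x Dx hx)] := st (Num.bound (nU x)).
by rewrite -/(s _) fx (normBC habs hV) -/(s (Num.bound (nU x)).+1) ltNge near.
Qed.

(** For c y of size about d, both y0 and c y + y0 lie in the ball around y0,
    so they are approximated by images of vectors of norm at most n. The
    difference of these vectors, divided by c, is the approximate preimage of
    y. *)
Lemma approx_preimage : exists2 C : Rl, 0 < C & forall y, E y ->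
  exists x, [/\ D x, nU x <= C * nV y & nV (y - f x) <= nV y / 2].
Proof.
have [n [y0 [d [Ey0 d0 h]]]] := image_dense_ball.
exists (n.+1%:R / (d * abs w)); first by rewrite divr_gt0 ?ltr0n // mulr_gt0.
move=> y Ey; have [->|yn0] := eqVneq y 0.
  exists 0; rewrite (norm0 habs hU) (norm0 habs hV) mulr0 mul0r (lin_on0 hD hf) subr0.
  by split; rewrite ?(norm0 habs hV) //; apply: subspace0.
have y_gt0 : 0 < nV y.
  by rewrite lt_neqAle norm_geV andbT eq_sym; apply: contraNneq yn0 => /(norm_eq0 hV)->.
have [c cn0 /andP[c1 c2]] := scale_into y_gt0 d0.
have ac := abs_gt0 habs cn0.
have e0 : 0 < abs c * nV y / 2 by rewrite divr_gt0 // mulr_gt0.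
have [x1 [Dx1 lx1 hx1]] : exists x, [/\ D x, nU x <= n%:R &
    nV (c *: y + y0 - f x) < abs c * nV y / 2].
  by apply: h => //; [apply: (proj2 hE) | rewrite addrK (normZ hV)].
have [x2 [Dx2 lx2 hx2]] : exists x, [/\ D x, nU x <= n%:R &
    nV (y0 - f x) < abs c * nV y / 2].
  by apply: h => //; rewrite subrr (norm0 habs hV) ltW.
exists (c^-1 *: (x1 - x2)); split.
- by apply: subspaceZ => //; apply: subspaceB.
- rewrite (normZ hU) (absV habs) mulrC ler_pdivrMr //.
  apply: le_trans (_ : n%:R <= _); first exact: (normB_le habs hU).
  apply: le_trans (_ : n.+1%:R <= _); first by rewrite ler_nat.
  rewrite -[X in X <= _]mulr1 -!mulrA ler_pM2l ?ltr0n //.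
  rewrite [_^-1 * _]mulrC ler_pdivlMr ?mulr_gt0 // mul1r [nV y * _]mulrC.
  exact: ltW.
- have -> : y - f (c^-1 *: (x1 - x2)) =
      c^-1 *: ((c *: y + y0 - f x1) - (y0 - f x2)).
    rewrite (lin_onZ _ hD hf) ?(lin_onB hD hf) //; last exact: subspaceB.
    have -> : c *: y + y0 - f x1 - (y0 - f x2) = c *: y - (f x1 - f x2).
      by rewrite !opprB [c *: y + y0 - _]addrAC [f x2 - y0]addrC addrA addrK
        -addrA [- _ + _]addrC.
    by rewrite [RHS]scalerBr scalerA mulVf // scale1r.
  rewrite (normZ hV) (absV habs) mulrC ler_pdivrMr //.
  by apply: le_trans (ltW (normB_lt habs hV hx1 hx2)) _; rewrite -mulrA mulrC.
Qed.

(** Successive approximation: the errors are halved at each step, so the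
    corrections form a convergent series. *)
Theorem open_mapping : exists2 C : Rl, 0 < C & forall y, E y ->
  exists x, [/\ D x, f x = y & nU x <= C * nV y].
Proof.
have [C C_gt0 h] := approx_preimage; exists C => // y Ey.
have /choice[g hg] : forall y, exists x, E y ->
    [/\ D x, nU x <= C * nV y & nV (y - f x) <= nV y / 2].
  move=> y'; have [/h [x hx]|nE] := pselect (E y'); first by exists x.
  by exists 0.
pose r := fix r (n : nat) : V := if n is m.+1 then r m - f (g (r m)) else y.
have Er n : E (r n).
  elim: n => [|n IH] //=; apply: subspaceB => //; apply: fE.
  by have [] := hg _ IH.
have gr n := hg _ (Er n).
have lr n : nV (r n) <= nV y / 2 ^+ n.
  elim: n => [|n IH]; first by rewrite expr0 divr1.
  have [_ _ h1] := gr n; apply: le_trans h1 _.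
  by rewrite exprSr invfM mulrA ler_pM2r // invr_gt0.
pose z n := g (r n).
have lz n : nU (z n) <= (C * nV y) / 2 ^+ n.
  by have [_ h1 _] := gr n; apply: le_trans h1 _; rewrite -mulrA ler_pM2l.
have z0 : tends_to nU z 0.
  move=> e /(geometric_small (C * nV y))[k hk]; exists k => n /hk; rewrite subr0.
  exact: le_lt_trans.
have Ds n : D (\sum_(i < n) z i).
  by apply: subspace_sum => // i _; have [] := gr i.
have fs n : f (\sum_(i < n) z i) = y - r n.
  elim: n => [|n IH]; first by rewrite big_ord0 (lin_on0 hD hf) subrr.
  rewrite big_ord_recr (lin_onD hf) ?IH //=; [|exact: Ds|by have [] := gr n].
  by rewrite opprB addrA addrAC.
have [x hx] := series_cvg habs hU z0.
have Dx : D x by apply: closed_tends cD _ hx.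
have CVy : 0 <= C * nV y by rewrite mulr_ge0 // ltW.
exists x; split => //.
  apply/eqP; rewrite -subr_eq0; apply/eqP; apply: (norm_small0 hV) => e e0.
  have [N1 h1] := geometric_small (nV y) e0.
  have [|N2 h2] := hx (e / (`|C0| + 1)); first by rewrite divr_gt0 // ltr_wpDl.
  pose n := maxn N1 N2.
  have -> : f x - y = - (f (\sum_(i < n) z i - x)) - r n.
    by rewrite (lin_onB hD hf) // fs !opprB addrA addrAC addrK.
  apply: (normB_lt habs hV); last by apply: le_lt_trans (lr n) (h1 _ (leq_maxl _ _)).
  rewrite (normN habs hV); apply: le_lt_trans (bf _) _; first exact: subspaceB.
  have /h2 : (N2 <= n)%N by rewrite leq_maxr.
  set v := nU _ => hv; have v0 : 0 <= v by apply: norm_ge0 hU _.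
  apply: le_lt_trans (_ : (`|C0| + 1) * v < e); last by rewrite mulrC -ltr_pdivlMr // ltr_wpDl.
  by apply: ler_wpM2r => //; apply: le_trans (ler_norm _) _; rewrite lerDl.
apply: (tends_norm_le (N := 0%N) habs hU _ hx) => n _.
apply: (norm_sum_le habs hU) => // i _; apply: le_trans (lz i) _.
by rewrite ler_pdivrMr ?exprn_gt0 // ler_peMr // exprn_ege1 // ler1n.
Qed.
End OpenMapping.

(** * Finite-dimensional extensions of closed subspaces *)

Section FiniteExtensions.
Variables (Rl : realType) (K : fieldType) (abs : K -> Rl).
Hypotheses (habs : nonarch_abs abs) (cK : norm_complete abs).
Variables (V : lmodType K) (nV : V -> Rl).
Hypothesis hV : banach abs nV.

Definition plus_line (X : set V) (u : V) : set V := [set v | exists c : K, X (v - c *: u)].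

Lemma sub_plus_line X u : X `<=` plus_line X u.
Proof. by move=> v Xv; exists 0; rewrite scale0r subr0. Qed.
Lemma plus_line_subspace X u : subspace X -> subspace (plus_line X u).
Proof.
move=> hX; split; first by exists 0; rewrite scale0r subrr; apply: subspace0.
move=> k x y [a ha] [b hb]; exists (k * a + b).
rewrite scalerDl opprD addrACA -scalerA -scalerBr.
by apply: (proj2 hX).
Qed.

(** The distance from u to the closed subspace X is positive, which bounds the
    coordinate along u; completeness of K then gives closedness. *)
Lemma plus_line_closed X u : subspace X -> is_closed nV X ->
  is_closed nV (plus_line X u) /\
  exists (g : V -> K) (C : Rl), [/\ 0 <= C, lin_on (Y := K^o) (plus_line X u) g,
    forall v, plus_line X u v -> abs (g v) <= C * nV v &
    forall v, plus_line X u v -> X (v - g v *: u)].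
Proof.
move=> hX cX; have [Xu|nXu] := pselect (X u).
  have e : plus_line X u = X.
    apply/seteqP; split; last exact: sub_plus_line.
    by move=> v [c hc]; rewrite -(subrK (c *: u) v); apply: subspaceD => //; apply: subspaceZ.
  rewrite e; split => //; exists (fun _ => 0), 0; split => //.
  - by move=> k x y _ _; rewrite scaler0 addr0.
  - by move=> v _; rewrite (abs0 habs) mul0r.
  - by move=> v Xv; rewrite scale0r subr0.
have [d d0 hd] : exists2 d, 0 < d & forall x, X x -> d <= nV (u - x).
  apply: contrapT => H; apply: nXu; apply/cX/(closP nV) => e e0.
  apply: contrapT => G; apply: H; exists e => // x Xx; rewrite leNgt; apply/negP => hlt.
  by apply: G; exists x; rewrite // (normBC habs hV).
pose g v : K := xget 0 [set c | X (v - c *: u)].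
have hg v : plus_line X u v -> X (v - g v *: u).
  by move=> [c hc]; apply: (@xgetPex _ 0 [set c | X (v - c *: u)]); exists c.
have bd c x : X x -> abs c * d <= nV (c *: u + x).
  move=> Xx; have [->|cn0] := eqVneq c 0; first by rewrite (abs0 habs) mul0r (norm_ge0 hV).
  have -> : c *: u + x = c *: (u - (- c^-1) *: x).
    by rewrite scalerBr scalerA mulrN mulfV // scaleN1r opprK.
  by rewrite (normZ hV) ler_wpM2l ?(abs_ge0 habs) // hd //; apply: subspaceZ.
have uniq v c : X (v - c *: u) -> g v = c.
  move=> hc; have h1 : X (v - g v *: u) by apply: hg; exists c.
  have := bd (g v - c) _ (subspaceB hX h1 hc).
  have -> : v - g v *: u - (v - c *: u) = - ((g v - c) *: u).
    by rewrite scalerBl !opprB addrC addrA subrK.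
  rewrite subrr (norm0 habs hV).
  rewrite -[0](mul0r d) ler_pM2r // => h2; apply/eqP; rewrite -subr_eq0.
  have := abs_ge0 habs (g v - c) => h3.
  by apply: contraT => /(abs_gt0 habs); rewrite ltNge h2.
have lg : lin_on (Y := K^o) (plus_line X u) g.
  move=> k x y hx hy; apply: uniq; rewrite scalerDl opprD addrACA -scalerA -scalerBr.
  by apply: (proj2 hX); apply: hg.
have ng v : plus_line X u v -> abs (g v) <= d^-1 * nV v.
  move=> hv; rewrite mulrC ler_pdivlMr //.
  by have := bd (g v) _ (hg v hv); rewrite addrC subrK.
split; last by exists g, d^-1; split => //; rewrite invr_ge0 ltW.
move=> v /(clos_seq (nV := nV)) [s hs sv].
have sC e : 0 < e -> exists N, forall m n, (N <= m)%N -> (N <= n)%N -> nV (s m - s n) < e.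
  move=> /sv[N hN]; exists N => m n hm hn; apply: (norm_trans_lt hV (y := v)).
    exact: hN.
  by rewrite (normBC habs hV); apply: hN.
have [c hc] : exists c, tends_to abs (g \o s) c.
  apply: cK => e e0; have [|N hN] := sC (e * d); first exact: mulr_gt0.
  exists N => m n hm hn; rewrite /= -[g (s m) - g (s n)](lin_onB _ lg) //.
    apply: le_lt_trans (ng _ _) _.
      by apply: subspaceB => //; apply: plus_line_subspace.
    by rewrite mulrC ltr_pdivrMr //; apply: hN.
  exact: plus_line_subspace.
exists c; apply: (closed_tends (u := fun n => s n - g (s n) *: u) cX) => [n|].
  exact: hg.
apply: (tendsD hV) => // e e0.
have [|N hN] := hc (e / (nV u + 1)).
  by rewrite divr_gt0 // ltr_wpDl // (norm_ge0 hV).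
exists N => n /hN /= hn; rewrite -opprD (normN habs hV) -scalerBl (normZ hV).
apply: le_lt_trans (_ : abs (g (s n) - c) * (nV u + 1) < e).
  by apply: ler_wpM2l; rewrite ?(abs_ge0 habs) // lerDl.
by rewrite -ltr_pdivlMr // ltr_wpDl // (norm_ge0 hV).
Qed.

Definition plus_span (X : set V) (u : nat -> V) (t : nat) : set V :=
  [set v | exists c : nat -> K, X (v - \sum_(i < t) c i *: u i)].

Lemma plus_spanS X u t : subspace X ->
  plus_span X u t.+1 = plus_line (plus_span X u t) (u t).
Proof.
move=> hX; apply/seteqP; split=> v.
  move=> [c hc]; exists (c t), c; move: hc.
  by rewrite big_ord_recr /= opprD addrA addrAC.
move=> [a [c hc]]; exists (fun i => if i == t then a else c i).
rewrite big_ord_recr /= eqxx opprD addrA addrAC.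
under eq_bigr => i _ do rewrite ltn_eqF //.
exact: hc.
Qed.
Lemma plus_span0 X u : plus_span X u 0 = X.
Proof.
apply/seteqP; split=> v; last by move=> h; exists (fun _ => 0); rewrite big_ord0 subr0.
by move=> [c]; rewrite big_ord0 subr0.
Qed.
Lemma sub_plus_span X u t : X `<=` plus_span X u t.
Proof.
move=> v Xv; exists (fun _ => 0); rewrite big1 ?subr0 // => i _; exact: scale0r.
Qed.
Lemma plus_span_subspace X u t : subspace X -> subspace (plus_span X u t).
Proof.
move=> hX; elim: t => [|t IH]; first by rewrite plus_span0.
by rewrite plus_spanS //; apply: plus_line_subspace.
Qed.
(** Vectors u i that depend on the previous ones modulo X get the coordinate
    0. *)
Lemma plus_span_coords X u t : subspace X -> is_closed nV X ->
  is_closed nV (plus_span X u t) /\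
  exists (b : nat -> V -> K) (C : Rl), [/\ 0 <= C,
    forall i, lin_on (Y := K^o) (plus_span X u t) (b i),
    forall i v, plus_span X u t v -> abs (b i v) <= C * nV v &
    forall v, plus_span X u t v -> X (v - \sum_(i < t) b i v *: u i)].
Proof.
move=> hX cX; elim: t => [|t [cY [b [C [C0 lb nb hb]]]]].
  rewrite plus_span0; split => //; exists (fun _ _ => 0), 0; split => //.
  - by move=> i k x y _ _; rewrite scaler0 addr0.
  - by move=> i v _; rewrite (abs0 habs) mul0r.
  - by move=> v; rewrite big_ord0 subr0.
have hY := plus_span_subspace u t hX.
rewrite plus_spanS //; have [cZ [g [C' [C'0 lg ng hg]]]] := plus_line_closed (u t) hY cY.
split => //; have hZ := plus_line_subspace (u t) hY.
pose C2 := Num.max 1 (C' * nV (u t)).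
exists (fun i v => if i == t then g v else b i (v - g v *: u t)), (Num.max C' (C * C2)).
split.
- by rewrite le_max C'0.
- move=> i k x y hx hy; case: ifP => _; first exact: lg.
  rewrite -(lb i) ?hg //; try exact: hg.
  congr (b i _); rewrite lg // scalerDl opprD addrACA -scalerA -scalerBr //.
- move=> i v hv; case: ifP => _.
    by apply: le_trans (ng _ hv) _; rewrite ler_wpM2r ?(norm_ge0 hV) // le_max lexx.
  apply: le_trans (nb _ _ (hg _ hv)) _.
  apply: le_trans (_ : C * (C2 * nV v) <= _); last first.
    by rewrite mulrA ler_wpM2r ?(norm_ge0 hV) // le_max lexx orbT.
  apply: ler_wpM2l => //; apply: (normB_le habs hV).
    by rewrite ler_peMl ?(norm_ge0 hV) // /C2 le_max lexx.
  rewrite (normZ hV); apply: le_trans (_ : C' * nV v * nV (u t) <= _).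
    by rewrite ler_wpM2r ?(norm_ge0 hV) // ng.
  by rewrite mulrAC ler_wpM2r ?(norm_ge0 hV) // /C2 le_max lexx orbT.
- move=> v hv; rewrite big_ord_recr /= eqxx opprD addrA addrAC.
  under eq_bigr => i _ do rewrite ltn_eqF //.
  by apply: hb; apply: hg.
Qed.
End FiniteExtensions.

(** * Finite powers of a Banach space *)

Section FinitePower.
Variables (Rl : realType) (K : fieldType) (abs : K -> Rl).
Hypotheses (habs : nonarch_abs abs).
Variables (V : lmodType K) (nV : V -> Rl).
Hypothesis hV : banach abs nV.
Variable k : nat.

Definition pow_norm (x : {ffun 'I_k -> V}) : Rl := \big[Num.max/0]_(i < k) nV (x i).

Lemma pow_norm_le x e : 0 <= e -> (pow_norm x <= e) <-> (forall i, nV (x i) <= e).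
Proof.
move=> e0; split=> [/bigmax_leP[_ h] i|h]; first exact: h.
by apply/bigmax_leP; split => // i _; apply: h.
Qed.
Lemma le_pow_norm (x : {ffun 'I_k -> V}) i : nV (x i) <= pow_norm x.
Proof. exact: (le_bigmax 0 (fun i => nV (x i)) i). Qed.
Lemma pow_norm_ge0 x : 0 <= pow_norm x.
Proof. exact: bigmax_ge_id. Qed.

Lemma banach_pow : banach abs pow_norm.
Proof.
split.
- exact: pow_norm_ge0.
- move=> v v0; apply/ffunP => i; rewrite ffunE; apply: (norm_eq0 hV).
  by apply/le_anti; rewrite (norm_ge0 hV) andbT -v0 le_pow_norm.
- move=> a v; apply/le_anti/andP; split.
    apply/pow_norm_le; first by rewrite mulr_ge0 ?(abs_ge0 habs) ?pow_norm_ge0.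
    by move=> i; rewrite ffunE (normZ hV) ler_wpM2l ?(abs_ge0 habs) ?le_pow_norm.
  have [->|an0] := eqVneq a 0; first by rewrite (abs0 habs) mul0r pow_norm_ge0.
  rewrite mulrC -ler_pdivlMr ?(abs_gt0 habs) //.
  apply/pow_norm_le; first by rewrite divr_ge0 ?(abs_ge0 habs) ?pow_norm_ge0.
  move=> i; rewrite ler_pdivlMr ?(abs_gt0 habs) // mulrC -(normZ hV).
  by have := le_pow_norm (a *: v) i; rewrite ffunE.
- move=> u v; apply/pow_norm_le; first by rewrite le_max pow_norm_ge0.
  move=> i; rewrite ffunE; apply: (normD_le hV).
    by apply: le_trans (le_pow_norm _ _) _; rewrite le_max lexx.
  by apply: le_trans (le_pow_norm _ _) _; rewrite le_max lexx orbT.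
move=> u hu.
have /choice[l hl] : forall i, exists l, tends_to nV (fun n => u n i) l.
  move=> i; case: hV => _ _ _ _; apply => e /hu[N hN]; exists N => m n hm hn.
  by apply: le_lt_trans (hN m n hm hn); have := le_pow_norm (u m - u n) i; rewrite !ffunE.
exists [ffun i => l i] => e e0.
have e2 : 0 < e / 2 by rewrite divr_gt0.
have /choice[N hN] : forall i, exists N, forall n, (N <= n)%N -> nV (u n i - l i) < e / 2.
  by move=> i; apply: hl.
exists (\max_i N i)%N => n hn; apply: le_lt_trans (_ : e / 2 < e); last by lra.
apply/pow_norm_le; first exact: ltW.
move=> i; rewrite !ffunE; apply/ltW/hN/(leq_trans _ hn); exact: (leq_bigmax i).
Qed.
End FinitePower.

(** * Finite generation *)

Section Generation.
Variables (T : pzRingType) (M : lmodType T).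
Implicit Types (D : set T) (X Y N : set M).

(** The generators are elements of X that need not lie in N. *)
Definition gen_by D X N : Prop :=
  exists (k : nat) (g : 'I_k -> M), (forall i, X (g i)) /\
    forall n, N n -> exists a : 'I_k -> T, (forall i, D (a i)) /\ n = \sum_i a i *: g i.

Lemma gen_by_fin D X N (J : finType) (g : J -> M) : (forall j, X (g j)) ->
  (forall n, N n -> exists a : J -> T, (forall j, D (a j)) /\ n = \sum_j a j *: g j) ->
  gen_by D X N.
Proof.
move=> Xg h; exists #|J|, (g \o enum_val); split=> [i|n /h[a [Da ->]]]; first exact: Xg.
exists (a \o enum_val); split=> [i|]; first exact: Da.
exact: big_enum_val.
Qed.

Lemma gen_byS D X Y N N' : X `<=` Y -> N' `<=` N -> gen_by D X N -> gen_by D Y N'.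
Proof.
move=> XY NN [k [g [Xg h]]]; exists k, g; split=> [i|n /NN/h //].
exact/XY/Xg.
Qed.

Lemma gen_by_trans D1 D2 X Y N : gen_by D1 X N ->
  (forall x, X x -> gen_by D2 Y [set s *: x | s in D1]) -> gen_by D2 Y N.
Proof.
move=> [k [g [Xg h]]] H.
have /fin_all_exists[q /fin_all_exists[f hf]] : forall i, exists q (f : 'I_q -> M), (forall j, Y (f j)) /\
    forall n, [set s *: g i | s in D1] n ->
      exists a : 'I_q -> T, (forall j, D2 (a j)) /\ n = \sum_j a j *: f j.
  by move=> i; apply: H.
apply: (@gen_by_fin _ _ _ {i : 'I_k & 'I_(q i)} (fun t => f (tag t) (tagged t))).
  by move=> [i j] /=; have [] := hf i.
move=> n /h[a [Da ->]].
have /fin_all_exists[b hb] : forall i, exists b : 'I_(q i) -> T, (forall j, D2 (b j)) /\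
    a i *: g i = \sum_j b j *: f i j.
  by move=> i; have [_ h2] := hf i; apply: h2; exists (a i).
exists (fun t => b (tag t) (tagged t)); split=> [[i j] /=|]; first by have [] := hb i.
rewrite (eq_bigr (fun i => \sum_j b i j *: f i j)); last by move=> i _; have [] := hb i.
by rewrite (sig_big_dep xpredT (fun _ _ => true) (fun i j => b i j *: f i j)).
Qed.

Definition stable D N : Prop :=
  [/\ N 0, forall x y, N x -> N y -> N (x + y) & forall s x, D s -> N x -> N (s *: x)].

Lemma stable_sum D N (I : Type) (r : seq I) (P : pred I) (F : I -> M) : stable D N ->
  (forall i, P i -> N (F i)) -> N (\sum_(i <- r | P i) F i).
Proof. by case=> h0 hD _ h; apply: big_ind. Qed.

Lemma stable_comb D N k (a : 'I_k -> T) (g : 'I_k -> M) : stable D N ->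
  (forall i, D (a i)) -> (forall i, N (g i)) -> N (\sum_i a i *: g i).
Proof. by move=> hN ha hg; refine (@stable_sum D N _ _ _ _ hN _) => i _; case: (hN) => _ _; apply. Qed.

Definition subring (D : set T) : Prop :=
  [/\ D 1, forall x y, D x -> D y -> D (x - y) & forall x y, D x -> D y -> D (x * y)].

Section Subring.
Variable D : set T.
Hypothesis hD : subring D.
Lemma subring1 : D 1. Proof. by case: hD. Qed.
Lemma subringB x y : D x -> D y -> D (x - y). Proof. by case: hD => _ h _; apply: h. Qed.
Lemma subringM x y : D x -> D y -> D (x * y). Proof. by case: hD => _ _ h; apply: h. Qed.
Lemma subring0 : D 0. Proof. by rewrite -(subrr 1); apply: subringB; apply: subring1. Qed.
Lemma subringN x : D x -> D (- x).
Proof. by rewrite -sub0r; apply: subringB; apply: subring0. Qed.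
Lemma subringD x y : D x -> D y -> D (x + y).
Proof. by move=> hx hy; rewrite -[y]opprK; apply: subringB => //; apply: subringN. Qed.
Lemma subring_sum (I : Type) (r : seq I) (P : pred I) (F : I -> T) :
  (forall i, P i -> D (F i)) -> D (\sum_(i <- r | P i) F i).
Proof. by move=> h; apply: big_ind => //; [exact: subring0 | exact: subringD]. Qed.
Lemma stableN N x : stable D N -> N x -> N (- x).
Proof.
by case=> _ _ h Nx; rewrite -scaleN1r; apply: h => //; apply: subringN; apply: subring1.
Qed.
Lemma stableB N x y : stable D N -> N x -> N y -> N (x - y).
Proof. by move=> hN Nx Ny; case: (hN) => _ h _; apply: h => //; apply: stableN. Qed.

(** Induction on t, for N contained in the sum of P and of the multiples of
    x_0, ..., x_t: the coefficients of x_t in elements of N form a left ideal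
    of D, whose generators come from finitely many elements of N. These reduce
    N to the part without x_t. *)
Lemma fg_extension P N (t : nat) (x : nat -> M) :
  (forall I, ideal_for *%R D I -> fg_ideal_for *%R D I) ->
  stable D P -> stable D N ->
  (forall n, N n -> exists a : nat -> T, (forall i, D (a i)) /\ P (n - \sum_(i < t) a i *: x i)) ->
  gen_by D (N `&` P) (N `&` P) -> gen_by D N N.
Proof.
move=> noeth hP; elim: t N => [|t IH] N hN hx fgP.
  have -> // : N = N `&` P.
  apply/seteqP; split=> n; last by case.
  by move=> Nn; split => //; have [a [_]] := hx n Nn; rewrite big_ord0 subr0.
pose Q := [set n : M | exists a : nat -> T,
             (forall i, D (a i)) /\ P (n - \sum_(i < t) a i *: x i)].
have hQ : stable D Q.
  split.
  - exists (fun _ => 0); split=> [i|]; first exact: subring0.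
    by rewrite big1 ?subr0; [case: hP | move=> i _; rewrite scale0r].
  - move=> m n [a [Da ha]] [b [Db hb]]; exists (fun i => a i + b i).
    split=> [i|]; first exact: subringD.
    under eq_bigr do rewrite scalerDl.
    by rewrite big_split opprD addrACA; case: hP => _ h _; apply: h.
  - move=> s n Ds [a [Da ha]]; exists (fun i => s * a i).
    split=> [i|]; first exact: subringM.
    under eq_bigr do rewrite -scalerA.
    by rewrite -scaler_sumr -scalerBr; case: hP => _ _; apply.
have hNQ : stable D (N `&` Q).
  case: hN => n0 nD nZ; case: hQ => q0 qD qZ; split => //.
    by move=> m n [? ?] [? ?]; split; [apply: nD | apply: qD].
  by move=> s n Ds [? ?]; split; [apply: nZ | apply: qZ].
have fgNQ : gen_by D (N `&` Q) (N `&` Q).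
  apply: IH => // [n [] //|].
  suff -> : N `&` Q `&` P = N `&` P by [].
  apply/seteqP; split=> n [] // => [[? ?] ? //|Nn Pn]; split => //; split => //.
  exists (fun _ => 0); split=> [i|]; first exact: subring0.
  by rewrite big1 ?subr0 // => i _; rewrite scale0r.
pose I := [set s | D s /\ exists2 n, N n & Q (n - s *: x t)].
have /noeth[q [s [Is hs]]] : ideal_for *%R D I.
  case: hN => n0 nD nZ; case: hQ => q0 qD qZ.
  split; first by move=> s [].
  - split; [exact: subring0 | exists 0; rewrite // scale0r subr0 //].
  - move=> s s' [Ds [n Nn hn]] [Ds' [n' Nn' hn']].
    split; [exact: subringD | exists (n + n'); first exact: nD].
    by rewrite scalerDl opprD addrACA; apply: qD.
  - move=> u s Du [Ds [n Nn hn]].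
    split; [exact: subringM | exists (u *: n); first exact: nZ].
    by rewrite -scalerA -scalerBr; apply: qZ.
have /choice[y hy] : forall j : 'I_q, exists y, N y /\ Q (y - s j *: x t).
  by move=> j; have [_ [y Ny Qy]] := Is j; exists y.
have [k [g [NQg hg]]] := fgNQ.
apply: (@gen_by_fin _ _ _ ('I_k + 'I_q)%type
  (fun z => match z with inl i => g i | inr j => y j end)).
  by move=> [i|j]; [have [] := NQg i | have [] := hy j].
move=> n Nn; have [a [Da ha]] := hx n Nn.
have It : I (a t).
  split => //; exists n => //; exists a; split => //.
  by move: ha; rewrite big_ord_recr /= opprD addrA addrAC.
have [b [Db eb]] := hs _ It.
have NQ : (N `&` Q) (n - \sum_j b j *: y j).
  split; first by apply: stableB => //; apply: (stable_comb hN) => // j; have [] := hy j.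
  have -> : n - \sum_j b j *: y j = (n - a t *: x t) - \sum_j b j *: (y j - s j *: x t).
    have -> : \sum_j b j *: (y j - s j *: x t) = \sum_j b j *: y j - a t *: x t.
      by rewrite eb scaler_suml -sumrB; apply: eq_bigr => j _; rewrite scalerBr scalerA.
    by rewrite opprB addrA subrK.
  apply: stableB => //; last by apply: (stable_comb hQ) => // j; have [] := hy j.
  exists a; split => //.
  by move: ha; rewrite big_ord_recr /= opprD addrA addrAC.
have [c [Dc ec]] := hg _ NQ.
exists (fun z => match z with inl i => c i | inr j => b j end); split; first by case.
by rewrite big_sumType /= -ec subrK.
Qed.

Lemma fg_submodule N (k : nat) (g : 'I_k -> M) :
  (forall I, ideal_for *%R D I -> fg_ideal_for *%R D I) -> stable D N ->
  (forall n, N n -> exists a : 'I_k -> T, (forall i, D (a i)) /\ n = \sum_i a i *: g i) ->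
  gen_by D N N.
Proof.
move=> noeth hN h.
pose x (i : nat) := if insub i is Some j then g j else 0.
apply: (@fg_extension [set 0] _ k x noeth) => //.
- split => //; first by move=> ? ? -> ->; rewrite addr0.
  by move=> s ? _ ->; rewrite scaler0.
- move=> n /h[a [Da ->]]; exists (fun i => if insub i is Some j then a j else 0).
  split=> [i|]; first by case: insub => // ; exact: subring0.
  apply/eqP; rewrite subr_eq0; apply/eqP/eq_bigr => i _.
  by rewrite /x valK.
- exists 0%N, (fun _ => 0); split=> [[]//|n [_ ->]].
  by exists (fun _ => 0); split=> [[]//|]; rewrite big_ord0.
Qed.
End Subring.
End Generation.

Lemma fg_subspace (K : fieldType) (U : lmodType K) (P N : set U) (t : nat) (x : nat -> U) :
  subspace P -> subspace N ->
  (forall n, N n -> exists a : nat -> K, P (n - \sum_(i < t) a i *: x i)) ->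
  findim (N `&` P) -> findim N.
Proof.
move=> hP hN h fP.
have st X : subspace X -> stable setT X.
  by move=> hX; split; [exact: subspace0 | exact: subspaceD | move=> *; exact: subspaceZ].
have toG X : findim X -> gen_by setT X X.
  move=> [k [e [Xe he]]]; exists k, e; split => // n /he[c ->].
  by exists c.
suff [k [g [Ng hg]]] : gen_by setT N N.
  by exists k, g; split => // n /hg[a [_ ->]]; exists a.
apply: (@fg_extension _ _ setT _ P N t x) => //; try exact: st; last exact: toG.
  move=> I [_ I0 _ IZ]; have [[a [Ia an0]]|nI] := pselect (exists a, I a /\ a != 0).
    exists 1%N, (fun _ => a); split => // y Iy; exists (fun _ => y / a); split => //.
    by rewrite big_ord1 divfK.
  exists 0%N, (fun _ => 0); split=> [[]//|y Iy]; exists (fun _ => 0); split => //.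
  by rewrite big_ord0; apply: contrapT => /eqP yn0; apply: nI; exists y.
by move=> n /h[a ha]; exists a.
Qed.

Lemma findim_sub (K : fieldType) (U : lmodType K) (X Y : set U) :
  subspace X -> X `<=` Y -> findim Y -> findim X.
Proof.
move=> hX XY [k [e [Ye he]]].
pose x (i : nat) := if insub i is Some j then e j else 0.
apply: (@fg_subspace _ _ [set 0] X k x (subspace_zero U)) => //.
- move=> n /XY/he[c ->]; exists (fun i => if insub i is Some j then c j else 0).
  by apply/eqP; rewrite subr_eq0; apply/eqP/eq_bigr => i _; rewrite /x valK.
- exists 0%N, (fun _ => 0); split=> [[]//|n [_ ->]].
  by exists (fun _ => 0); rewrite big_ord0.
Qed.

(** * Noetherian Banach algebras *)

Lemma clos_image (Rl : realType) (K : fieldType) (U V : lmodType K) (nU : U -> Rl)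
    (nV : V -> Rl) (f : U -> V) (X : set U) (Z : set V) :
  (forall u x, tends_to nU u x -> tends_to nV (fun n => f (u n)) (f x)) ->
  is_closed nV Z -> (forall y, X y -> Z (f y)) ->
  forall y, clos (norm_nbhs nU) X y -> Z (f y).
Proof.
move=> cf cZ h y /(clos_seq (nV := nU))[u hu uy].
by apply: (closed_tends cZ _ (cf _ _ uy)) => n; apply: h.
Qed.

Lemma bounded_tends (Rl : realType) (K : fieldType) (abs : K -> Rl) (U V : lmodType K)
    (nU : U -> Rl) (nV : V -> Rl) (P : set U) (f : U -> V) (C : Rl) :
  banach abs nU -> banach abs nV -> subspace P -> lin_on P f ->
  (forall x, P x -> nV (f x) <= C * nU x) ->
  forall u x, (forall n, P (u n)) -> P x -> tends_to nU u x -> tends_to nV (fun n => f (u n)) (f x).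
Proof.
move=> hU hV hP lf bf u x Pu Px ux e e0.
have [|N hN] := ux (e / (`|C| + 1)); first by rewrite divr_gt0 // ltr_wpDl.
exists N => n /hN hn; rewrite -(lin_onB hP lf) //.
apply: le_lt_trans (bf _ _) _; first exact: subspaceB.
apply: le_lt_trans (_ : (`|C| + 1) * nU (u n - x) < e).
  by apply: ler_wpM2r; rewrite ?(norm_ge0 hU) //; apply: le_trans (ler_norm _) _; rewrite lerDl.
by rewrite mulrC -ltr_pdivlMr // ltr_wpDl.
Qed.

Section BanachAlgebra.
Variables (Rl : realType) (p : nat) (K : fieldType) (abs : K -> Rl).
Hypothesis hK : complete_dv_ext_of_Qp abs p.
Variables (S : algType K) (nS : S -> Rl).
Hypothesis hS : banach_alg abs nS.

Let habs := dv_abs hK.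
Let bS := proj1 hS.

Lemma normM x y : nS (x * y) <= nS x * nS y. Proof. by case: hS. Qed.

Lemma tendsMl a u x : tends_to nS u x -> tends_to nS (fun n => a * u n) (a * x).
Proof.
move=> ux; apply: (@bounded_tends _ _ _ S S nS nS setT (fun x => a * x) (nS a) bS bS) => //.
- by move=> k y z _ _; rewrite mulrDr scalerAr.
- by move=> y _; apply: normM.
Qed.
Lemma tendsMr a u x : tends_to nS u x -> tends_to nS (fun n => u n * a) (x * a).
Proof.
move=> ux; apply: (@bounded_tends _ _ _ S S nS nS setT (fun x => x * a) (nS a) bS bS) => //.
- by move=> k y z _ _; rewrite mulrDl scalerAl.
- by move=> y _; rewrite mulrC normM.
Qed.
Lemma tendsZ k u x : tends_to nS u x -> tends_to nS (fun n => k *: u n) (k *: x).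
Proof.
move=> ux; apply: (@bounded_tends _ _ _ S S nS nS setT (fun x => k *: x) (abs k) bS bS) => //.
- by move=> c y z _ _; rewrite scalerDr !scalerA mulrC.
- by move=> y _; rewrite (normZ bS).
Qed.

Definition closed_subring (D : set S) : Prop :=
  [/\ subring D, subspace D & is_closed nS D].

Lemma closed_subringT : closed_subring setT. Proof. by []. Qed.

Lemma subalg_subspace (A : subalgClosed S) : subspace [set` A].
Proof.
by split=> /= [|k x y hx hy]; [apply: rpred0 | rewrite rpredD ?rpredZ].
Qed.
Lemma subalg_subring (A : subalgClosed S) : subring [set` A].
Proof.
split=> /= [|x y hx hy|x y hx hy]; [exact: rpred1 | | exact: rpredM].
exact: (subspaceB (subalg_subspace A)).
Qed.

Lemma sub_closure (X : set S) : X `<=` clos (norm_nbhs nS) X.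
Proof. exact: (sub_clos habs bS). Qed.

Lemma closure_closed_subring (A : subalgClosed S) : closed_subring (closure_of nS A).
Proof.
have hA := subalg_subring A; have sA := clos_subspace habs bS (subalg_subspace A).
have cA : is_closed nS (closure_of nS A) by apply: (clos_closed bS).
split => //; split; first by apply: sub_closure; apply: subring1.
  by move=> x y; apply: (subspaceB sA).
move=> x y hx hy; apply: (clos_image (f := fun x => x * y) _ cA _ hx).
  by move=> u z; apply: tendsMr.
move=> {hx} x hx; apply: (clos_image (f := fun y => x * y) _ cA _ hy).
  by move=> u z; apply: tendsMl.
by move=> {hy}y hy; apply: sub_closure; apply: (subringM hA).
Qed.

Lemma uniformizer : exists2 w : K, 0 < abs w & abs w < 1.
Proof. by have [w []] := dv_discrete hK; exists w. Qed.

(** A matrix E with small entries makes 1 - E invertible: b is the sum of the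
    geometric series a + a E + a E^2 + ... *)
Lemma neumann (D : set S) (k : nat) (a : 'I_k -> S) (E : 'I_k -> 'I_k -> S) :
  closed_subring D -> (forall i, D (a i)) -> (forall i j, D (E i j)) ->
  (forall i j, nS (E i j) <= 1 / 2) ->
  exists b : 'I_k -> S, (forall i, D (b i)) /\ forall j, b j = a j + \sum_i b i * E i j.
Proof.
move=> [hD sD cD] Da DE nE; pose C := \sum_i nS (a i).
have C0 : 0 <= C by apply: sumr_ge0 => i _; apply: (norm_ge0 bS).
pose r := fix r (n : nat) : 'I_k -> S := if n is m.+1 then fun j => \sum_i r m i * E i j else a.
have Dr n i : D (r n i).
  elim: n i => [|n IH] i //=; apply: subring_sum => // j _; exact: subringM.
have nr n i : nS (r n i) <= C / 2 ^+ n.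
  elim: n i => [|n IH] i.
    rewrite expr0 divr1 /C (bigD1 i) //= lerDl; apply: sumr_ge0 => j _; exact: (norm_ge0 bS).
  have c2 : 0 <= C / 2 ^+ n.+1 by rewrite divr_ge0 ?exprn_ge0.
  apply: (norm_sum_le habs bS) => // j _; apply: le_trans (normM _ _) _.
  rewrite exprSr invfM mulrA; apply: ler_pM; rewrite ?(norm_ge0 bS) //.
  by rewrite -[2^-1]mul1r.
have r0 i : tends_to nS (fun n => r n i) 0.
  move=> e /(geometric_small C)[N hN]; exists N => n /hN; rewrite subr0.
  exact: le_lt_trans.
have /choice[b hb] : forall i, exists b, tends_to nS (fun n => \sum_(t < n) r t i) b.
  by move=> i; apply: (series_cvg habs bS (r0 i)).
exists b; split=> [i|j].
  by apply: (closed_tends cD _ (hb i)) => n; apply: subring_sum => // t _.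
apply: (tends_uniq habs bS (tends_shift 1 (hb j))).
apply: (tends_ext (u := fun n => a j + \sum_i (\sum_(t < n) r t i) * E i j)).
  move=> n; rewrite addn1 big_ord_recl; congr (_ + _).
  under eq_bigr do rewrite mulr_suml.
  by rewrite exchange_big.
apply: (tendsD bS); first exact: (tends_cst habs bS).
by apply: (tends_sum habs bS) => i _; apply: tendsMr.
Qed.

(** The closure of I has finitely many generators g_i. By the open mapping
    theorem the elements g_i - g'_i, for g'_i in I close to g_i, are
    combinations of the g_j with small coefficients; as 1 - E is invertible
    for a matrix E with small entries, the g'_i generate the closure of I as
    well. *)
Theorem noetherian_closed (D I : set S) : closed_subring D -> noetherian D ->
  ideal_for *%R D I -> is_closed nS I.
Proof.
move=> cDr noeth hI; have [hD sD cD] := cDr; have [ID I0 IA IM] := hI.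
have sI : subspace I.
  split => // k x y Ix Iy; apply: IA => //; rewrite -mulr_algl; apply: IM => //.
  by apply: subspaceZ => //; apply: subring1.
pose E := clos (norm_nbhs nS) I.
have sE : subspace E by apply: (clos_subspace habs bS sI).
have cE : is_closed nS E by apply: (clos_closed bS).
have ED : E `<=` D by apply: (clos_min cD ID).
have hE : ideal_for *%R D E.
  split => //; [exact: subspace0 | exact: subspaceD |].
  move=> s x Ds; apply: (clos_image (f := fun x => s * x) _ cE).
    by move=> u y; apply: tendsMl.
  by move=> y Iy; apply: sub_closure; apply: IM.
have [k [g [Eg hg]]] := (proj1 noeth) E hE.
pose DD : set {ffun 'I_k -> S} := [set a | forall i, D (a i)].
pose f (a : {ffun 'I_k -> S}) := \sum_i a i * g i.
have [w w0 w1] := uniformizer.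
have bU := banach_pow habs bS k.
have [C C0 hC] : exists2 C : Rl, 0 < C & forall y, E y ->
    exists x, [/\ DD x, f x = y & pow_norm nS x <= C * nS y].
  apply: (open_mapping habs w0 w1 bU bS (D := DD) (C0 := \sum_i nS (g i))) => //.
  - split=> [i|c x y Dx Dy i]; rewrite ?ffunE; first exact: subring0.
    by apply: (proj2 sD); [apply: Dx | apply: Dy].
  - move=> x hx i; apply/cD/(closP nS) => e /((closP _ _ _).1 hx)[y Dy hy].
    exists (y i) => //; apply: le_lt_trans hy.
    by have := le_pow_norm nS (y - x) i; rewrite !ffunE.
  - move=> c x y _ _; rewrite /f scaler_sumr -big_split; apply: eq_bigr => i _.
    by rewrite !ffunE mulrDl scalerAl.
  - move=> x _; have x0 := pow_norm_ge0 nS x.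
    apply: (norm_sum_le habs bS) => [|i _].
      by rewrite mulr_ge0 // sumr_ge0 // => i _; apply: (norm_ge0 bS).
    apply: le_trans (normM _ _) _; rewrite mulrC; apply: ler_pM; rewrite ?(norm_ge0 bS) //.
      by rewrite (bigD1 i) //= lerDl sumr_ge0 // => j _; apply: (norm_ge0 bS).
    exact: le_pow_norm.
  - move=> x Dx; apply: subspace_sum => // i _; case: hE => _ _ _; apply=> //; exact: Dx.
  - move=> y /hg[a [Da ->]]; exists [ffun i => a i].
      by move=> i; rewrite ffunE.
    by apply: eq_bigr => i _; rewrite ffunE.
have /choice[g' hg'] : forall i, exists g', I g' /\ nS (g i - g') <= (2 * C)^-1.
  move=> i; have [|y Iy hy] := (closP nS I (g i)).1 (Eg i) (2 * C)^-1.
    by rewrite invr_gt0 mulr_gt0.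
  by exists y; split => //; rewrite (normBC habs bS) ltW.
have /choice[M hM] : forall i, exists x : {ffun 'I_k -> S},
    [/\ DD x, f x = g i - g' i & pow_norm nS x <= C * nS (g i - g' i)].
  by move=> i; apply: hC; apply: (subspaceB sE) => //; apply: sub_closure; have [] := hg' i.
move=> x /(hg x)[a [Da ->]].
have [||||b [Db hb]] := @neumann D k a (fun i j => M i j) => //.
- by move=> i j; have [] := hM i.
- move=> i j; have [_ _ h] := hM i; apply: le_trans (le_pow_norm nS (M i) j) _.
  apply: le_trans h _; have [_ h] := hg' i.
  apply: le_trans (_ : C * (2 * C)^-1 <= _); first by rewrite ler_pM2l.
  by rewrite invfM mulrCA divff ?mulr1 ?mul1r ?lt0r_neq0.
suff -> : \sum_i a i * g i = \sum_i b i * g' i.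
  by apply: (subspace_sum sI) => i _; apply: IM => //; have [] := hg' i.
have -> : \sum_i b i * g' i = \sum_i b i * g i - \sum_i b i * \sum_j M i j * g j.
  rewrite -sumrB; apply: eq_bigr => i _; rewrite -mulrBr; congr (_ * _).
  by have [_ h _] := hM i; rewrite -/(f (M i)) h opprB addrC subrK.
under [X in _ = _ - X]eq_bigr => i _ do rewrite mulr_sumr.
rewrite exchange_big -sumrB; apply: eq_bigr => j _ /=.
under eq_bigr => i _ do rewrite mulrA.
by rewrite -mulr_suml -mulrBl {1}(hb j) addrK.
Qed.

Hypothesis hSn : noetherian [set: S].
Variable M : lmodType S.

Lemma ann_closed (m : M) : is_closed nS [set s : S | s *: m = 0].
Proof.
apply: (noetherian_closed closed_subringT hSn); split => //=.
- by rewrite scale0r.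
- by move=> x y hx hy; rewrite scalerDl hx hy addr0.
- by move=> s x _ hx; rewrite -scalerA hx scaler0.
Qed.

Lemma ann_subspace (m : M) : subspace [set s : S | s *: m = 0].
Proof.
split=> [|k x y /= hx hy]; first by rewrite /= scale0r.
by rewrite scalerDl hy addr0 -mulr_algl -scalerA hx scaler0.
Qed.

(** Elements close to generators are obtained from them by a matrix 1 + E with
    E small, which is invertible, so they generate too. *)
Lemma dense_generators (X : set M) : finite_over M [set: S] ->
  dense_in (can_nbhs nS (M := M)) X -> gen_by setT X [set: M].
Proof.
move=> [k [g gen]] dX.
have O_nbhs (m : M) : can_nbhs nS (m : restr M)
    [set y : restr M | exists a : 'I_k -> S, (forall i, nS (a i) <= 1 / 2) /\ y = m + \sum_i a i *: g i].
  move=> l h genh.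
  have /choice[c hc] : forall j : 'I_l, exists c : 'I_k -> S, h j = \sum_i c i *: g i.
    by move=> j; have [c [_ hc]] := gen (h j); exists c.
  pose C := \sum_j \sum_i nS (c j i) + 1.
  have S0 j : 0 <= \sum_i nS (c j i) by apply: sumr_ge0 => i _; apply: (norm_ge0 bS).
  have C0 : 0 < C by rewrite ltr_wpDl // sumr_ge0.
  exists (1 / 2 / C) => [|a ha]; first by rewrite !divr_gt0.
  exists (fun i => \sum_j a j * c j i); split.
    move=> i; apply: (norm_sum_le habs bS) => [|j _]; first by rewrite divr_ge0.
    apply: le_trans (normM _ _) _.
    apply: le_trans (_ : (1 / 2 / C) * C <= _); last by rewrite divfK ?gt_eqF.
    apply: ler_pM; rewrite ?(norm_ge0 bS) ?ltW //.
    apply: lt_le_trans (_ : \sum_i nS (c j i) + 1 <= _).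
      by rewrite (bigD1 i) //= -addrA ltrDl ltr_wpDl // sumr_ge0 // => ? _; apply: (norm_ge0 bS).
    by rewrite lerD2r (bigD1 j) //= lerDl sumr_ge0.
  congr (_ + _); under eq_bigr => j _ do rewrite hc scaler_sumr.
  rewrite exchange_big; apply: eq_bigr => i _; rewrite scaler_suml.
  by apply: eq_bigr => j _; rewrite scalerA.
have /choice[y hy] : forall i, exists y : M, X y /\ exists a : 'I_k -> S,
    (forall j, nS (a j) <= 1 / 2) /\ y = g i + \sum_j a j *: g j.
  by move=> i; have [y Xy [a ha]] := dX (g i) _ (O_nbhs (g i)); exists y; split => //; exists a.
have /choice[E hE] : forall i, exists a : 'I_k -> S,
    (forall j, nS (a j) <= 1 / 2) /\ y i = g i + \sum_j a j *: g j.
  by move=> i; have [] := hy i.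
exists k, y; split=> [i|m _]; first by have [] := hy i.
have [a [_ ->]] := gen m.
have [|//|i j|b [_ hb]] := @neumann setT k a (fun i j => - E i j) closed_subringT.
- by [].
- by rewrite (normN habs bS); have [] := hE i.
exists b; split => //.
under [RHS]eq_bigr => i _ do rewrite (proj2 (hE i)) scalerDr scaler_sumr.
rewrite big_split exchange_big -big_split; apply: eq_bigr => j _ /=.
under [X in _ = _ + X]eq_bigr => i _ do rewrite scalerA.
rewrite -scaler_suml -scalerDl {1}(hb j) -addrA -big_split big1 ?addr0 // => i _.
by rewrite /= mulrN addNr.
Qed.

End BanachAlgebra.

(** * Sums of subspaces and products of sets *)

Section SumsOfSubspaces.
Variables (K : fieldType) (U : lmodType K) (I : choiceType).
Variables (P : set I) (V_ : I -> set U).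

Lemma sum_of_min (X : set U) : subspace X -> (forall i, P i -> V_ i `<=` X) ->
  sum_of P V_ `<=` X.
Proof.
move=> hX h x [F [x_ [hF ->]]]; rewrite big_seq; apply: subspace_sum => // i iF.
by have [Pi Vi] := hF i iF; apply: h Vi.
Qed.

Lemma sum_of_in i x : P i -> V_ i x -> sum_of P V_ x.
Proof.
move=> Pi Vx; exists [fset i]%fset, (fun _ => x); split; last by rewrite big_seq_fset1.
by move=> j; rewrite inE => /eqP->.
Qed.

Lemma sum_of_subspace : (forall i, P i -> subspace (V_ i)) -> subspace (sum_of P V_).
Proof.
move=> hV; split; first by exists fset0, (fun _ => 0); split=> //; rewrite big_seq_fset0.
move=> k x y [F [x_ [hF ->]]] [G [y_ [hG ->]]].
exists (F `|` G)%fset,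
  (fun i => k *: (if i \in F then x_ i else 0) + (if i \in G then y_ i else 0)).
split.
  move=> i; rewrite in_fsetU; have [iF _|iF /= iG] := boolP (i \in F).
    have [Pi Vi] := hF i iF; split=> //; apply: (proj2 (hV i Pi)) => //.
    by case: ifP => [/hG[]//|_]; apply: subspace0 (hV i Pi).
  have [Pi Vi] := hG i iG; split=> //; rewrite iG scaler0 add0r //.
rewrite big_split /= -scaler_sumr; congr (_ *: _ + _).
  rewrite -(big_fset_incl _ (fsubsetUl F G)) => [|i _ /negPf->//].
  by apply: eq_big_seq => i ->.
rewrite -(big_fset_incl _ (fsubsetUr F G)) => [|i _ /negPf->//].
by apply: eq_big_seq => i ->.
Qed.
End SumsOfSubspaces.

Section ProductsOfSets.
Variables (K : fieldType) (S : algType K).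
Implicit Types X Y Z : set S.

Lemma prodset_in X Y x y : X x -> Y y -> prodset X Y (x * y).
Proof.
by move=> Xx Yy; exists 1%N, (fun _ => x), (fun _ => y); split=> //; rewrite big_ord1.
Qed.

Lemma prodset_min X Y Z : subspace Z -> (forall x y, X x -> Y y -> Z (x * y)) ->
  prodset X Y `<=` Z.
Proof.
move=> hZ h z [k [x [y [hxy ->]]]]; apply: subspace_sum => // i _.
by have [Xi Yi] := hxy i; apply: h.
Qed.

Lemma prodset_subspace X Y : subspace X -> subspace (prodset X Y).
Proof.
move=> hX; split; first by exists 0%N, (fun _ => 0), (fun _ => 0); split=> [[]//|]; rewrite big_ord0.
move=> c z z' [k [x [y [h ->]]]] [k' [x' [y' [h' ->]]]].
exists (k + k')%N, (fun i => match fintype.split i with inl j => c *: x j | inr j => x' j end),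
  (fun i => match fintype.split i with inl j => y j | inr j => y' j end); split.
  move=> i; case: (fintype.split i) => j; last exact: h'.
  by have [? ?] := h j; split=> //; apply: subspaceZ.
rewrite big_split_ord scaler_sumr; congr (_ + _); apply: eq_bigr => i _.
  by rewrite -[lshift _ _]/(unsplit (inl i)) unsplitK scalerAl.
by rewrite -[rshift _ _]/(unsplit (inr i)) unsplitK.
Qed.

Lemma prodsetS X Y X' Y' : X `<=` X' -> Y `<=` Y' -> prodset X Y `<=` prodset X' Y'.
Proof.
move=> hX hY z [k [x [y [h ->]]]]; exists k, x, y; split=> // i.
by have [? ?] := h i; split; [apply: hX | apply: hY].
Qed.

Lemma subspace_mulr_pre (Z : set S) a : subspace Z -> subspace [set x | Z (x * a)].
Proof.
move=> hZ; split; first by rewrite /= mul0r; apply: subspace0.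
by move=> k x y /= hx hy; rewrite mulrDl -scalerAl; apply: (proj2 hZ).
Qed.
Lemma subspace_mull_pre (Z : set S) a : subspace Z -> subspace [set x | Z (a * x)].
Proof.
move=> hZ; split; first by rewrite /= mulr0; apply: subspace0.
by move=> k x y /= hx hy; rewrite mulrDr -scalerAr; apply: (proj2 hZ).
Qed.
End ProductsOfSets.

Lemma subspaceI (K : fieldType) (V : lmodType K) (X Y : set V) :
  subspace X -> subspace Y -> subspace (X `&` Y).
Proof.
move=> hX hY; split; first by split; apply: subspace0.
by move=> k x y [? ?] [? ?]; split; [apply: (proj2 hX) | apply: (proj2 hY)].
Qed.

Section ExtendedFamilies.
Variables (V : nmodType) (k : nat) (g : 'I_k -> V).
Definition ext0 (n : nat) : V := if insub n is Some i then g i else 0.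
Lemma ext0E (i : 'I_k) : ext0 i = g i. Proof. by rewrite /ext0 valK. Qed.
Lemma ext0_prop (X : V -> Prop) : X 0 -> (forall i, X (g i)) -> forall n, X (ext0 n).
Proof. by move=> X0 h n; rewrite /ext0; case: insub. Qed.
End ExtendedFamilies.

(** * Triangular decompositions *)

Section TriangularDecomposition.
Variables (K : fieldType) (S : algType K).
Variables (R : subalgClosed S) (gr : int -> set S).
Variables (A B H : subalgClosed S) (d : S).
Hypothesis hT : alg_tri_decomp R gr A B H d.
Hypothesis char0 : forall n : nat, n%:R = 0 :> K -> n = 0%N.

Lemma natr_inj (m n : nat) : m%:R = n%:R :> K -> m = n.
Proof.
wlog mn : m n / (m <= n)%N => [hw|].
  by case/orP: (leq_total m n) => h e; [apply: hw | apply/esym/hw].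
move=> e; have : (n - m)%:R = 0 :> K by rewrite natrB // e subrr.
by move/char0/eqP; rewrite subn_eq0 => nm; apply/eqP; rewrite eqn_leq mn.
Qed.
Lemma intr_inj (m n : int) : m%:~R = n%:~R :> K -> m = n.
Proof.
move=> e; apply/eqP; rewrite -subr_eq0; apply/eqP.
have : (m - n)%:~R = 0 :> K by rewrite intrB e subrr.
case: (m - n) => k; first by move/char0->.
by rewrite NegzE mulrNz => /eqP; rewrite oppr_eq0 => /eqP /char0.
Qed.

Lemma grP n x : gr n x <-> x \in R /\ d * x - x * d = n%:~R *: x.
Proof. by rewrite (td_weight hT). Qed.
Lemma gr_subspace n : subspace (gr n).
Proof.
split; last by move=> k x y; case: (td_graded hT) => h _ _ _ _; apply: h.
by apply/grP; rewrite mulr0 mul0r subrr scaler0; split=> //; apply: rpred0.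
Qed.
Lemma gr_mul m n x y : gr m x -> gr n y -> gr (m + n) (x * y).
Proof. by case: (td_graded hT) => _ _ h _ _; apply: h. Qed.
Lemma gr1 : gr 0 1. Proof. by case: (td_graded hT). Qed.
Lemma gr_R n x : gr n x -> x \in R. Proof. by case/grP. Qed.
Lemma H_gr0 h : h \in H -> gr 0 h. Proof. by move=> hh; apply: (td_subH hT). Qed.
Lemma H_R h : h \in H -> h \in R. Proof. by move/H_gr0/gr_R. Qed.
Lemma A_R h : h \in A -> h \in R. Proof. by move=> hh; apply: (td_subA hT). Qed.
Lemma B_R h : h \in B -> h \in R. Proof. by move=> hh; apply: (td_subB hT). Qed.
Lemma R_sum : [set` R] = sum_of setT gr. Proof. by case: (td_graded hT). Qed.
Lemma alg_subspace (D : subalgClosed S) : subspace [set` D].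
Proof. by split=> /= [|k x y hx hy]; [apply: rpred0 | rewrite rpredD ?rpredZ]. Qed.
Lemma piece_subspace (D : subalgClosed S) n : subspace (piece gr D n).
Proof. by apply: subspaceI; [apply: alg_subspace | apply: gr_subspace]. Qed.

Lemma gr_comm n x : gr n x -> d * x = x * d + n%:~R *: x.
Proof. by case/grP=> _ <-; rewrite addrC subrK. Qed.

Lemma gr_disjoint n z : gr n z -> sum_of [set m | m != n] gr z -> z = 0.
Proof.
case: (td_graded hT) => _ _ _ _ ind gz [F [x_ [hF ez]]].
have nF : n \notin F by apply/negP => /hF[] /=; rewrite eqxx.
have := ind (n |` F)%fset (fun i => if i == n then - z else x_ i).
move=> /(_ _ _ n); rewrite eqxx => h; rewrite -[z]opprK h ?oppr0 ?fset1U1 //.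
- move=> i; rewrite in_fset1U; case: eqP => [-> _|_ /= /hF[]//].
  by apply: subspaceN => //; apply: gr_subspace.
- rewrite big_fsetU1 //= eqxx {1}ez; apply/eqP; rewrite addrC subr_eq0; apply/eqP.
  by apply: eq_big_seq => i iF; case: eqP => // e; move: nF; rewrite -e iF.
Qed.

(** The component of degree n for the grading; meaningful on R. *)
Definition pr (n : int) (x : S) : S :=
  xget 0 [set y | gr n y /\ sum_of [set m | m != n] gr (x - y)].

Lemma co_subspace n : subspace (sum_of [set m | m != n] gr).
Proof. by apply: sum_of_subspace => i _; apply: gr_subspace. Qed.

Lemma prP n x : x \in R -> gr n (pr n x) /\ sum_of [set m | m != n] gr (x - pr n x).
Proof.
move=> Rx; apply: (@xgetPex _ 0 [set y | gr n y /\ sum_of [set m | m != n] gr (x - y)]).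
have : [set` R] x by [].
rewrite R_sum; move: x {Rx}; apply: (@sum_of_min _ _ _ _ _ [set x : S | exists y,
  [set y | gr n y /\ sum_of [set m | m != n] gr (x - y)] y]).
  split; first by exists 0; split; [|rewrite subr0]; apply: subspace0;
    [apply: gr_subspace | apply: co_subspace].
  move=> k x x' [y [gy hy]] [y' [gy' hy']]; exists (k *: y + y'); split.
    by apply: (proj2 (gr_subspace n)).
  by rewrite opprD addrACA -scalerBr; apply: (proj2 (co_subspace n)).
move=> m _ x gx; have [e|ne] := eqVneq m n.
  by exists x; split; rewrite -?e // subrr; apply: subspace0; apply: co_subspace.
exists 0; split; first by apply: subspace0; apply: gr_subspace.
by rewrite subr0; apply: sum_of_in gx.
Qed.
Lemma pr_uniq n x y : x \in R -> gr n y -> sum_of [set m | m != n] gr (x - y) -> pr n x = y.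
Proof.
move=> Rx gy hy; have [gz hz] := prP n Rx; apply/eqP; rewrite -subr_eq0; apply/eqP.
apply: (gr_disjoint (n := n)); first by apply: subspaceB => //; apply: gr_subspace.
have -> : pr n x - y = (x - y) - (x - pr n x) by rewrite opprB [RHS]addrC addrA subrK.
by apply: subspaceB => //; apply: co_subspace.
Qed.
Lemma pr_id n x : gr n x -> pr n x = x.
Proof.
move=> gx; apply: pr_uniq => //; first exact: gr_R gx.
by rewrite subrr; apply: subspace0; apply: co_subspace.
Qed.
Lemma pr_other m n x : gr m x -> m != n -> pr n x = 0.
Proof.
move=> gx mn; apply: pr_uniq; first exact: gr_R gx.
  by apply: subspace0; apply: gr_subspace.
by rewrite subr0; apply: sum_of_in gx.
Qed.
Lemma pr_lin n : lin_on [set` R] (pr n).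
Proof.
move=> k x y /= Rx Ry; have [gx hx] := prP n Rx; have [gy hy] := prP n Ry.
apply: pr_uniq; first by rewrite rpredD ?rpredZ.
  by apply: (proj2 (gr_subspace n)).
by rewrite opprD addrACA -scalerBr; apply: (proj2 (co_subspace n)).
Qed.
Lemma pr_mul0l n h x : gr 0 h -> x \in R -> pr n (h * x) = h * pr n x.
Proof.
move=> gh Rx; have [gx hx] := prP n Rx; apply: pr_uniq.
- by apply: rpredM => //; apply: gr_R gh.
- by have := gr_mul gh gx; rewrite add0r.
rewrite -mulrBr; move: (x - _) hx; apply: sum_of_min.
  by apply: subspace_mull_pre; apply: co_subspace.
by move=> m mn y gy /=; apply: (sum_of_in (i := m)) => //; have := gr_mul gh gy; rewrite add0r.
Qed.

Lemma pr_sub (D : subalgClosed S) (P : set int) n : [set` D] `<=` [set` R] ->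
  [set` D] = sum_of P (piece gr D) -> forall x, x \in D -> piece gr D n (pr n x).
Proof.
move=> DR e x Dx; have : [set` D] x by [].
rewrite e => hx; suff: ([set` R] `&` [set x | piece gr D n (pr n x)]) x by case.
move: x hx {Dx}; apply: sum_of_min.
  split; first by split; [apply: rpred0 | rewrite /= (pr_id (x := 0)); apply: subspace0;
    [apply: piece_subspace | apply: gr_subspace]].
  move=> k x y [Rx hx] [Ry hy]; split; first exact: (proj2 (alg_subspace R)).
  by rewrite /= pr_lin //; apply: (proj2 (piece_subspace D n)).
move=> m _ x [Dx gx]; split; first exact: DR.
have [<-|mn] := eqVneq m n; first by rewrite /= (pr_id gx).
by rewrite /= (pr_other gx mn); apply: subspace0; apply: piece_subspace.
Qed.

Lemma B_min (X : set S) : subspace X -> (forall j, Bup gr B j `<=` X) -> [set` B] `<=` X.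
Proof.
move=> hX h; rewrite (td_gradB hT); apply: sum_of_min => // i /= i0.
by have := h `|i|%N; rewrite /Bup (lez0_abs i0) opprK.
Qed.
Lemma A_min (X : set S) : subspace X -> (forall j : nat, piece gr A j `<=` X) -> [set` A] `<=` X.
Proof.
move=> hX h; rewrite (td_gradA hT); apply: sum_of_min => // i /= i0.
by have := h `|i|%N; rewrite (gez0_abs i0).
Qed.

Lemma Bup_subspace j : subspace (Bup gr B j). Proof. exact: piece_subspace. Qed.
Lemma Bup_mul i j x y : Bup gr B i x -> Bup gr B j y -> Bup gr B (i + j) (x * y).
Proof.
by move=> [/= Bx gx] [/= By gy]; split=> /=; [rewrite rpredM | rewrite PoszD opprD; apply: gr_mul].
Qed.
Lemma Bgt_subspace n : subspace (Bgt gr B n).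
Proof. by apply: sum_of_subspace => i _; apply: Bup_subspace. Qed.
Lemma Bgt_min n (X : set S) : subspace X -> (forall j, (n < j)%N -> Bup gr B j `<=` X) ->
  Bgt gr B n `<=` X.
Proof. by move=> hX h; apply: sum_of_min. Qed.
Lemma Bgt_in n j x : (n < j)%N -> Bup gr B j x -> Bgt gr B n x.
Proof. by move=> nj; apply: sum_of_in. Qed.
Lemma Bgt_B n : Bgt gr B n `<=` [set` B].
Proof. by apply: Bgt_min => [|j _ x []//]; apply: alg_subspace. Qed.

Lemma Bgt_mulr n x b : Bgt gr B n x -> b \in B -> Bgt gr B n (x * b).
Proof.
move=> hx Bb; have hG := Bgt_subspace n.
move: x hx; apply: Bgt_min => [|j nj x hx]; first exact: subspace_mulr_pre.
move: b Bb; apply: (@B_min [set b | Bgt gr B n (x * b)]); first exact: subspace_mull_pre.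
by move=> i b hb; apply: (Bgt_in (j := (j + i)%N)); [rewrite ltn_addr | apply: Bup_mul].
Qed.
Lemma Bgt_mull n x b : Bgt gr B n x -> b \in B -> Bgt gr B n (b * x).
Proof.
move=> hx Bb; have hG := Bgt_subspace n.
move: x hx; apply: Bgt_min => [|j nj x hx]; first exact: subspace_mull_pre.
move: b Bb; apply: (@B_min [set b | Bgt gr B n (b * x)]); first exact: subspace_mulr_pre.
by move=> i b hb; apply: (Bgt_in (j := (i + j)%N)); [rewrite ltn_addl | apply: Bup_mul].
Qed.

Lemma Bup_H j b h : Bup gr B j b -> h \in H -> prodset [set` H] (Bup gr B j) (b * h).
Proof.
move=> [/= Bb gb] Hh; have : prodset [set` B] [set` H] (b * h) by apply: prodset_in.
rewrite (td_BH hT) => -[k [x [y [hxy e]]]].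
have gbh : gr (- j%:Z) (b * h) by rewrite -[- _]addr0; apply: gr_mul => //; apply: H_gr0.
exists k, x, (fun i => pr (- j%:Z) (y i)); split=> [i|].
  have [Hx By] := hxy i; split=> //.
  by apply: (pr_sub _ _ (td_gradB hT)) => //; apply: (td_subB hT).
rewrite -{1}(pr_id gbh) e (lin_on_sum _ (alg_subspace R) (pr_lin _)); last first.
  by move=> i _; have [Hx By] := hxy i; rewrite /= rpredM ?(H_R Hx) ?(B_R By).
by apply: eq_bigr => i _; have [Hx By] := hxy i; apply: pr_mul0l; [apply: H_gr0 | apply: B_R].
Qed.
Lemma Bgt_H n b h : Bgt gr B n b -> h \in H -> prodset [set` H] (Bgt gr B n) (b * h).
Proof.
move=> hb Hh; move: b hb; apply: Bgt_min.
  by apply: subspace_mulr_pre; apply: prodset_subspace; apply: alg_subspace.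
move=> j nj b hb /=; have := Bup_H hb Hh; apply: prodsetS => // x.
exact: Bgt_in.
Qed.

Lemma AHB_subspace : subspace (prodset [set` A] (prodset [set` H] [set` B])).
Proof. by apply: prodset_subspace; apply: alg_subspace. Qed.

Lemma R_AHB : [set` R] `<=` prodset [set` A] (prodset [set` H] [set` B]).
Proof.
pose N := prodset [set` A] (prodset [set` H] [set` B]).
have hN : submodule N := subspace_submodule AHB_subspace.
have hP := submodule_setT S.
have tri : trilin_on [set` A] [set` H] [set` B]
    (fun _ _ _ : S => 0 : subquotient hP hN).
  by split=> *; move=> k x y _ _; rewrite scaler0 addr0.
move=> x Rx; apply/(sq_pi_eq0 hP hN) => //.
have [_ h] := td_tensor hT tri.
apply: (h (sq_pi hP hN) (fun _ => 0)) => //.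
- by move=> k y z _ _; apply: sq_pi_lin.
- move=> a b c Aa Hb Bc; apply/sq_pi_eq0 => //.
  by rewrite -mulrA; apply: prodset_in => //; apply: prodset_in.
- by move=> k y z _ _; rewrite scaler0 addr0.
Qed.

Lemma R_ind (X : set S) : subspace X ->
  (forall (m l : nat) a h b, piece gr A m a -> h \in H -> Bup gr B l b -> X (a * (h * b))) ->
  [set` R] `<=` X.
Proof.
move=> hX h; apply: subset_trans R_AHB _; apply: prodset_min => // a y Aa hy.
move: y hy; apply: prodset_min; first exact: subspace_mull_pre.
move=> c b Hc Bb /=; move: a Aa.
apply: (@A_min [set a | X (a * (c * b))]); first exact: subspace_mulr_pre.
move=> m a ha /=; move: b Bb.
apply: (@B_min [set b | X (a * (c * b))]); last by move=> l b hb; apply: (h m l).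
by have := subspace_mull_pre c (subspace_mull_pre a hX).
Qed.

Lemma B_low n : exists (k : nat) (g : 'I_k -> S), (forall i, exists j, Bup gr B j (g i)) /\
  forall x, x \in B -> exists c : 'I_k -> K, Bgt gr B n (x - \sum_i c i *: g i).
Proof.
have /fin_all_exists[q /fin_all_exists[f hf]] : forall j : 'I_n.+1, exists q (f : 'I_q -> S),
    (forall i, Bup gr B j (f i)) /\
    forall x, Bup gr B j x -> exists c : 'I_q -> K, x = \sum_i c i *: f i.
  by move=> j; have [_] := td_findim hT (- (j : nat)%:Z).
pose J : finType := {j : 'I_n.+1 & 'I_(q j)}.
pose g (t : J) : S := f (tag t) (tagged t).
suff h x : x \in B -> exists c : J -> K, Bgt gr B n (x - \sum_t c t *: g t).
  exists #|J|, (fun i => g (enum_val i)); split=> [i|x /h[c hc]].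
    by exists (tag (enum_val i)); have [h1 _] := hf (tag (enum_val i)); apply: h1.
  exists (fun i => c (enum_val i)).
  by rewrite -(big_enum_val (fun t : J => c t *: g t)).
have hG := Bgt_subspace n.
move: x; apply: (@B_min [set x : S | exists c : J -> K, Bgt gr B n (x - \sum_t c t *: g t)]).
  split.
    exists (fun _ => 0); rewrite big1 ?subr0; last by move=> i _; rewrite scale0r.
    exact: subspace0.
  move=> k x y [c hc] [c' hc']; exists (fun i => k * c i + c' i).
  under eq_bigr => i _ do rewrite scalerDl -scalerA.
  rewrite big_split -scaler_sumr opprD addrACA -scalerBr.
  exact: (proj2 hG).
move=> j x hx; have [nj|jn] := ltnP n j.
  exists (fun _ => 0); rewrite big1 ?subr0; last by move=> i _; rewrite scale0r.
  exact: Bgt_in hx.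
have [_ h] := hf (inord j); have [|c hc] := h x; first by rewrite inordK.
pose c' (t : J) : K := if tag t =P inord j is ReflectT e
  then c (eq_rect (tag t) (fun j => 'I_(q j)) (tagged t) _ e) else 0.
exists c'; have -> : \sum_t c' t *: g t = x; last by rewrite subrr; apply: subspace0.
rewrite (eq_bigr (fun t : J => c' (Tagged (fun j => 'I_(q j)) (tagged t)) *: f (tag t) (tagged t)));
  last by case.
rewrite -(sig_big_dep xpredT (fun _ _ => true)
  (fun j i => c' (Tagged (fun j => 'I_(q j)) i) *: f j i)) /=.
rewrite (bigD1 (inord j)) //= [X in _ + X]big1 ?addr0.
  rewrite [RHS]hc; apply: eq_bigr => i _; rewrite /c' /=.
  by case: eqP => // e; rewrite (eq_irrelevance e erefl).
move=> j' nj; apply: big1 => i _; rewrite /c' /=; case: eqP => [e|_].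
  by rewrite e eqxx in nj.
by rewrite scale0r.
Qed.
End TriangularDecomposition.

(** * Finite-dimensional semisimple algebras *)

Lemma linear_pack (T : pzRingType) (U V : lmodType T) (f : U -> V) :
  (forall k x y, f (k *: x + y) = k *: f x + f y) -> exists g : {linear U -> V}, forall x, g x = f x.
Proof.
move=> hf; pose g : {linear U -> V} := HB.pack f (GRing.isLinear.Build T U V *:%R f hf).
by exists g.
Qed.

Section Semisimple.
Variables (K : fieldType) (T : algType K).

(** Equivalently, the left ideal T e is simple. *)
Definition minimal_elt (e : T) : Prop :=
  e <> 0 /\ forall h, h * e <> 0 -> exists h', h' * (h * e) = e.

Lemma minimal_mull h e : minimal_elt e -> h * e <> 0 -> minimal_elt (h * e).
Proof.
move=> [e0 he] he0; split=> // k hk; have [|h' eh'] := he (k * h); first by rewrite -mulrA.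
by exists (h * h'); rewrite -mulrA [k * _]mulrA eh'.
Qed.

Variables (t : nat) (u : nat -> T).
Hypothesis hu : forall x, exists c : nat -> K, x = \sum_(i < t) c i *: u i.

(** The positions of the leading terms of the elements of X: a subspace is
    determined, among those that contain it, by this finite set. *)
Definition pivots (X : set T) : {set 'I_t} :=
  [set i : 'I_t | `[< exists c : nat -> K, X (u i + \sum_(j < i) c j *: u j) >]].

Lemma pivots_le X Y : subspace X -> subspace Y -> X `<=` Y ->
  pivots Y \subset pivots X -> Y `<=` X.
Proof.
move=> hX hY XY sub.
suff h s : (s <= t)%N -> forall y (c : nat -> K), Y y -> y = \sum_(i < s) c i *: u i -> X y.
  by move=> y Yy; have [c hc] := hu y; apply: (h t (leqnn t) y c).
elim: s => [|s IH] st y c Yy ey; first by rewrite ey big_ord0; apply: subspace0.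
have [cs0|csn0] := eqVneq (c s) 0.
  apply: (IH (ltnW st) y c) => //.
  by rewrite ey big_ord_recr /= cs0 scale0r addr0.
have : Ordinal st \in pivots Y.
  rewrite inE; apply/asboolP; exists (fun i => (c s)^-1 * c i).
  have -> : u (Ordinal st) + \sum_(j < Ordinal st) ((c s)^-1 * c j) *: u j = (c s)^-1 *: y.
    rewrite ey big_ord_recr /= scalerDr scalerA mulVf // scale1r addrC scaler_sumr.
    by congr (_ + _); apply: eq_bigr => i _; rewrite scalerA.
  exact: subspaceZ.
move=> /(fintype.subsetP sub); rewrite inE => /asboolP[b Xb].
set x := _ + _ in Xb; rewrite -[y](subrK (c s *: x)).
apply: subspaceD => //; last exact: subspaceZ.
apply: (IH (ltnW st) _ (fun i => c i - c s * b i)).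
  by apply: subspaceB => //; apply: subspaceZ => //; apply: XY.
rewrite ey big_ord_recr /= /x scalerDr opprD addrA addrK scaler_sumr -sumrB.
by apply: eq_bigr => i _; rewrite scalerBl scalerA.
Qed.

Lemma ideal_subspace (I : set T^o) : submodule I -> subspace (I : set T).
Proof.
move=> hI; split; first exact: submodule0 hI.
move=> k x y Ix Iy; have := submoduleZ hI (k%:A : T) Ix.
by rewrite /= /GRing.scale /= mulr_algl => h; apply: (submoduleD hI h Iy).
Qed.

(** Descent on the number of pivots, which plays the role of the dimension. *)
Lemma minimal_exists (I : set T^o) x : submodule I -> I x -> x <> 0 ->
  exists2 e, I e & minimal_elt e.
Proof.
have [n] := ubnP #|pivots I|; elim: n => // n IH in I x * => cI hI Ix x0.
have [mx|nmx] := pselect (minimal_elt x); first by exists x.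
have [h [hx nh]] : exists h, h * x <> 0 /\ forall h', h' * (h * x) <> x.
  apply: contrapT => H; apply: nmx; split=> // h hx; apply: contrapT => G.
  by apply: H; exists h; split=> // h' e; apply: G; exists h'.
pose J : set T^o := [set y | exists h', y = h' * (h * x)].
have hJ : submodule J.
  split; first by exists 0; rewrite mul0r.
    by move=> _ _ [a ->] [b ->]; exists (a + b); rewrite mulrDl.
  by move=> s _ [a ->]; exists (s * a); exact: mulrA.
have JI : J `<=` I.
  by move=> _ [a ->]; rewrite mulrA; apply: (submoduleZ hI (a * h : T) Ix).
have [||||e Je me] := IH J (h * x) => //; last by exists e => //; apply: JI.
- rewrite ltnS in cI; apply: leq_trans cI; apply: proper_card; apply/fintype.properP; split.
    apply/fintype.subsetP => i; rewrite inE => /asboolP[c hc]; rewrite inE; apply/asboolP; exists c; exact: (JI _ hc).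
  apply: contrapT => H; suff /(_ x Ix) [h' e] : (I : set T) `<=` J by apply: (nh h').
  apply: pivots_le => //; try exact: ideal_subspace.
  apply/fintype.subsetP => i Ii; apply: contrapT => /negP nJ; apply: H; exists i => //.
- by exists 1; rewrite mul1r.
Qed.

Hypothesis ssT : semisimple_alg T.

(** The sum of all simple left ideals has a complement; were it nonzero, it
    would contain a simple left ideal. *)
Lemma unit_sum_minimal : exists (q : nat) (e : 'I_q -> T),
  (forall i, minimal_elt (e i)) /\ 1 = \sum_i e i.
Proof.
pose X : set T^o := [set x | exists s : seq T, {in s, forall e, minimal_elt e} /\ x = \sum_(e <- s) e].
have hX : submodule X.
  split; first by exists [::]; rewrite big_nil.
    move=> _ _ [s [hs ->]] [s' [hs' ->]]; exists (s ++ s'); rewrite big_cat; split=> // e.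
    by rewrite mem_cat => /orP[/hs|/hs'].
  move=> a _ [s [hs ->]]; exists [seq x <- [seq a * e | e <- s] | x != 0]; split.
    move=> e; rewrite mem_filter => /andP[/eqP ae0 /mapP[e' es' ee]].
    by rewrite ee in ae0 *; apply: minimal_mull => //; apply: hs.
  rewrite /GRing.scale /= big_filter big_map mulr_sumr.
  by rewrite [RHS]big_mkcond; apply: eq_bigr => e _; case: eqP.
have [J [hJ XJ hXJ]] := ssT hX.
have [x [y [[s [hs ex]] Jy e1]]] := hXJ 1.
have y0 : y = 0.
  apply: contrapT => y0; have [e Je me] := minimal_exists hJ Jy y0.
  have : (X `&` J) e by split => //; exists [:: e]; split; [move=> z; rewrite inE => /eqP-> | rewrite big_seq1].
  by rewrite XJ => e0; case: me.
exists (size s), (tnth (in_tuple s)); split.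
  by move=> i; apply: hs; apply: mem_tnth.
by rewrite e1 y0 addr0 ex big_tnth.
Qed.
End Semisimple.

Section SimpleQuotient.
Variables (K : fieldType) (T : algType K) (e : T).

Lemma ann_submodule : submodule (S := T) (M := T^o) [set h | h * e = 0].
Proof.
split=> /= [|x y hx hy|s x hx]; first by rewrite mul0r.
  by rewrite mulrDl hx hy addr0.
by rewrite /GRing.scale /= -mulrA hx mulr0.
Qed.

(** A copy of the left ideal T e. *)
Definition cyclic_quotient : lmodType T :=
  subquotient (submodule_setT (T^o : lmodType T)) ann_submodule.
Definition cyclic_gen : cyclic_quotient := sq_pi _ _ (1 : T^o).

Lemma cyclic_genP w : exists h : T, w = h *: cyclic_gen.
Proof.
have [x _ ->] := sq_surj (hP := submodule_setT T^o) (hN := ann_submodule) w.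
exists x; rewrite /cyclic_gen -sq_piZ //; congr sq_pi.
by rewrite /GRing.scale /= mulr1.
Qed.
Lemma cyclic_gen_eq0 h : h *: cyclic_gen = 0 <-> h * e = 0.
Proof.
rewrite /cyclic_gen -sq_piZ // sq_pi_eq0 //.
by rewrite /GRing.scale /= mulr1.
Qed.

Lemma cyclic_irreducible : minimal_elt e -> irreducible cyclic_quotient.
Proof.
move=> [e0 he]; split.
  exists cyclic_gen; rewrite -[cyclic_gen]scale1r => /cyclic_gen_eq0.
  by rewrite mul1r.
move=> N hN; have [[w [Nw w0]]|nN] := pselect (exists w, N w /\ w <> 0); [right|left].
  have [h ew] := cyclic_genP w; rewrite ew in Nw w0.
  have [|h' eh] := he h; first by move=> /cyclic_gen_eq0.
  apply/seteqP; split=> // v _; have [a ->] := cyclic_genP v.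
  suff : N cyclic_gen by apply: submoduleZ.
  suff <- : h' *: (h *: cyclic_gen) = cyclic_gen by apply: submoduleZ.
  apply/eqP; rewrite -subr_eq0 scalerA -{2}[cyclic_gen]scale1r -scalerBl; apply/eqP.
  by apply/cyclic_gen_eq0; rewrite mulrBl mul1r -mulrA eh subrr.
apply/seteqP; split=> w; last by move=> ->; apply: submodule0.
by move=> Nw; apply: contrapT => w0; apply: nN; exists w.
Qed.
End SimpleQuotient.

(** * The degree-zero part of a triangular decomposition *)

Lemma val_subalgZ (K : fieldType) (S : algType K) (H : subalgClosed S) k (x : subalg H) :
  val (k *: x) = k *: val x.
Proof. by rewrite linearZ. Qed.

Section DegreeZero.
Variables (K : fieldType) (S : algType K).
Variables (R : subalgClosed S) (gr : int -> set S).
Variables (A B H : subalgClosed S) (d : S).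
Hypothesis hT : alg_tri_decomp R gr A B H d.
Hypothesis char0 : forall n : nat, n%:R = 0 :> K -> n = 0%N.

Let AHBgt := prodset [set` A] (prodset [set` H] (Bgt gr B 0)).

Lemma AHBgt_subspace : subspace AHBgt.
Proof. by apply: prodset_subspace; apply: alg_subspace. Qed.

(** In a product a h b of degree 0, either a and b are scalars or b has
    negative degree. *)
Lemma degree0_split x : gr 0 x -> exists2 h, h \in H & AHBgt (x - h).
Proof.
move=> gx; have Rx := gr_R hT gx; have hG := AHBgt_subspace.
suff [_ [h [Hh hx]]] : ([set` R] `&` [set x | exists h, h \in H /\ AHBgt (pr gr 0 x - h)]) x.
  by exists h => //; rewrite (pr_id hT gx) in hx.
move: x {gx} Rx; apply: (R_ind hT).
  split; first by split; [apply: rpred0 | exists 0; rewrite rpred0 (pr_id hT (x := 0)) ?subr0;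
    [split=> //; apply: subspace0 | apply: subspace0 (gr_subspace hT 0)]].
  move=> k x y [Rx [h [Hh hx]]] [Ry [h' [Hh' hy]]].
  split; first exact: (proj2 (alg_subspace R)).
  exists (k *: h + h'); rewrite rpredD ?rpredZ //; split=> //.
  rewrite (pr_lin hT) // opprD addrACA -scalerBr; exact: (proj2 hG).
move=> m l a h b [/= Aa ga] Hh hb; have [Bb gb] := hb.
have gx : gr (m%:Z - l%:Z) (a * (h * b)).
  apply: (gr_mul hT) => //; rewrite -[- _]add0r; apply: (gr_mul hT) => //.
  exact: (H_gr0 hT).
split; first exact: (gr_R hT gx).
have [ml|ml] := eqVneq m l; last first.
  exists 0; rewrite rpred0; split=> //; rewrite (pr_other hT gx) ?subr0 ?subr_eq0 //.
  exact: subspace0.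
subst l; rewrite subrr in gx; rewrite /= (pr_id hT gx).
case: m ga gb hb gx => [|m] ga gb hb gx.
  have : piece gr A 0 a by [].
  rewrite (td_A0 hT) => -[k ek].
  have : piece gr B 0 b by split=> //; rewrite oppr0 in gb.
  rewrite (td_B0 hT) => -[k' ek'].
  exists (a * (h * b)); rewrite subrr ek ek' mulr_algl mulr_algr !rpredZ //; split=> //.
  exact: subspace0.
exists 0; rewrite rpred0 subr0; split=> //; apply: prodset_in => //; apply: prodset_in => //.
exact: Bgt_in hb.
Qed.

(** The tensor decomposition of R provides the linear map a h b |-> a h b_0,
    with b_0 the component of b in degree 0. It is the identity on H and kills
    A H B^{>0}. *)
Lemma H_AHBgt_disjoint x : x \in H -> AHBgt x -> x = 0.
Proof.
move=> Hx hx; have linR := pr_lin hT 0.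
have tri : trilin_on [set` A] [set` H] [set` B] (fun a h b => a * (h * pr gr 0 b)).
  split=> [h b _ _ k y z _ _|a b _ _ k y z _ _|a h _ _ k y z By Bz].
  - by rewrite mulrDl scalerAl.
  - by rewrite mulrDl mulrDr -scalerAl -scalerAr.
  - by rewrite (linR k y z (B_R hT By) (B_R hT Bz)) !mulrDr -!scalerAr.
have [[g [lg pg]] _] := td_tensor hT tri.
have gH : g x = x.
  rewrite -[x in LHS]mul1r -[1 * x in LHS]mulr1 pg ?rpred1 //; try exact: rpred1.
  by rewrite (pr_id hT (gr1 hT)) mulr1 mul1r.
suff : ([set` R] `&` [set x | g x = 0]) x by case=> _ gx0; rewrite -gH.
have sZ : subspace ([set` R] `&` [set x | g x = 0]).
  split; first by split; [apply: rpred0 | apply: (lin_on0 (alg_subspace R) lg)].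
  move=> k y z [Ry gy] [Rz gz]; split; first exact: (proj2 (alg_subspace R)).
  by rewrite /= lg // gy gz scaler0 addr0.
move: {gH Hx} x hx; apply: prodset_min => // a y Aa; move: y.
apply: prodset_min; first exact: subspace_mull_pre.
move=> h b Hh hb; move: b hb; apply: Bgt_min.
  by have := subspace_mull_pre h (subspace_mull_pre a sZ).
move=> j j0 b [/= Bb gb]; split.
  by rewrite /= !rpredM ?(A_R hT Aa) ?(H_R hT Hh) ?(B_R hT Bb).
rewrite /= mulrA pg // (pr_other hT gb) ?mulr0 //.
by rewrite oppr_eq0; case: j j0 {gb}.
Qed.

Lemma AHBgt_mulHl h x : h \in H -> AHBgt x -> AHBgt (h * x).
Proof.
move=> Hh; have hG := AHBgt_subspace.
move: x; apply: prodset_min => [|a y Aa hy]; first exact: subspace_mull_pre.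
have : prodset [set` H] [set` A] (h * a) by apply: prodset_in.
rewrite (td_HA hT) /= mulrA; move: (h * a); apply: prodset_min; first exact: subspace_mulr_pre.
move=> a' h' Aa' Hh' /=; rewrite -mulrA; apply: prodset_in => //.
move: y hy; apply: prodset_min.
  by apply: subspace_mull_pre; apply: prodset_subspace; apply: alg_subspace.
by move=> k b Hk hb; rewrite /= mulrA; apply: prodset_in => //=; rewrite rpredM.
Qed.

Lemma AHBgt_mulHr h x : h \in H -> AHBgt x -> AHBgt (x * h).
Proof.
move=> Hh; have hG := AHBgt_subspace.
move: x; apply: prodset_min => [|a y Aa hy]; first exact: subspace_mulr_pre.
rewrite /= -mulrA; apply: prodset_in => //; move: y hy.
have hHB : subspace (prodset [set` H] (Bgt gr B 0)).
  by apply: prodset_subspace; apply: alg_subspace.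
apply: prodset_min; first exact: subspace_mulr_pre.
move=> k b Hk hb; rewrite /= -mulrA; move: (b * h) (Bgt_H hT hb Hh).
apply: prodset_min; first exact: subspace_mull_pre.
by move=> h' b' Hh' hb'; rewrite /= mulrA; apply: prodset_in => //=; rewrite rpredM.
Qed.

(** As d commutes with H, which has degree 0, so does its component d0,
    because H meets A H B^{>0} trivially. *)
Lemma d_split : exists (d' : S) (d0 : subalg H),
  [/\ d = d' + val d0, AHBgt d' & forall h, d0 * h = h * d0].
Proof.
have [h0 Hh0 hd'] := degree0_split (td_deg0 hT).
exists (d - h0), (Subalg Hh0); split=> //; first by rewrite /= subrK.
move=> [h Hh]; apply/val_inj; rewrite /= -[LHS]/(h0 * h) -[RHS]/(h * h0).
apply/eqP; rewrite -subr_eq0; apply/eqP; apply: H_AHBgt_disjoint.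
  by apply: (subspaceB (alg_subspace H)); apply: rpredM.
have dh : d * h = h * d by rewrite (gr_comm hT (H_gr0 hT Hh)) scale0r addr0.
have -> : h0 * h - h * h0 = h * (d - h0) - (d - h0) * h.
  by rewrite mulrBr mulrBl dh opprB [RHS]addrC addrA subrK.
by apply: (subspaceB AHBgt_subspace); [apply: AHBgt_mulHl | apply: AHBgt_mulHr].
Qed.

(** Schur's lemma: d0 acts on W by an endomorphism. *)
Lemma central_scalar (W : lmodType (subalg H)) (d0 : subalg H) : irreducible W ->
  (forall h, d0 * h = h * d0) -> exists c : K, forall w : W, d0 *: w = (c%:A : subalg H) *: w.
Proof.
move=> irrW cent.
have [|f hf] := @linear_pack _ W W (fun w => d0 *: w).
  by move=> k x y; rewrite scalerDr !scalerA cent.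
have [c hc] := td_Hsplit hT irrW f.
by exists c => w; rewrite -hf hc.
Qed.

(** The e_i generate simple left ideals, and the central element d0 acts on H
    e_i by the scalar c(W) of W = H e_i. A vector v of an H-module is the sum
    of the e_i v, on which d0 acts by these scalars. *)
Lemma simple_data : exists (d' : S) (d0 : subalg H) (q : nat) (e : 'I_q -> subalg H) (c : 'I_q -> K),
  [/\ d = d' + val d0, AHBgt d', 1 = \sum_i e i &
    forall i, [/\ minimal_elt (e i), is_c gr A B d (cyclic_quotient (e i)) (c i) &
                  d0 * e i = c i *: e i]].
Proof.
have [d' [d0 [ed hd' cent]]] := d_split.
have [k [g [Hg hg]]] := td_Hfin hT.
pose g' (i : 'I_k) : subalg H := Subalg (Hg i).
have [|q [e [me e1]]] := @unit_sum_minimal _ (subalg H) k (ext0 g') _ (td_Hss hT).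
  move=> x; have [c hc] := hg (val x) (subalg_valP x).
  exists (ext0 (c : 'I_k -> K^o)); apply/val_inj; rewrite hc raddf_sum.
  by apply: eq_bigr => i _; rewrite !ext0E; apply/esym/val_subalgZ.
have /choice[c hc] : forall i, exists c : K, forall w : cyclic_quotient (e i),
    d0 *: w = (c%:A : subalg H) *: w.
  by move=> i; apply: central_scalar => //; apply: cyclic_irreducible.
exists d', d0, q, e, c; split=> // i; split=> //.
  by exists d', d0; split=> //; apply: hc.
apply/eqP; rewrite -subr_eq0 -mulr_algl -mulrBl; apply/eqP/cyclic_gen_eq0.
by rewrite scalerBl hc subrr.
Qed.

(** * Weight vectors *)

Section Weights.
Variable M : lmodType S.

Definition wt (l : K) : set (restr M) :=
  [set v | exists s : nat, (d - l%:A) ^+ s *: (v : M) = 0].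

Lemma mod_wspaceE l : mod_wspace d (M := M) l = wt l.
Proof.
have it n (v : restr M) : iter n (fun x : restr M => mod_op d x - l *: x) v = (d - l%:A) ^+ n *: (v : M).
  elim: n => [|n IH]; first by rewrite expr0 scale1r.
  by rewrite /= IH exprS -scalerA [RHS]scalerBl.
apply/seteqP; split=> v.
  by case=> _ [n0 hn]; exists n0; rewrite -it; apply: hn.
case=> s hs; split=> //; exists s => n sn; rewrite it -(subnK sn) exprD -scalerA hs.
exact: (@scaler0 S M).
Qed.

Lemma restr_scaleC (x : S) (k : K) (v : M) : x *: (k%:A *: v) = k%:A *: (x *: v).
Proof. by rewrite !scalerA mulr_algr mulr_algl. Qed.

Lemma restr_linear (x : S) (k : K) (v w : restr M) :
  x *: ((k *: v + w : restr M) : M) = (k *: (x *: (v : M) : restr M) + (x *: (w : M))) :> restr M.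
Proof.
rewrite -[LHS]/(x *: (k%:A *: (v : M) + (w : M))) scalerDr.
by congr (_ + _); rewrite scalerA mulr_algr -mulr_algl -scalerA.
Qed.

Lemma wt_subspace l : subspace (wt l).
Proof.
split; first by exists 0%N; rewrite scaler0.
move=> k x y [s hs] [t ht]; exists (s + t)%N; rewrite restr_linear.
rewrite {2}exprD -scalerA ht scaler0 addr0 addnC exprD -scalerA hs.
by rewrite (@scaler0 S M) (@scaler0 K (restr M)).
Qed.

Lemma wt_gr n x l (v : M) : gr n x -> wt l v -> wt (l + n%:~R) (x *: v).
Proof.
move=> gx [s hs]; exists s.
have e : (d - (l + n%:~R)%:A) * x = x * (d - l%:A).
  rewrite mulrBl (gr_comm hT gx) mulrBr mulr_algl mulr_algr scalerDl.
  by rewrite opprD addrACA subrr addr0.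
suff es t : (d - (l + n%:~R)%:A) ^+ t * x = x * (d - l%:A) ^+ t.
  by rewrite scalerA es -scalerA hs scaler0.
elim: t => [|t IH]; first by rewrite !expr0 mul1r mulr1.
by rewrite exprS -mulrA IH mulrA e -mulrA -exprS.
Qed.

Definition wtsum (L : set K) : set (restr M) := sum_of L wt.

Lemma wtsum_subspace L : subspace (wtsum L).
Proof. by apply: sum_of_subspace => l _; apply: wt_subspace. Qed.
Lemma wtsum_in (L : set K) l v : L l -> wt l v -> wtsum L v.
Proof. exact: sum_of_in. Qed.

Lemma mod_wsumE : mod_wsum d (M := M) = wtsum setT.
Proof.
apply/seteqP; split.
  apply: sum_of_min => [|l _]; first exact: wtsum_subspace.
  by move=> v; rewrite -/(mod_wspace d l) mod_wspaceE; apply: wtsum_in.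
apply: sum_of_min => [|l _ v wv].
  by apply: sum_of_subspace => l _; rewrite -/(mod_wspace d l) mod_wspaceE; apply: wt_subspace.
have [->|v0] := pselect (v = 0).
  apply: subspace0; apply: sum_of_subspace => l' _.
  by rewrite -/(mod_wspace d l') mod_wspaceE; apply: wt_subspace.
apply: (sum_of_in (i := l)); last by rewrite -/(mod_wspace d l) mod_wspaceE.
by exists v; rewrite // -/(mod_wspace d l) mod_wspaceE.
Qed.

Lemma act_pre_subspace (X : set (restr M)) (x : S) : subspace X ->
  subspace [set v : restr M | X (x *: (v : M))].
Proof.
move=> hX; split; first by rewrite /= scaler0; apply: subspace0 hX.
by move=> k v w hv hw; rewrite /= restr_linear; apply: (proj2 hX).
Qed.
Lemma act_pre_subspaceS (X : set (restr M)) (v : M) : subspace X ->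
  subspace [set x : S | X (x *: v)].
Proof.
move=> hX; split; first by rewrite /= scale0r; apply: subspace0 hX.
move=> k x y hx hy; rewrite /= scalerDl -mulr_algl -scalerA; exact: (proj2 hX).
Qed.

Lemma wtsum_gr n x (L L' : set K) (v : M) : gr n x -> (forall l, L l -> L' (l + n%:~R)) ->
  wtsum L v -> wtsum L' (x *: v).
Proof.
move=> gx hL; move: v.
apply: (@sum_of_min _ (restr M) _ _ _ [set v : restr M | wtsum L' (x *: (v : M))]).
  by apply: act_pre_subspace; apply: wtsum_subspace.
by move=> l Ll v hv; apply: (wtsum_in (l := l + n%:~R)); [apply: hL | apply: wt_gr].
Qed.

(** On vectors of weight l, d - c is the sum of the nonzero scalar l - c and
    of the locally nilpotent operator d - l. *)
Lemma wt_divide l c (u : M) : l != c -> wt l u -> exists2 u' : M, wt l u' & (d - c%:A) *: u' = u.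
Proof.
move=> lc [s]; elim: s u => [|s IH] u.
  by rewrite expr0 scale1r => ->; exists 0; [apply: subspace0 (wt_subspace l) | rewrite scaler0].
rewrite exprSr -scalerA => hu.
have [u' wu' eu'] := IH _ hu.
have lc0 : l - c != 0 by rewrite subr_eq0.
have cm : (l - c)^-1%:A * (d - c%:A) = (d - c%:A) * ((l - c)^-1%:A : S).
  by rewrite mulr_algl mulr_algr.
exists ((l - c)^-1%:A *: (u - u')).
  have wu : wt l u by exists s.+1; rewrite exprSr -scalerA.
  apply: (subspaceZ (V := restr M)); first exact: wt_subspace.
  exact: (subspaceB (wt_subspace l)).
rewrite scalerA -cm -scalerA scalerBr eu' -scalerBl.
have -> : d - c%:A - (d - l%:A) = (l - c)%:A.
  by rewrite opprB addrC addrA subrK scalerBl.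
by rewrite scalerA -[_%:A * _%:A]scalerAl mul1r scalerA mulVf // !scale1r.
Qed.

(** As d - c is invertible on the other weight spaces, (d - c) m is the sum of
    (d - c) z, for some z in the sum, and of a vector of weight c; hence m - z
    has weight c. *)
Lemma wtsum_remove (L : set K) c (m : M) : L c ->
  wtsum L ((d - c%:A) *: m) -> wtsum L m.
Proof.
move=> Lc hm; have hW := wtsum_subspace L.
pose Q := [set y : restr M | exists z : M, wtsum L z /\ wt c ((y : M) - (d - c%:A) *: z : M)].
have /(_ _ hm) [z [hz wz]] : wtsum L `<=` Q.
  apply: sum_of_min.
    split; first by exists 0; split; [apply: subspace0 hW | rewrite scaler0 subr0; apply: subspace0 (wt_subspace c)].
    move=> k y y' [z [hz wz]] [z' [hz' wz']].
    exists (k%:A *: z + z'); split; first exact: (proj2 hW k z z').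
    have e : (k%:A *: (y : M) + y') - (d - c%:A) *: (k%:A *: z + z') =
        k%:A *: ((y : M) - (d - c%:A) *: z) + ((y' : M) - (d - c%:A) *: z').
      by rewrite scalerDr restr_scaleC opprD addrACA -scalerBr.
    rewrite /= [X in wt c X]e; exact: (proj2 (wt_subspace c) k _ _ wz wz').
  move=> l Ll y wy; have [e|lc] := eqVneq l c.
    by exists 0; rewrite scaler0 subr0; split; [apply: subspace0 hW | rewrite -e].
  have [u wu eu] := wt_divide lc wy.
  exists u; rewrite eu subrr; split; first exact: wtsum_in wu.
  exact: subspace0 (wt_subspace c).
rewrite -scalerBr in wz; have wmz : wt c (m - z).
  by case: wz => s hs; exists s.+1; rewrite exprSr -scalerA.
rewrite -(subrK z m); apply: (subspaceD hW) => //.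
exact: wtsum_in wmz.
Qed.

(** Induction on n. It suffices to treat e_i m, on which d - c_i acts as d',
    an element of A H B^{>0}; for b in B^{>0}, the vector b e_i m is killed by
    B^j for all j >= n - 1, so (d - c_i) e_i m is a sum of weight vectors by
    induction, and therefore so is e_i m. *)
Lemma killed_wtsum (L : set K) (d' : S) (d0 : subalg H) (q : nat) (e : 'I_q -> subalg H) (c : 'I_q -> K) :
  (forall l, L l -> L (l + 1)) -> d = d' + val d0 -> AHBgt d' -> 1 = \sum_i e i ->
  (forall i, d0 * e i = c i *: e i /\ L (c i)) ->
  forall n (m : M), (forall j b, (n <= j)%N -> Bup gr B j b -> b *: m = 0) -> wtsum L m.
Proof.
move=> hL ed hd' e1 he; have hW := wtsum_subspace L.
have hLn l (n : nat) : L l -> L (l + n%:R).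
  move=> Ll; elim: n => [|n IH]; first by rewrite addr0.
  by rewrite -natr1 addrA; apply: hL.
elim=> [|n IH] m hm.
  rewrite -[m]scale1r (hm 0%N 1) //; first exact: subspace0 hW.
  by split; [apply: rpred1 | rewrite oppr0; apply: (gr1 hT)].
have -> : m = \sum_i val (e i) *: m.
  by rewrite -scaler_suml -raddf_sum -e1 scale1r.
apply: (subspace_sum hW) => i _.
have [ei Lc] := he i; apply: (@wtsum_remove L (c i)) => //.
have -> : (d - (c i)%:A) *: (val (e i) *: m) = d' *: (val (e i) *: m).
  rewrite ed !scalerA; congr (_ *: _); rewrite mulrBl mulrDl mulr_algl.
  have -> : val d0 * val (e i) = c i *: val (e i).
    by rewrite -[LHS]/(val (d0 * e i)) ei val_subalgZ.
  by rewrite addrK.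
set v := _ *: m.
have hv j b : (n < j)%N -> Bup gr B j b -> b *: v = 0.
  move=> nj hb; rewrite /v scalerA.
  have := Bup_H hT hb (subalg_valP (e i)).
  suff : prodset [set` H] (Bup gr B j) `<=` [set x | x *: m = 0] by apply.
  apply: prodset_min; first exact: ann_subspace.
  by move=> h b' _ hb'; rewrite /= -scalerA (hm j) ?scaler0.
suff : AHBgt `<=` [set x | wtsum L (x *: v)] by apply.
have sX := act_pre_subspaceS v hW.
apply: prodset_min => // a y Aa; move: y; apply: prodset_min; first exact: subspace_mull_pre.
move=> h b Hh; move: b; apply: Bgt_min; first exact: (subspace_mull_pre h (subspace_mull_pre a sX)).
move=> j j0 b hb /=; rewrite -!scalerA.
have hbv : wtsum L (b *: v).
  apply: IH => i' b' ni hb'; rewrite scalerA; apply: (hv (i' + j)%N); last exact: (Bup_mul hT).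
  by apply: leq_ltn_trans ni _; rewrite -addn1 leq_add2l.
have hhbv : wtsum L (h *: (b *: v)).
  by apply: (wtsum_gr (H_gr0 hT Hh) _ hbv) => l; rewrite addr0.
move: a Aa; apply: (A_min hT); first exact: act_pre_subspaceS.
by move=> k a [_ ga] /=; apply: (wtsum_gr ga _ hhbv) => l; apply: hLn.
Qed.
End Weights.
End DegreeZero.

(** * Maps out of quotients and completed tensor products *)

Section Descent.
Variables (Rl : realType) (K : fieldType) (abs : K -> Rl).
Hypothesis habs : nonarch_abs abs.
Variables (U Q V : lmodType K) (nU : U -> Rl) (nV : V -> Rl) (P : set U) (p : U -> Q).
Hypotheses (hU : banach abs nU) (hV : banach abs nV) (hP : subspace P).
Hypotheses (hp : lin_on P p) (sp : forall v, exists2 x, P x & p x = v).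

Lemma descend (F : U -> V) : lin_on P F -> (forall x, P x -> p x = 0 -> F x = 0) ->
  exists g : Q -> V, linear g /\ forall x, P x -> g (p x) = F x.
Proof.
move=> lF F0; have /choice[r hr] : forall v, exists x, P x /\ p x = v.
  by move=> v; have [x] := sp v; exists x.
have key x y : P x -> P y -> p x = p y -> F x = F y.
  move=> Px Py e; apply/eqP; rewrite -subr_eq0 -(lin_onB hP lF) //; apply/eqP/F0.
    exact: subspaceB.
  by rewrite (lin_onB hP hp) // e subrr.
exists (fun v => F (r v)); split=> [k u v|x Px].
  have [Pu pu] := hr u; have [Pv pv] := hr v; have [Pw pw] := hr (k *: u + v).
  rewrite -[RHS]lF //; apply: key => //; first by apply: (proj2 hP).
  by rewrite pw hp // pu pv.
by have [Pr pr] := hr (p x); apply: key.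
Qed.

Lemma qnorm_bound (C c : Rl) (v : Q) : 0 <= C ->
  (forall x, P x -> p x = v -> c <= C * nU x) -> c <= C * qnorm nU P p v.
Proof.
rewrite le_eqVlt => /orP[/eqP<-|C0] h.
  by have [x Px px] := sp v; have := h x Px px; rewrite !mul0r.
rewrite mulrC -ler_pdivrMr //; apply: (le_qnorm hU sp) => x Px px.
by rewrite ler_pdivrMr // mulrC; apply: h.
Qed.

Lemma qnorm_map_bound (F : U -> V) (g : Q -> V) (C : Rl) :
  (forall x, P x -> g (p x) = F x) -> (forall x, P x -> nV (F x) <= C * nU x) ->
  forall v, nV (g v) <= `|C| * qnorm nU P p v.
Proof.
move=> hg bF v; apply: qnorm_bound => // x Px <-; rewrite hg //.
apply: le_trans (bF x Px) _; apply: ler_wpM2r; [exact: (norm_ge0 hU) | exact: ler_norm].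
Qed.
End Descent.

Section CompletedTensor.
Variables (Rl : realType) (K : fieldType) (abs : K -> Rl).
Hypothesis habs : nonarch_abs abs.

(** The pure tensors span a dense subspace of a completed tensor product: the
    quotient by a closed subspace containing them is killed by uniqueness. *)
Lemma ctensor_span (T : Type) (D : set T) (X Y Z : lmodType K)
    (nX : X -> Rl) (nY : Y -> Rl) (nZ : Z -> Rl)
    (xr : X -> T -> X) (yl : T -> Y -> Y) (tau : X -> Y -> Z) (N : set Z) :
  is_ctensor abs D nX nY nZ xr yl tau -> subspace N -> is_closed nZ N ->
  (forall x y, N (tau x y)) -> forall z, N z.
Proof.
move=> [bZ _ _ _ univ] sN cN hN z.
have hP := submodule_setT Z; have hsN := subspace_submodule sN.
pose Q : lmodType K := subquotient hP hsN; pose pi : Z -> Q := sq_pi hP hsN.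
have lpi : lin_on setT pi by move=> k x y _ _; apply: sq_pi_lin.
have spi v : exists2 x, setT x & pi x = v by have [x Px ->] := sq_surj v; exists x.
have kpi : is_closed nZ [set x | [set: Z] x /\ pi x = 0].
  suff -> : [set x | [set: Z] x /\ pi x = 0] = N by [].
  apply/seteqP; split=> x; first by case=> _ /sq_pi_eq0; apply.
  by move=> Nx; split=> //; apply/sq_pi_eq0.
have bQ := banach_qnorm habs bZ (subspace_setT Z) (@closed_setT _ _ _ nZ) lpi spi kpi.
have [|||g [_ uniq]] := univ Q _ bQ (fun _ _ => 0).
- by split=> ? ? ? ?; rewrite scaler0 addr0.
- by exists 0 => x y; rewrite (norm0 habs bQ) mul0r.
- by [].
have gpi : g = pi.
  apply: uniq; split=> [k x y||x y]; first exact: sq_pi_lin.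
    by exists 1 => x; rewrite mul1r; apply: (qnorm_le bZ spi).
  by apply/sq_pi_eq0.
have g0 : g = fun _ => 0.
  apply: uniq; split=> [k x y||x y] //; first by rewrite scaler0 addr0.
  by exists 0 => x; rewrite (norm0 habs bQ) mul0r.
have : pi z = 0 by rewrite -gpi g0.
by move/sq_pi_eq0; apply.
Qed.

Lemma closed_kernel (U V : lmodType K) (nU : U -> Rl) (nV : V -> Rl) (P : set U) (f : U -> V) (C : Rl) :
  banach abs nU -> banach abs nV -> subspace P -> is_closed nU P -> lin_on P f ->
  (forall x, P x -> nV (f x) <= C * nU x) -> is_closed nU [set x | P x /\ f x = 0].
Proof.
move=> bU bV sP cP lf bf x hx.
have [u hu ux] := clos_seq hx; have Px : P x by apply: (closed_tends cP _ ux) => n; case: (hu n).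
split=> //; have t1 : tends_to nV (fun n => f (u n)) (f x).
  by apply: (bounded_tends bU bV sP lf bf) => // n; case: (hu n).
apply: (tends_uniq habs bV t1).
by apply: (tends_ext (u := fun _ => 0)) => [n|]; [case: (hu n) => _ -> | apply: (tends_cst habs bV)].
Qed.
End CompletedTensor.

Lemma irreducible_cyclic (T : pzRingType) (W : lmodType T) : irreducible W ->
  exists w0 : W, forall w, exists h : T, w = h *: w0.
Proof.
move=> [[w0 w00] irr]; exists w0 => w.
have sN : submodule [set v | exists h : T, v = h *: w0].
  split; first by exists 0; rewrite scale0r.
    by move=> _ _ [a ->] [b ->]; exists (a + b); rewrite scalerDl.
  by move=> s _ [a ->]; exists (s * a); rewrite scalerA.
have [e|e] := irr _ sN; last by have : [set: W] w by []; rewrite -e.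
have : [set v | exists h : T, v = h *: w0] w0 by exists 1; rewrite scale1r.
by rewrite e.
Qed.

Lemma findim_closed (Rl : realType) (K : fieldType) (abs : K -> Rl) (V : lmodType K)
    (nV : V -> Rl) (X : set V) : nonarch_abs abs -> norm_complete abs -> banach abs nV ->
  subspace X -> findim X -> is_closed nV X.
Proof.
move=> habs cK bV sX [k [e [Xe he]]].
have -> : X = plus_span [set 0] (ext0 e) k.
  apply/seteqP; split=> v.
    move=> /he[c ->]; exists (ext0 (c : 'I_k -> K^o)).
    by apply/eqP; rewrite subr_eq0; apply/eqP/eq_bigr => i _; rewrite !ext0E.
  move=> [c]; move/eqP; rewrite subr_eq0 => /eqP->.
  by apply: (subspace_sum sX) => i _; apply: (subspaceZ sX); rewrite ext0E.
by have [] := plus_span_coords habs cK bV (ext0 e) k (subspace_zero V) (closed_zero habs bV).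
Qed.

Section Setting.
Variables (Rl : realType) (p : nat) (hp : prime p).
Variables (K : fieldType) (abs : K -> Rl) (hK : complete_dv_ext_of_Qp abs p).
Variables (S : algType K) (nS : S -> Rl) (hS : banach_alg abs nS).
Variables (R : subalgClosed S) (gr : int -> set S) (A B H : subalgClosed S) (d : S).
Hypothesis hT : banach_tri_decomp abs nS R gr A B H d.

Let habs := dv_abs hK.
Let bS := proj1 hS.
Let hTa := btd_alg hT.
Let char0 := padic_char0 hp hK.
Let cA := closure_of nS A.
Let cB := closure_of nS B.
Hypotheses (hSn : noetherian [set: S]) (hA : noetherian cA) (hBn : noetherian cB).

(** * Expansions in the closure of A *)

Lemma ad_tends u x : tends_to nS u x -> tends_to nS (fun n => ad d (u n)) (ad d x).
Proof.
by move=> ux; apply: (tendsB habs bS); [apply: (tendsMl hS) | apply: (tendsMr hS)].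
Qed.

Lemma ad_lin : lin_on setT (ad d : S -> S).
Proof.
move=> k x y _ _; rewrite /ad mulrDr mulrDl -scalerAr -scalerAl scalerBr.
by rewrite opprD addrACA.
Qed.

Lemma ad_gr n x : gr n x -> ad d x = n%:~R *: x.
Proof. by rewrite /ad => /(gr_comm hTa)->; rewrite addrAC subrr add0r. Qed.

Lemma ad_A x : x \in A -> ad d x \in A.
Proof.
move: x; apply: (A_min hTa).
  split; first by rewrite /= (lin_on0 (subspace_setT S) ad_lin) rpred0.
  by move=> k x y hx hy; rewrite /= ad_lin // rpredD ?rpredZ.
by move=> n x [/= Ax gx]; rewrite (ad_gr gx) rpredZ.
Qed.

Lemma ad_cA x : cA x -> cA (ad d x).
Proof.
apply: clos_image; first by move=> u y; apply: ad_tends.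
  exact: (clos_closed bS).
by move=> y Ay; apply: (sub_closure hK hS); apply: ad_A.
Qed.

(** The component of x of degree i is multiplied by i, and by l; distinct
    integers being distinct in K, only one component is nonzero. *)
Lemma eigen_piece x l : x \in A -> ad d x = l *: x -> x <> 0 ->
  exists2 n : nat, l = n%:R & piece gr A n x.
Proof.
move=> Ax ex x0; have : [set` A] x by [].
rewrite (td_gradA hTa) => -[F [x_ [hF sx]]].
case: (td_graded hTa) => _ _ _ _ ind.
have hz i : i \in F -> (l - i%:~R) *: x_ i = 0.
  apply: (ind F (fun i => (l - i%:~R) *: x_ i) _ _ i) => [j jF|].
    by have [_ [_ gj]] := hF j jF; apply: (subspaceZ (gr_subspace hTa j)).
  rewrite (eq_big_seq (fun i => l *: x_ i - ad d (x_ i))).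
    by rewrite sumrB -scaler_sumr -sx -(lin_on_sum _ (subspace_setT S) ad_lin) // -sx ex subrr.
  by move=> j jF; have [_ [_ gj]] := hF j jF; rewrite (ad_gr gj) scalerBl.
have [i iF xi0] : exists2 i, i \in F & x_ i <> 0.
  apply: contrapT => h; apply: x0; rewrite sx big_seq big1 // => i iF.
  by apply: contrapT => xi0; apply: h; exists i.
have el : l = i%:~R.
  apply/eqP; rewrite -subr_eq0; apply/eqP; apply: contrapT => /eqP l0.
  by apply: xi0; rewrite -[x_ i]scale1r -(mulVf l0) -scalerA hz // scaler0.
have [/= i0 pi] := hF i iF.
have exi : x = x_ i.
  rewrite sx (big_fsetD1 i) //= big_seq big1 ?addr0 // => j; rewrite in_fsetD1 => /andP[ji jF].
  have := hz j jF; rewrite el -intrB => e; apply: contrapT => xj0.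
  have : ((i - j)%:~R : K) != 0.
    apply/eqP => e0; move/eqP: ji; apply; apply/eqP.
    have : i - j = 0 by apply: (intr_inj char0); rewrite e0.
    by move/eqP; rewrite subr_eq0 eq_sym.
  by move=> n0; apply: xj0; rewrite -[x_ j]scale1r -(mulVf n0) -scalerA e scaler0.
exists `|i|%N; first by rewrite el -[in LHS](gez0_abs i0).
by rewrite exi (gez0_abs i0).
Qed.

(** The weight vectors of the closure of A are homogeneous elements of A, so
    the weight decomposition is a series indexed by the degree. A finite set
    of weights is contained in an initial segment of degrees, whence the
    convergence of the partial sums. *)
Lemma cA_expand a : cA a -> exists a_ : nat -> S, (forall n : nat, piece gr A n (a_ n)) /\
  tends_to nS (fun N => \sum_(n < N) a_ n) a.
Proof.
move=> Aa; have [I [[Iw hI] ss]] := btd_wsA hT; have [v_ [hv cv]] := hI a Aa.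
have vA l : I l -> v_ l \in A.
  move=> Il; have : wsum cA (ad d) (v_ l) by apply: (sum_of_in (i := l)); [apply: Iw | apply: hv].
  by rewrite (btd_wsumA hT).
have vP l : I l -> v_ l <> 0 -> exists2 n : nat, l = n%:R & piece gr A n (v_ l).
  by move=> Il v0; apply: eigen_piece => //; [apply: vA | apply: ss => //; apply: hv].
pose a_ (n : nat) := if `[< I n%:R >] then v_ n%:R else 0.
have P0 n : piece gr A n 0 by apply: subspace0; apply: (piece_subspace hTa).
exists a_; split=> [n|e e0].
  rewrite /a_; case: asboolP => // In; have [->//|v0] := pselect (v_ n%:R = 0).
  by have [m /(natr_inj char0)<-] := vP _ In v0.
have [|F0 [F0I hF0]] := cv [set y | nS (y - a) < e]; first by exists e.
pose deg (x : K) := xget 0%N [set n : nat | n%:R = x].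
have degE n : deg n%:R = n.
  apply: (natr_inj char0); apply: (@xgetPex _ 0%N [set m : nat | m%:R = n%:R :> K]).
  by exists n.
exists (\max_(x <- F0) (deg x).+1)%N => N' hN.
pose s := [seq n%:R : K | n <- iota 0 N' & `[< I n%:R >]].
pose F := (F0 `|` [fset x in s])%fset.
have -> : \sum_(n < N') a_ n = \sum_(l <- F) v_ l.
  rewrite -(big_fset_incl _ (fsubsetUr F0 [fset x in s]%fset)) => [|x xF xs].
    have us : uniq s.
      rewrite map_inj_uniq ?filter_uniq ?iota_uniq // => m n; exact: (natr_inj char0).
    rewrite (perm_big s) /=; last first.
      by apply: uniq_perm => //; first exact: fset_uniq; move=> x; rewrite in_fset.
    rewrite big_map big_filter [RHS]big_mkcond -(big_mkord xpredT a_).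
    by rewrite /index_iota subn0.
  apply: contrapT => v0; move: xF; rewrite in_fsetU (negPf xs) orbF => xF.
  have Ix : I x by apply: F0I.
  have [n en _] := vP x Ix v0; move/negP: xs; apply.
  rewrite in_fset; apply/mapP; exists n => //; rewrite mem_filter -en; apply/andP; split.
    exact/asboolP.
  rewrite mem_iota /= add0n; apply: leq_trans hN.
  by rewrite -(degE n) -en; apply: (@leq_bigmax_seq _ _ xpredT (fun x => (deg x).+1)).
apply: hF0 => x /=; first by rewrite in_fsetU => ->.
rewrite in_fsetU => /orP[/F0I//|].
by rewrite in_fset => /mapP[n]; rewrite mem_filter => /andP[/asboolP In _] ->.
Qed.

(** * Homogeneous components of closed invariant subspaces *)

Section Components.
Variable l : nat.

(** The operator (l + 1 - ad d) ... (l + m - ad d) / m!, which is 1 in degree l,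
    0 in degrees l + 1, ..., l + m, and a binomial coefficient up to sign, hence
    of absolute value at most 1, in higher degrees. *)
Fixpoint cutoff (m : nat) (x : S) : S :=
  if m is m'.+1 then
    m'.+1%:R^-1 *: ((l + m'.+1)%:R *: cutoff m' x - ad d (cutoff m' x)) else x.

Lemma cutoff_lin m : lin_on setT (cutoff m).
Proof.
have scC (a b : K) (v : S) : a *: (b *: v) = b *: (a *: v) by rewrite !scalerA mulrC.
elim: m => [|m IH] k x y _ _ //=; rewrite IH // ad_lin // [k *: (_ *: _)]scC -scalerDr.
by congr (_ *: _); rewrite scalerDr [_ *: (k *: _)]scC [in RHS]scalerBr opprD addrACA.
Qed.

Lemma cutoff_tends m u x : tends_to nS u x -> tends_to nS (fun n => cutoff m (u n)) (cutoff m x).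
Proof.
move=> ux; elim: m => [|m IH] //=; apply: (tendsZ hS); apply: (tendsB habs bS).
  exact: (tendsZ hS).
exact: ad_tends.
Qed.

Fixpoint cutoff_coef (m n : nat) : K :=
  if m is m'.+1 then m'.+1%:R^-1 * (((l + m'.+1)%:R - n%:R) * cutoff_coef m' n) else 1.

Lemma cutoff_gr m (n : nat) x : gr n x -> cutoff m x = cutoff_coef m n *: x.
Proof.
move=> gx; elim: m => [|m IH] /=; first by rewrite scale1r.
by rewrite IH (lin_onZ _ (subspace_setT S) ad_lin) // (ad_gr gx) !scalerA -scalerBl scalerA
  mulrBl [_ * n%:~R]mulrC.
Qed.

Lemma cutoff_coef_self m : cutoff_coef m l = 1.
Proof.
elim: m => [|m IH] //=; rewrite IH mulr1 natrD addrAC subrr add0r mulVf //.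
by apply/eqP => /char0.
Qed.

Lemma cutoff_coef_bin m q : cutoff_coef m (l + q.+1) = (-1) ^+ m * 'C(q, m)%:R.
Proof.
elim: m => [|m IH] /=; first by rewrite bin0 expr0 mulr1.
have m0 : (m.+1%:R : K) != 0 by apply/eqP => /char0.
apply: (mulfI m0); rewrite mulrA divff // mul1r IH mulrCA.
rewrite [RHS]mulrCA -natrM mul_bin_left natrM exprS mulN1r mulNr -mulrN; congr (_ * _).
have [mq|qm] := leqP m q.
  rewrite -mulNr natrB // !natrD opprD addrACA subrr add0r opprB.
  by rewrite -!natr1 opprD addrACA subrr addr0.
by rewrite bin_small // mulr0 mulr0 oppr0.
Qed.
End Components.

Lemma tends_terms (a_ : nat -> S) a : tends_to nS (fun N => \sum_(n < N) a_ n) a ->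
  tends_to nS a_ 0.
Proof.
move=> ha e /ha[N hN]; exists N => n Nn; rewrite subr0.
have -> : a_ n = (\sum_(i < n.+1) a_ i - a) - (\sum_(i < n) a_ i - a).
  by rewrite big_ord_recr opprB addrA subrK /= addrAC subrr add0r.
by apply: (normB_lt habs bS); apply: hN => //; apply: leqW.
Qed.

(** The operators cutoff l m preserve J. Applied to b they give b_l, plus the
    b_n with n > l + m multiplied by elements of absolute value at most 1, and
    these are small for large m. *)
Lemma component_first (J : set S) (b : S) (b_ : nat -> S) (l : nat) :
  subspace J -> is_closed nS J -> (forall x, J x -> J (ad d x)) -> J b ->
  (forall n : nat, gr n (b_ n)) -> tends_to nS (fun N => \sum_(n < N) b_ n) b ->
  (forall n, (n < l)%N -> b_ n = 0) -> J (b_ l).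
Proof.
move=> sJ cJ aJ Jb gb tb b0; apply/cJ/(closP nS) => e e0.
have e2 : 0 < e / 2 by rewrite divr_gt0.
have [m hm] := tends_terms tb e2.
exists (cutoff l m b).
  elim: m {hm} => [|m IH] //=; apply: (subspaceZ sJ); apply: (subspaceB sJ).
    exact: (subspaceZ sJ).
  exact: aJ.
apply: le_lt_trans (_ : e / 2 < e); last by lra.
have tc : tends_to nS (fun N => cutoff l m (\sum_(n < N) b_ n) - b_ l) (cutoff l m b - b_ l).
  by apply: (tendsD bS); [apply: cutoff_tends | apply: (tends_cst habs bS)].
apply: (tends_norm_le (N := l.+1) habs bS _ tc) => N lN.
rewrite (lin_on_sum _ (subspace_setT S) (cutoff_lin l m)) //.
rewrite (bigD1 (Ordinal lN)) //= (cutoff_gr l m (gb l)) cutoff_coef_self scale1r.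
rewrite addrAC subrr add0r; apply: (norm_sum_le habs bS); first exact: ltW.
move=> i il; have [il'|li] := leqP i l.
  rewrite b0 ?(lin_on0 (subspace_setT S) (cutoff_lin l m)) ?(norm0 habs bS) ?ltW //.
  by rewrite ltn_neqAle il' andbT; apply: contra il => /eqP e1; apply/eqP/val_inj.
rewrite (cutoff_gr l m (gb i)) -(subnKC li) addSnnS cutoff_coef_bin (normZ bS).
set q := (i - l.+1)%N; have [mq|qm] := leqP m q; last first.
  by rewrite bin_small // mulr0 (abs0 habs) mul0r ltW.
rewrite (absM habs) (absX habs) (absN1 habs) expr1n mul1r.
apply: le_trans (_ : 1 * nS (b_ (l + q.+1)%N) <= _).
  by apply: ler_wpM2r; [apply: (norm_ge0 bS) | apply: (abs_nat_le1 habs)].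
rewrite mul1r; apply: ltW; have := hm (l + q.+1)%N; rewrite subr0; apply.
by apply: leq_trans mq _; rewrite addnS; apply: leqW; apply: leq_addl.
Qed.

(** Subtracting the components already found leaves b_l as the lowest one. *)
Theorem components_in (J : set S) (b : S) (b_ : nat -> S) :
  subspace J -> is_closed nS J -> (forall x, J x -> J (ad d x)) -> J b ->
  (forall n : nat, gr n (b_ n)) -> tends_to nS (fun N => \sum_(n < N) b_ n) b ->
  forall l, J (b_ l).
Proof.
move=> sJ cJ aJ Jb gb tb; elim/ltn_ind => l IH.
pose c_ n := if (n < l)%N then 0 else b_ n.
have -> : b_ l = c_ l by rewrite /c_ ltnn.
apply: (@component_first J (b - \sum_(n < l) b_ n)) => //.
- by apply: (subspaceB sJ) => //; apply: (subspace_sum sJ) => i _; apply: IH.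
- by move=> n; rewrite /c_; case: ifP => // _; apply: subspace0 (gr_subspace hTa n).
- move=> e /tb[N hN]; exists (maxn N l) => n; rewrite geq_max => /andP[Nn ln].
  have -> : \sum_(i < n) c_ i = \sum_(i < n) b_ i - \sum_(i < l) b_ i.
    rewrite -!(big_mkord xpredT) !(@big_cat_nat _ _ _ l 0 n) //= [X in _ = X - _]addrC addrK.
    rewrite big_nat big1 ?add0r; last by move=> i /andP[_ il]; rewrite /c_ il.
    by apply: eq_big_nat => i /andP[li _]; rewrite /c_ ltnNge li.
  by rewrite opprD addrACA subrr addr0; apply: hN.
- by move=> n nl; rewrite /c_ nl.
Qed.

(** * Weights of modules generated by weight vectors over the closure of A *)

Section WeightBounded.
Variable M : lmodType S.

Let cAr : closed_subring nS cA := closure_closed_subring hK hS A.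

Lemma stable_subspace (P : set M) : stable cA P -> subspace (V := restr M) P.
Proof.
case=> P0 PD PZ; split=> // k x y Px Py; apply: PD => //; apply: PZ => //.
have [sr sA _] := cAr; exact: subspaceZ sA _ _ (subring1 sr).
Qed.

(** What is preserved when weight vectors are added to a submodule P over the
    closure of A one at a time. *)
Definition weight_bounded (L : set K) (P : set M) : Prop :=
  [/\ stable cA P, forall v, P v -> P (d *: v),
      forall l, findim ((P : set (restr M)) `&` wt d l) &
      forall l v, P v -> wt d l v -> v <> 0 -> L l].

Lemma weight_bounded_pow L P l s v : weight_bounded L P -> P v -> P ((d - l%:A) ^+ s *: v).
Proof.
move=> [st dP _ _] Pv; have sP := stable_subspace st.
elim: s => [|s IH]; first by rewrite expr0 scale1r.
rewrite exprS -scalerA scalerBl; apply: (subspaceB sP); first exact: dP.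
exact: (subspaceZ sP).
Qed.

(** Let d v = mu v modulo P. The quotient (P + cA v) / P is cA / J for a left
    ideal J of cA that is stable under ad(d), and closed as cA is noetherian.
    So J contains the homogeneous components of its elements, and the weights
    of cA / J are among the mu + n, with multiplicities at most dim A_n. *)
Lemma weight_bounded_step (L : set K) P mu v : (forall l, L l -> L (l + 1)) -> weight_bounded L P -> L mu ->
  P ((d - mu%:A) *: v) -> exists2 P', weight_bounded L P' & P `<=` P' /\ P' v.
Proof.
move=> hL nP Lmu Pv; have [st dP fP wP] := nP; have sP := stable_subspace st.
have [srA sA ccA] := cAr; have [P0 PD PZ] := st.
have hLn l (n : nat) : L l -> L (l + n%:R).
  move=> Ll; elim: n => [|n IH]; first by rewrite addr0.
  by rewrite -natr1 addrA; apply: hL.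
pose J := [set x | cA x /\ P (x *: v)].
have idJ : ideal_for *%R cA J.
  split; first by move=> x [].
  - by split; [apply: subring0 | rewrite scale0r].
  - by move=> x y [? ?] [? ?]; split; [apply: (subringD srA) | rewrite scalerDl; apply: PD].
  - by move=> s x ? [? ?]; split; [apply: (subringM srA) | rewrite -scalerA; apply: PZ].
have cJ := noetherian_closed hK hS cAr hA idJ.
have sJ : subspace J.
  split; first by case: idJ.
  move=> k x y [cx Px] [cy Py]; split; first exact: (proj2 sA).
  rewrite scalerDl -mulr_algl -scalerA; exact: (proj2 sP k _ _ Px Py).
(* d (x v) = (ad(d)(x) + mu x) v modulo P *)
have dxv x : cA x -> P (d *: (x *: v) - (ad d x + mu *: x) *: v).
  move=> cx; have -> : d *: (x *: v) - (ad d x + mu *: x) *: v = x *: ((d - mu%:A) *: v).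
    rewrite !scalerA -scalerBl; congr (_ *: _); rewrite /ad mulrBr mulr_algr.
    by rewrite opprD opprB addrA [d * x + _]addrC subrK.
  exact: PZ.
have aJ x : J x -> J (ad d x).
  move=> [cx Px]; split; first exact: ad_cA.
  have h := dxv x cx; have -> : ad d x *: v =
      d *: (x *: v) - (mu%:A *: (x *: v)) - (d *: (x *: v) - (ad d x + mu *: x) *: v).
    by rewrite opprB [RHS]addrC addrA subrK [(_ + mu *: x) *: v]scalerDl scalerA mulr_algl addrK.
  apply: (subspaceB sP) => //; apply: (subspaceB sP); first exact: dP.
  exact: (subspaceZ sP).
pose P' := [set m | exists a, cA a /\ P (m - a *: v)].
have PP' : P `<=` P' by move=> m Pm; exists 0; rewrite scale0r subr0; split; [apply: subring0|].
have P'v : P' v by exists 1; rewrite scale1r subrr; split; [apply: subring1|].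
have st' : stable cA P'.
  split; first exact: PP'.
  - move=> x y [a [ca ha]] [b [cb hb]]; exists (a + b); split; first exact: (subringD srA).
    by rewrite scalerDl opprD addrACA; apply: PD.
  - move=> s x cs [a [ca ha]]; exists (s * a); split; first exact: (subringM srA).
    by rewrite -scalerA -scalerBr; apply: PZ.
have dP' m : P' m -> P' (d *: m).
  move=> [a [ca ha]]; exists (ad d a + mu *: a); split.
    by apply: (subringD srA); [apply: ad_cA | apply: (subspaceZ sA)].
  have -> : d *: m - (ad d a + mu *: a) *: v =
      d *: (m - a *: v) + (d *: (a *: v) - (ad d a + mu *: a) *: v).
    by rewrite scalerBr addrA subrK.
  by apply: PD; [apply: dP | apply: dxv].
have key l m : P' m -> wt d l m -> exists x, P (m - x *: v) /\
    (x = 0 \/ exists2 n0 : nat, l = mu + n0%:R & piece gr A n0 x).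
  move=> [a [ca ha]] [s hs].
  pose T x := ad d x + (mu - l) *: x.
  have cT x : cA x -> cA (T x).
    by move=> cx; apply: (subringD srA); [apply: ad_cA | apply: (subspaceZ sA)].
  have cTs t : cA (iter t T a) by elim: t => [|t IH] //=; apply: cT.
  have hTs t : P ((d - l%:A) ^+ t *: (a *: v) - iter t T a *: v).
    elim: t => [|t IH]; first by rewrite expr0 scale1r subrr.
    rewrite exprS -scalerA; set X := _ ^+ _ *: _ in IH *; set y := iter t T a in IH *.
    have -> : (d - l%:A) *: X - iter t.+1 T a *: v =
        (d - l%:A) *: (X - y *: v) + (d *: (y *: v) - (ad d y + mu *: y) *: v).
      rewrite scalerBr -addrA; congr (_ + _).
      have eT : T y *: v = (ad d y + mu *: y) *: v - l%:A *: (y *: v).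
        by rewrite scalerA mulr_algl -scalerBl; congr (_ *: _); rewrite /T scalerBl addrA.
      rewrite -[iter t.+1 T a]/(T y) eT [(d - _) *: _]scalerBl !opprB [RHS]addrA subrK //.
    apply: PD; last exact: (dxv _ (cTs t)).
    by have := weight_bounded_pow l 1 nP IH; rewrite expr1.
  have Js : J (iter s T a).
    split => //; have h1 := hTs s.
    have h2 : P ((d - l%:A) ^+ s *: (a *: v)).
      have -> : (d - l%:A) ^+ s *: (a *: v) = - ((d - l%:A) ^+ s *: (m - a *: v)).
        by rewrite scalerBr hs sub0r opprK.
      by apply: (subspaceN sP); apply: weight_bounded_pow nP ha.
    by have := subspaceB sP h2 h1; rewrite opprB addrCA subrr addr0.
  have [a_ [pa ta]] := cA_expand ca.
  have ga (n : nat) : gr n (a_ n) by have [] := pa n.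
  have tT t : tends_to nS (fun N => \sum_(n < N) (n%:R + (mu - l)) ^+ t *: a_ n) (iter t T a).
    elim: t => [|t IH]; first by apply: tends_ext ta => N; apply: eq_bigr => n _; rewrite expr0 scale1r.
    rewrite /= {2}/T.
    have := tendsD bS (ad_tends IH) (tendsZ hS (mu - l) IH).
    apply: tends_ext => N; rewrite (lin_on_sum _ (subspace_setT S) ad_lin) //.
    rewrite scaler_sumr -big_split; apply: eq_bigr => n _ /=.
    by rewrite (lin_onZ _ (subspace_setT S) ad_lin) // (ad_gr (ga n)) !scalerA -scalerDl
      exprSr [in RHS]mulrDr [(mu - l) * _]mulrC.
  have Ja (n : nat) : n%:R + (mu - l) != 0 -> J (a_ n).
    move=> n0; have h : J ((n%:R + (mu - l)) ^+ s *: a_ n).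
      apply: (@components_in J _ (fun n => (n%:R + (mu - l)) ^+ s *: a_ n) sJ cJ aJ Js _ (tT s)).
      by move=> k; apply: (subspaceZ (gr_subspace hTa k)).
    have := subspaceZ sJ ((n%:R + (mu - l)) ^- s) h.
    by rewrite scalerA mulVf ?scale1r // expf_neq0.
  have Pma y : J (a - y) -> P (m - y *: v).
    move=> [_ hy]; have -> : m - y *: v = (m - a *: v) + (a - y) *: v.
      by rewrite scalerBl addrA subrK.
    exact: PD.
  have [[n0 en0]|nn] := pselect (exists n0 : nat, l = mu + n0%:R).
    exists (a_ n0); split; last by right; exists n0.
    apply: Pma; pose c_ n := if n == n0 then 0 else a_ n.
    apply: (closed_tends (u := fun N => \sum_(n < N + n0.+1) c_ n) cJ) => [N|].
      apply: (subspace_sum sJ) => n _; rewrite /c_; case: ifP => [_|/negbT nn0].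
        exact: subspace0 sJ.
      apply: Ja; rewrite en0 opprD [mu + _]addrA subrr add0r subr_eq0.
      by apply: contra nn0 => /eqP /(natr_inj char0)->.
    have := tends_shift n0.+1 (tendsD bS ta (tends_cst habs bS (- a_ n0))).
    apply: tends_ext => N.
    have n0N : (n0 < N + n0.+1)%N by rewrite addnS ltnS leq_addl.
    rewrite (bigD1 (Ordinal n0N)) //= addrAC subrr add0r.
    rewrite [RHS](bigD1 (Ordinal n0N)) //= {1}/c_ eqxx add0r.
    by apply: eq_bigr => i; rewrite -val_eqE /c_ => /negPf/= ->.
  exists 0; split; last by left.
  apply: Pma; rewrite subr0; apply: closed_tends cJ _ ta => N.
  apply: (subspace_sum sJ) => n _; apply: Ja.
  apply: contra_notN nn => /eqP e; exists n.
  by apply/esym/eqP; rewrite -subr_eq0 [mu + _]addrC -addrA e.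
exists P' => //; split => // l.
  have sPw : subspace (V := restr M) (P' `&` wt d l).
    by apply: subspaceI; [apply: stable_subspace | apply: wt_subspace].
  have fPw : findim ((P' `&` wt d l : set (restr M)) `&` P).
    suff -> : (P' `&` wt d l : set (restr M)) `&` P = (P : set (restr M)) `&` wt d l by [].
    by apply/seteqP; split=> [x [[? ?] ?]|x [? ?]]; split => //; split=> //; apply: PP'.
  have [[n0 en0]|nn] := pselect (exists n0 : nat, l = mu + n0%:R).
    have [[k [e [pe he]]] _] := td_findim hTa n0.
    pose g (i : 'I_k) : restr M := e i *: v.
    apply: (@fg_subspace _ (restr M) P _ k (ext0 g)) => // m [P'm wm].
    have [x [Px hx]] := key l m P'm wm.
    have [c hc] : exists c : 'I_k -> K, x = \sum_i c i *: e i.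
      case: hx => [->|[n1 e1 px]]; last first.
        by apply: he; suff <- : n1 = n0 by []; apply: (natr_inj char0); apply: (addrI mu); rewrite -en0.
      by exists (fun _ => 0); rewrite big1 // => i _; rewrite scale0r.
    exists (ext0 (c : 'I_k -> K^o)).
    suff -> : \sum_(i < k) @GRing.scale K (restr M) (ext0 (c : 'I_k -> K^o) i) (ext0 g i) = x *: v by [].
    rewrite hc scaler_suml; apply: eq_bigr => i _; rewrite !ext0E.
    by rewrite -mulr_algl -scalerA.
  suff -> : (P' `&` wt d l : set (restr M)) = (P' `&` wt d l : set (restr M)) `&` P by [].
  apply/seteqP; split=> [m [P'm wm]|m []//]; split=> //.
  have [x [Px [x0|[n0 en0 _]]]] := key l m P'm wm; last by case: nn; exists n0.
  by move: Px; rewrite x0 scale0r subr0.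
move=> m P'm wm m0; have [x [Px [x0|[n0 -> _]]]] := key l m P'm wm; last exact: hLn.
by apply: (wP l m) => //; move: Px; rewrite x0 scale0r subr0.
Qed.

(** The vectors (d - mu)^t v are added in the order of decreasing t. *)
Lemma weight_bounded_add (L : set K) mu v P s : (forall l, L l -> L (l + 1)) -> weight_bounded L P -> L mu ->
  P ((d - mu%:A) ^+ s *: v) -> exists2 P', weight_bounded L P' & P `<=` P' /\ P' v.
Proof.
move=> hL; elim: s v P => [|s IH] v P nP Lmu.
  by rewrite expr0 scale1r => Pv; exists P => //; split.
rewrite exprSr -scalerA => /(IH _ _ nP Lmu)[P1 nP1 [PP1 P1v]].
have [P2 nP2 [P12 P2v]] := weight_bounded_step hL nP1 Lmu P1v.
by exists P2 => //; split=> //; apply: subset_trans P12.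
Qed.

Lemma weight_bounded0 L : weight_bounded L [set 0].
Proof.
split.
- split=> //; first by move=> x y -> ->; rewrite addr0.
  by move=> s x _ ->; rewrite scaler0.
- by move=> v ->; rewrite scaler0.
- move=> l; exists 0%N, (fun _ => 0); split=> [[]//|x [-> _]].
  by exists (fun _ => 0); rewrite big_ord0.
- by move=> l v ->.
Qed.

Theorem weight_bounded_generated (L : set K) (P0 : set M) (k : nat) (g : 'I_k -> M) :
  (forall l, L l -> L (l + 1)) -> weight_bounded L P0 ->
  (forall i, exists2 l, L l & wt d l (g i)) ->
  exists2 P, weight_bounded L P & P0 `<=` P /\ forall i, P (g i).
Proof.
move=> hL nP0 hg; suff h t : (t <= k)%N ->
    exists2 P, weight_bounded L P & P0 `<=` P /\ forall i : 'I_k, (i < t)%N -> P (g i).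
  by have [P nP [P0P hP]] := h k (leqnn k); exists P => //; split=> // i; apply: hP.
elim: t => [|t IH] tk; first by exists P0 => //; split.
have [P nP [P0P hP]] := IH (ltnW tk); have [l Ll [s hs]] := hg (Ordinal tk).
have [|P' nP' [PP' P'v]] := @weight_bounded_add L l (g (Ordinal tk)) P s hL nP Ll.
  by rewrite hs; have [[]] := nP.
exists P' => //; split; first exact: subset_trans PP'.
move=> i; rewrite ltnS leq_eqVlt => /orP[/eqP e|/hP/PP'//].
by have -> : i = Ordinal tk by apply/val_inj.
Qed.

Lemma generated_weights (L : set K) : (forall l, L l -> L (l + 1)) ->
  gen_by cA [set v : M | exists2 l, L l & wt d l v] setT ->
  forall l, findim (wt (M := M) d l) /\ (forall v : M, wt d l v -> v <> 0 -> L l).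
Proof.
move=> hL [k [g [hg gen]]] l; have [P [st _ fP wP] [_ hP]] := weight_bounded_generated hL (weight_bounded0 L) hg.
have PT v : P v.
  by have [a [ca ->]] := gen v I; apply: (stable_comb st).
split; last by move=> v; apply: wP.
have -> : wt (M := M) d l = (P : set (restr M)) `&` wt d l by apply/seteqP; split=> [v|v []].
exact: fP.
Qed.

End WeightBounded.

(** * Convergent weight decompositions *)

Section Decompositions.
Variable M : lmodType S.

(** For weight vectors g_j of weight mu_j and v = sum_j a_j g_j, the
    expansions of the a_j into homogeneous elements a_{j,n} decompose v into
    the vectors a_{j,n} g_j of weight mu_j + n. The family is to be indexed by
    the weights of M: when mu_j + n is not a weight, a_{j,n} g_j vanishes and
    the term can be dropped. *)
Theorem generated_wdecomp : gen_by cA [set v : M | exists l, wt d l v] setT ->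
  mod_wdecomp nS d M.
Proof.
move=> [k [g [hg gen]]]; have /choice[mu hmu] := hg.
exists (mod_weights d M); split=> // v _; have [a [ca ev]] := gen v I.
have /choice[a_ ha] : forall j : 'I_k, exists a_ : nat -> S,
    (forall n : nat, piece gr A n (a_ n)) /\ tends_to nS (fun N => \sum_(n < N) a_ n) (a j).
  by move=> j; apply: (cA_expand (ca j)).
have wa j (n : nat) : wt d (mu j + n%:R) (a_ j n *: g j).
  by apply: (wt_gr hTa (n := n)) => //; have [h _] := ha j; have [] := h n.
pose idx j l := xget 0%N [set n : nat | l = mu j + n%:R].
pose c j l := if `[< exists n : nat, l = mu j + n%:R >] then a_ j (idx j l) else 0.
have idxE j n : idx j (mu j + n%:R) = n.
  apply/(natr_inj char0)/(addrI (mu j))/esym.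
  by apply: (@xgetPex _ 0%N [set m : nat | mu j + n%:R = mu j + m%:R]); exists n.
have cE j n : c j (mu j + n%:R) = a_ j n.
  by rewrite /c idxE; case: asboolP => // h; case: h; exists n.
exists (fun l => \sum_j c j l *: g j); split=> [l _|O /(_ k g)].
  rewrite -/(mod_wspace d l) mod_wspaceE.
  apply: (subspace_sum (wt_subspace d M l)) => j _.
  have [[n ->]|h] := pselect (exists n : nat, l = mu j + n%:R); first by rewrite cE.
  rewrite /c; case: asboolP => // _; rewrite scale0r; exact: subspace0 (wt_subspace d M l).
case=> [m|e e0 he]; first by have [b [_ ->]] := gen m I; exists b.
have /choice[N hN] : forall j, exists N, forall n, (N <= n)%N ->
    nS (\sum_(i < n) a_ j i - a j) < e /\ nS (a_ j n) < e.
  move=> j; have [_ tj] := ha j; have [N1 h1] := tj e e0.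
  have [N2 h2] := tends_terms tj e0; exists (maxn N1 N2) => n.
  by rewrite geq_max => /andP[n1 n2]; split; [apply: h1 | have := h2 n n2; rewrite subr0].
pose N0 := (\max_j N j)%N.
have NN0 j : (N j <= N0)%N by apply: leq_bigmax.
pose sq := [seq x <- [seq mu j + n%:R | j <- enum 'I_k, n <- iota 0 N0] | `[< mod_weights d M x >]].
pose F0 := [fset x in sq]%fset.
exists F0; split; first by move=> x /=; rewrite in_fset mem_filter => /andP[/asboolP].
move=> F F0F FI.
pose N1 := (N0 + \sum_j \max_(l <- F) (idx j l).+1)%N.
have N1F j n : mu j + n%:R \in F -> (n < N1)%N.
  move=> hF; apply: leq_trans (leq_addl _ _); rewrite (bigD1 j) //=.
  apply: leq_trans (leq_addr _ _); rewrite -{1}(idxE j n).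
  exact: (@leq_bigmax_seq _ _ xpredT (fun l => (idx j l).+1)).
have cF j : \sum_(l <- F) c j l = \sum_(n < N1 | mu j + n%:R \in F) a_ j n.
  transitivity (\sum_(l <- F) \sum_(n < N1) if l == mu j + n%:R then a_ j n else 0).
    apply: eq_big_seq => l lF.
    have [[n en]|h] := pselect (exists n : nat, l = mu j + n%:R).
      have nN : (n < N1)%N by apply: (N1F j); rewrite -en.
      rewrite (bigD1 (Ordinal nN)) //= en cE eqxx big1 ?addr0 // => i /eqP hi.
      case: eqP => // /addrI /(natr_inj char0) e1; case: hi.
      by apply/val_inj.
    rewrite /c; case: asboolP => // _; rewrite big1 // => i _.
    by case: eqP => // e1; case: h; exists i.
  rewrite exchange_big [RHS]big_mkcond /=; apply: eq_bigr => n _.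
  have [xF|xF] := boolP (mu j + n%:R \in F).
    rewrite (big_fsetD1 _ xF) /= eqxx big_seq big1 ?addr0 // => l.
    by rewrite in_fsetD1 => /andP[/negPf->].
  rewrite big_seq big1 // => l lF; case: eqP => // e1; move: xF; rewrite -e1.
  by rewrite lF.
have zero j (n : nat) : (n < N0)%N -> mu j + n%:R \notin F -> a_ j n *: g j = 0.
  move=> nN nF; apply: contrapT => h; move/negP: nF; apply; apply: F0F.
  rewrite /= in_fset mem_filter; apply/andP; split.
    apply/asboolP; exists (a_ j n *: g j) => //.
    by rewrite -/(mod_wspace d (mu j + n%:R)) mod_wspaceE.
  by apply/allpairsP; exists (j, n); rewrite mem_enum mem_iota.
pose x j := (\sum_(n < N1) a_ j n - a j) -
  \sum_(n < N1 | (N0 <= n)%N && (mu j + n%:R \notin F)) a_ j n.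
have -> : \sum_(l <- F) \sum_j c j l *: g j = (v : M) + \sum_j x j *: g j.
  rewrite exchange_big ev -big_split; apply: eq_bigr => j _ /=.
  rewrite -scaler_suml cF -scalerDl /x addrA [a j + _]addrC subrK.
  have e1 : \sum_(n < N1) a_ j n =
      \sum_(n < N1 | mu j + n%:R \in F) a_ j n + \sum_(n < N1 | mu j + n%:R \notin F) a_ j n.
    by rewrite (bigID (fun n : 'I_N1 => mu j + n%:R \in F)).
  have e2 : (\sum_(n < N1 | mu j + n%:R \notin F) a_ j n) *: g j =
      (\sum_(n < N1 | (N0 <= n)%N && (mu j + n%:R \notin F)) a_ j n) *: g j.
    rewrite !scaler_suml big_mkcond [RHS]big_mkcond; apply: eq_bigr => n _.
    case: (boolP (_ \notin F)) => nF; rewrite ?andbF ?andbT //.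
    by case: leqP => // /zero->.
  by rewrite scalerBl e1 scalerDl e2 addrK.
apply: he => j; apply: (normB_lt habs bS).
  apply: (hN j _ _).1; apply: leq_trans (NN0 j) _; exact: leq_addr.
apply: (norm_sum_lt habs bS) => // n /andP[Nn _]; apply: (hN j _ _).2.
exact: leq_trans (NN0 j) Nn.
Qed.

(** * Elements killed by B^{>n} *)

(** The completed tensor decomposition of S, with the coordinates g of H taken
    as scalars. For phi a b = beta(b) a the map G extracts coefficients in the
    closure of A, and for phi a b = a b it extracts coordinates over H. *)
Lemma ctensor_extend (g : S -> K) (phi : S -> S -> S) (Cg C : Rl) :
  lin_on (Y := K^o) [set` H] g -> 0 <= C ->
  (forall h, h \in H -> abs (g h) <= Cg * nS h) ->
  (forall b, cB b -> lin_on cA (phi^~ b)) -> (forall a, cA a -> lin_on cB (phi a)) ->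
  (forall a b, cA a -> cB b -> nS (phi a b) <= C * (nS a * nS b)) ->
  exists G : S -> S, [/\ lin_on setT G,
    forall u x, tends_to nS u x -> tends_to nS (fun n => G (u n)) (G x) &
    forall a h b, cA a -> h \in H -> cB b -> G (a * h * b) = g h *: phi a b].
Proof.
move=> lg C0 bg la lb bphi.
have [||G [[lG [C' bG] pG] _]] :=
    btd_tensor hT bS (f := fun a h b => g h *: phi a b).
- split=> [h b Hh Bb k x y hx hy|a b Aa Bb k x y hx hy|a h Aa Hh k x y hx hy].
  + by rewrite la // scalerDr !scalerA [k * _]mulrC.
  + by rewrite lg // scalerDl -scalerA.
  + by rewrite lb // scalerDr !scalerA [k * _]mulrC.
- exists (Cg * C) => a h b Aa Hh Bb; rewrite (normZ bS).
  apply: le_trans (_ : (Cg * nS h) * (C * (nS a * nS b)) <= _).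
    by apply: ler_pM; rewrite ?(abs_ge0 habs) ?(norm_ge0 bS) //; [apply: bg | apply: bphi].
  by rewrite -!mulrA; have -> : nS h * (C * (nS a * nS b)) = C * (nS a * (nS h * nS b)) by rewrite mulrCA; congr (_ * _); rewrite mulrCA.
have lG' : lin_on setT G by move=> k x y _ _; apply: lG.
exists G; split=> // u x ux.
by apply: (bounded_tends bS bS (subspace_setT S) lG' (C := C')) => // y _; apply: bG.
Qed.

Lemma H_coords : exists (k : nat) (h : 'I_k -> S) (g : 'I_k -> S -> K) (C : Rl),
  [/\ forall i, h i \in H, forall i, lin_on (Y := K^o) [set` H] (g i),
      forall i x, x \in H -> abs (g i x) <= C * nS x &
      forall x, x \in H -> x = \sum_i g i x *: h i].
Proof.
have [k [h [Hh hh]]] := td_Hfin hTa.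
have [_ [g [C [C0 lg bg eg]]]] :=
  plus_span_coords habs (dv_complete hK) bS (ext0 h) k (subspace_zero S) (closed_zero habs bS).
have HX x : x \in H -> plus_span [set 0] (ext0 h) k x.
  move=> Hx; have [c ec] := hh x Hx; exists (ext0 (c : 'I_k -> K^o)).
  apply/eqP; rewrite subr_eq0; apply/eqP; rewrite ec; apply: eq_bigr => i _.
  by rewrite !ext0E.
exists k, h, (fun i => g i), C; split=> [i|i a x y Hx Hy|i x Hx|x Hx]; first exact: Hh.
- by apply: lg; apply: HX.
- by apply: bg; apply: HX.
- have /eqP := eg x (HX x Hx); rewrite subr_eq0 => /eqP {1}->.
  by apply: eq_bigr => i _; rewrite ext0E.
Qed.

(** If B^{>n} kills m then S m is generated over cA by H B m, because S is
    topologically generated over cA by H B, and B m is finite-dimensional. *)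
Theorem killed_generated (n : nat) (m : M) : (forall b, Bgt gr B n b -> b *: m = 0) ->
  gen_by cA [set v : M | exists h j b, [/\ h \in H, Bup gr B j b & v = (h * b) *: m]]
    [set s *: m | s in setT].
Proof.
move=> hm; pose J := cB `&` [set s | s *: m = 0].
have sann := ann_subspace m.
have [_ sB cBc] := closure_closed_subring hK hS B.
have sJ : subspace J by apply: subspaceI.
have cJ : is_closed nS J by apply: closedI => //; apply: (ann_closed hK hS hSn).
have [kB [gB [hB hgB]]] := B_low hTa n.
have [cX [be [C [C0 lbe bbe ebe]]]] := plus_span_coords habs (dv_complete hK) bS (ext0 gB) kB sJ cJ.
have BX : cB `<=` plus_span J (ext0 gB) kB.
  apply: (clos_min cX) => x Bx; have [c hc] := hgB x Bx; exists (ext0 (c : 'I_kB -> K^o)).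
  have -> : \sum_(i < kB) ext0 (c : 'I_kB -> K^o) i *: ext0 gB i = \sum_i c i *: gB i.
    by apply: eq_bigr => i _; rewrite !ext0E.
  by split; [apply: (sub_closure hK hS); apply: (Bgt_B hc) | apply: hm].
have [kH [h [ga [CH [Hh lga bga ega]]]]] := H_coords.
have [_ sA cAc] := closure_closed_subring hK hS A.
have /choice[G hG] : forall ij : 'I_kH * 'I_kB, exists G : S -> S, [/\ lin_on setT G,
    forall u x, tends_to nS u x -> tends_to nS (fun n => G (u n)) (G x) &
    forall a h b, cA a -> h \in H -> cB b -> G (a * h * b) = ga ij.1 h *: (be ij.2 b *: a)].
  move=> [i j]; apply: (@ctensor_extend (ga i) (fun a b => be j b *: a) CH C) => //.
  - exact: bga.
  - by move=> b _ k x y _ _; rewrite scalerDr !scalerA mulrC.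
  - move=> a _ k x y hx hy; rewrite lbe ?scalerDl -?scalerA //; exact: BX.
  - move=> a b _ Bb; rewrite (normZ bS) [nS a * _]mulrC mulrA.
    by apply: ler_wpM2r; [apply: (norm_ge0 bS) | apply: bbe; apply: BX].
have Rprod (Z : set S) : subspace Z ->
    (forall a c b, cA a -> c \in H -> cB b -> Z (a * c * b)) -> [set` R] `<=` Z.
  move=> sZ hZ; apply: (R_ind hTa sZ) => r l a c b [Aa _] Hc [Bb _].
  by rewrite mulrA; apply: hZ => //; apply: (sub_closure hK hS).
have GA ij s : cA (G ij s).
  have [lG tG pG] := hG ij.
  apply: (clos_image tG cAc (X := [set` R])); last exact: (btd_dense hT).
  apply: (Rprod [set x | cA (G ij x)]).
    split=> [|k x y hx hy]; first by rewrite /= (lin_on0 (subspace_setT S) lG); apply: subspace0 sA.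
    by rewrite /= lG //; apply: (proj2 sA).
  by move=> a c b Aa Hc Bb; rewrite /= pG //; do 2![apply: (subspaceZ sA)].
pose E (s : S) := s - \sum_ij G ij s * (h ij.1 * gB ij.2).
have Em s : E s *: m = 0.
  have annc : is_closed nS [set s : S | s *: m = 0] by apply: (ann_closed hK hS hSn).
  have dR : clos (norm_nbhs nS) [set` R] s by apply: (btd_dense hT).
  refine (@clos_image _ _ S S nS nS E [set` R] [set s | s *: m = 0] _ annc _ s dR).
    move=> u x ux; apply: (tendsB habs bS) => //.
    apply: (tends_sum habs bS) => ij _; apply: (tendsMr hS).
    by have [_ tG _] := hG ij; apply: tG.
  apply: (Rprod [set x | E x *: m = 0]).
    have lE : lin_on setT E.
      move=> k x y _ _; rewrite /E scalerBr addrACA -opprD scaler_sumr -big_split.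
      congr (_ - _); apply: eq_bigr => ij _ /=; have [lG _ _] := hG ij.
      by rewrite lG // mulrDl scalerAl.
    split=> [|k x y hx hy]; first by rewrite /= (lin_on0 (subspace_setT S) lE) scale0r.
    by rewrite /= lE // scalerDl hy addr0 -mulr_algl -scalerA hx scaler0.
  move=> a c b Aa Hc Bb /=.
  have -> : E (a * c * b) = a * c * (b - \sum_(j < kB) be j b *: gB j).
    rewrite /E mulrBr; congr (_ - _).
    transitivity (\sum_i \sum_j G (i, j) (a * c * b) * (h i * gB j)).
      by rewrite pair_bigA; apply: eq_bigr => -[i j].
    have eac : a * c = \sum_i a * (ga i c *: h i) by rewrite {1}(ega c Hc) mulr_sumr.
    rewrite [in RHS]eac mulr_suml; apply: eq_bigr => i _.
    rewrite mulr_sumr; apply: eq_bigr => j _; have [_ _ pG] := hG (i, j).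
    by rewrite pG //= -!scalerAl -!scalerAr -!scalerAl !scalerA mulrA [ga i c * _]mulrC.
  have [_ hb] := ebe b (BX b Bb).
  have e1 : \sum_(j < kB) be j b *: ext0 gB j = \sum_(j < kB) be j b *: gB j.
    by apply: eq_bigr => j _; rewrite ext0E.
  by move: hb; rewrite e1 /= -scalerA => ->; rewrite scaler0.
apply: (@gen_by_fin _ _ _ _ _ ('I_kH * 'I_kB)%type (fun ij => (h ij.1 * gB ij.2) *: m)).
  by move=> [i j] /=; have [l hl] := hB j; exists (h i), l, (gB j).
move=> _ [s _ <-]; exists (fun ij => G ij s); split=> [ij|]; first exact: GA.
have := Em s; rewrite /E scalerBl => /eqP; rewrite subr_eq0 => /eqP->.
by rewrite scaler_suml; apply: eq_bigr => ij _; rewrite scalerA.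
Qed.

(** * Local nilpotence over the closure of A *)

(** The submodule of M generated over cA by B y is finitely generated, so its
    weights are bounded below along l - N. *)
Lemma nilpotent_wt (l : K) (y : M) : finite_over M cA -> wt d l y ->
  exists n, forall b, Bgt gr B n b -> b *: y = 0.
Proof.
move=> [k0 [x genx]] wy; have cAr := closure_closed_subring hK hS A; have [srA sA _] := cAr.
pose N := [set z *: y | z in prodset cA [set` B]].
have sN : subspace (prodset cA [set` B]) by apply: prodset_subspace.
have stN : stable cA N.
  split.
  - by exists 0; rewrite ?scale0r //; apply: subspace0 sN.
  - by move=> _ _ [z hz <-] [z' hz' <-]; exists (z + z'); rewrite ?scalerDl //; apply: (subspaceD sN).
  - move=> s _ cs [z hz <-]; exists (s * z); rewrite ?scalerA //.
    move: z hz; apply: prodset_min; first exact: subspace_mull_pre.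
    by move=> a b Aa Bb; rewrite /= mulrA; apply: prodset_in => //; apply: (subringM srA).
have [|q [nu [Nnu genN]]] := fg_submodule srA (g := x) (proj1 hA) stN.
  by move=> v _; apply: genx.
have /choice[z hz] : forall i, exists z, prodset cA [set` B] z /\ nu i = z *: y.
  by move=> i; have [z hz <-] := Nnu i; exists z.
(* each generator of N involves only finitely many of the B^j *)
pose bounded (Z : set M) n := stable cA Z /\ forall j b, (j <= n)%N -> Bup gr B j b -> Z (b *: y).
have boundedW Z n n' : (n <= n')%N -> bounded Z n' -> bounded Z n.
  by move=> nn [? h]; split=> // j b jn; apply: h; apply: leq_trans nn.
have Zsub Z n z' k : bounded Z n -> Z (z' *: y) -> Z ((k *: z') *: y).
  move=> [stZ _] h; rewrite -mulr_algl -scalerA.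
  by case: stZ => _ _; apply=> //; apply: (subspaceZ sA); apply: (subring1 srA).
have fin z' : prodset cA [set` B] z' -> exists n, forall Z, bounded Z n -> Z (z' *: y).
  move: z'; apply: prodset_min.
    split; first by exists 0%N => Z [[Z0 _ _] _]; rewrite scale0r.
    move=> k u u' [n hn] [n' hn']; exists (maxn n n') => Z bZ.
    have b1 := boundedW _ _ _ (leq_maxl n n') bZ; have b2 := boundedW _ _ _ (leq_maxr n n') bZ.
    rewrite scalerDl; case: (bZ) => -[_ ZD _] _; apply: ZD; last exact: hn'.
    by apply: Zsub bZ _; apply: hn.
  move=> a b Aa; move: b; apply: (B_min hTa).
    split; first by exists 0%N => Z [[Z0 _ _] _]; rewrite mulr0 scale0r.
    move=> k u u' [n hn] [n' hn']; exists (maxn n n') => Z bZ.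
    have b1 := boundedW _ _ _ (leq_maxl n n') bZ; have b2 := boundedW _ _ _ (leq_maxr n n') bZ.
    rewrite mulrDr -scalerAr scalerDl; case: (bZ) => -[_ ZD _] _; apply: ZD; last exact: hn'.
    by apply: Zsub bZ _; apply: hn.
  move=> j b hb; exists j => Z [[_ _ ZM] hZ]; rewrite -scalerA.
  by apply: ZM => //; apply: (hZ j).
have /choice[n hn] : forall i, exists n, forall Z, bounded Z n -> Z (nu i).
  by move=> i; have [hzi ->] := hz i; apply: fin.
pose n0 := (\max_i n i)%N.
have bN Z : bounded Z n0 -> N `<=` Z.
  move=> bZ v Nv; have [a [ca ->]] := genN v Nv.
  apply: (stable_comb (proj1 bZ)) => // i; apply: hn; apply: boundedW bZ.
  exact: leq_bigmax.
pose L l' := exists i j : nat, (i <= n0)%N /\ l' = l - i%:R + j%:R.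
have hL l' : L l' -> L (l' + 1).
  by move=> [i [j [hi ->]]]; exists i, j.+1; split=> //; rewrite -natr1 addrA.
have wy' j b : Bup gr B j b -> wt d (l - j%:R) (b *: y).
  by move=> [_ gb]; have := wt_gr hTa gb wy; rewrite mulrNz.
have bounded_sub P : weight_bounded L P -> subspace (V := restr M) P.
  by case=> st _ _ _; apply: (stable_subspace st).
have [P nP hP] : exists2 P : set M, weight_bounded L P &
    forall j b, (j < n0.+1)%N -> Bup gr B j b -> P (b *: y).
  suff h t : (t <= n0.+1)%N -> exists2 P : set M, weight_bounded L P &
      forall j b, (j < t)%N -> Bup gr B j b -> P (b *: y) by apply: (h n0.+1).
  elim: t => [|t IH] tn; first by exists [set 0]; [apply: weight_bounded0 | ].
  have [P nP hP] := IH (ltnW tn).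
  have [_ [k [e [Be he]]]] := td_findim hTa (- t%:Z).
  have [i|P' nP' [PP' P'e]] := weight_bounded_generated (g := fun i => e i *: y) hL nP.
    exists (l - t%:R); last by apply: wy'; apply: Be.
    by exists t, 0%N; rewrite addr0.
  exists P' => // j b; rewrite ltnS leq_eqVlt => /orP[/eqP->|jt] hb; last exact/PP'/(hP j).
  have [c ->] := he b hb; rewrite scaler_suml.
  apply: (subspace_sum (V := restr M) (bounded_sub _ nP')) => i _.
  rewrite -mulr_algl -scalerA; exact: (subspaceZ (bounded_sub _ nP') _ (P'e i)).
have NP : N `<=` P by apply: bN; split; [have [] := nP | ].
have zero j b : (n0 < j)%N -> Bup gr B j b -> b *: y = 0.
  move=> nj hb; apply: contrapT => by0.
  have Pby : P (b *: y).
    by apply: NP; exists b => //; rewrite -[b]mul1r; apply: prodset_in; [apply: (subring1 srA) | case: hb].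
  have [_ _ _ wP] := nP; have [i [j' [hi e]]] := wP _ _ Pby (wy' j b hb) by0.
  have /(natr_inj char0) ei : (i%:R : K) = (j + j')%:R.
    have e2 : - (j%:R : K) = - i%:R + j'%:R by apply: (addrI l); rewrite e addrA.
    by rewrite natrD -[j%:R]opprK e2 opprD opprK subrK.
  by move: nj; rewrite ltnNge (leq_trans _ hi) // ei leq_addr.
exists n0 => b hb; suff : [set b | b *: y = 0] b by [].
move: b hb; apply: Bgt_min => [|j nj b hb]; [exact: ann_subspace | exact: (zero j)].
Qed.

Lemma Bgt_le n n' : (n <= n')%N -> Bgt gr B n' `<=` Bgt gr B n.
Proof.
move=> nn; apply: Bgt_min => [|j nj b]; first exact: (Bgt_subspace hTa).
by apply: Bgt_in; apply: leq_ltn_trans nj.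
Qed.

Lemma loc_nilpotent_wtsum : (forall l (y : M), wt d l y -> exists n, forall b, Bgt gr B n b -> b *: y = 0) ->
  loc_nilpotent gr B (mod_wsum d (M := M)).
Proof.
move=> h m; rewrite mod_wsumE.
apply: (@sum_of_min _ (restr M) _ _ _ [set m : restr M | exists n : nat, forall b, Bgt gr B n b -> b *: (m : M) = 0]).
  split; first by exists 0%N => b _; rewrite scaler0.
  move=> k u u' [n hn] [n' hn']; exists (maxn n n') => b hb.
  have hb1 := Bgt_le (leq_maxl n n') hb; have hb2 := Bgt_le (leq_maxr n n') hb.
  by rewrite restr_linear (hn b hb1) (hn' b hb2) addr0; apply: (@scaler0 K (restr M)).
by move=> l _ y; apply: h.
Qed.

(** The finite partial sums of a convergent weight decomposition are sums of
    weight vectors. *)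
Lemma wdecomp_dense : mod_wdecomp nS d M -> dense_in (can_nbhs nS (M := M)) (mod_wsum d (M := M)).
Proof.
move=> [I [_ hI]] v O hO; have [v_ [wv cv]] := hI v Logic.I.
have [F0 [F0I hF]] := cv O hO.
exists (\sum_(l <- F0) v_ l); last by apply: hF.
rewrite mod_wsumE big_seq; apply: (subspace_sum (wtsum_subspace d M setT)) => l lF.
by apply: (@wtsum_in _ _ _ _ _ l) => //; rewrite -mod_wspaceE; apply: wv; apply: F0I.
Qed.

End Decompositions.

(** * The completed subalgebra BH and its ideals *)

Local Notation closure X := (clos (norm_nbhs nS) X).
Local Notation HB := (prodset [set` H] [set` B]).
Local Notation HBgt n := (prodset [set` H] (Bgt gr B n)).
Local Notation cBH := (cBH nS B H).
Local Notation cBHgt := (cBHgt nS gr B H).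

Lemma HB_subspace : subspace HB.
Proof. by apply: prodset_subspace; apply: alg_subspace. Qed.
Lemma HBgt_subspace n : subspace (HBgt n).
Proof. by apply: prodset_subspace; apply: alg_subspace. Qed.
Lemma sub_clos_S X : X `<=` closure X. Proof. exact: (sub_closure hK hS). Qed.

Lemma mull_closure (x : S) (X Z : set S) : is_closed nS Z -> (forall y, X y -> Z (x * y)) ->
  forall y, closure X y -> Z (x * y).
Proof.
move=> cZ h y Xy; apply: (clos_image (f := fun y => x * y) _ cZ h Xy).
by move=> u z; apply: (tendsMl hS).
Qed.
Lemma mulr_closure (x : S) (X Z : set S) : is_closed nS Z -> (forall y, X y -> Z (y * x)) ->
  forall y, closure X y -> Z (y * x).
Proof.
move=> cZ h y Xy; apply: (clos_image (f := fun y => y * x) _ cZ h Xy).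
by move=> u z; apply: (tendsMr hS).
Qed.

Lemma closure_subspace X : subspace X -> subspace (closure X).
Proof. exact: (clos_subspace habs bS). Qed.
Lemma cB_subspace : subspace cB.
Proof. exact: (closure_subspace (alg_subspace B)). Qed.
Lemma cBH_subspace : subspace cBH.
Proof. by apply: closure_subspace; apply: prodset_subspace; apply: cB_subspace. Qed.

Lemma cBHE : cBH = closure HB.
Proof.
apply/seteqP; split.
  apply: clos_min; first exact: (clos_closed bS).
  apply: prodset_min; first exact: (closure_subspace HB_subspace).
  move=> b h Bb Hh; move: b Bb; apply: (@mulr_closure h [set` B]).
    exact: (clos_closed bS).
  move=> b Bb; apply: sub_clos_S; rewrite -(td_BH hTa); exact: prodset_in.
rewrite -(td_BH hTa); apply: closS; apply: prodsetS => // b Bb; exact: sub_clos_S.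
Qed.

(** One has (h x) (h' y) = h (x h') y, where x h' is in H X. *)
Lemma HX_mul (X Y Z : set S) : (forall b h, X b -> h \in H -> prodset [set` H] X (b * h)) ->
  (forall x y, X x -> Y y -> Z (x * y)) ->
  forall x y, prodset [set` H] X x -> prodset [set` H] Y y -> prodset [set` H] Z (x * y).
Proof.
move=> XH XY x y hx hy.
have sP : subspace (prodset [set` H] Z) by apply: prodset_subspace; apply: alg_subspace.
move: x hx; apply: prodset_min => [|h b Hh Xb]; first exact: subspace_mulr_pre.
move: y hy; apply: prodset_min => [|h' b' Hh' Yb']; first exact: subspace_mull_pre.
have := XH b h' Xb Hh'; rewrite /= -mulrA [b * (_ * _)]mulrA; move: (b * h').
apply: (prodset_min (Z := [set x | prodset [set` H] Z (h * (x * b'))])).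
  exact: (subspace_mulr_pre b' (subspace_mull_pre h sP)).
move=> k c Hk Xc; rewrite /= -mulrA mulrA; apply: prodset_in; first exact: rpredM.
exact: XY.
Qed.

Lemma B_H b h : b \in B -> h \in H -> HB (b * h).
Proof. by move=> Bb Hh; rewrite -(td_BH hTa); apply: prodset_in. Qed.

Lemma HB_mul x y : HB x -> HB y -> HB (x * y).
Proof. by apply: HX_mul => [b h|a b]; [apply: B_H | apply: rpredM]. Qed.

Lemma HB_1 : HB 1.
Proof. by rewrite -[1]mulr1; apply: prodset_in; apply: rpred1. Qed.

Lemma cBH_mul x y : cBH x -> cBH y -> cBH (x * y).
Proof.
rewrite cBHE => hx hy; have cc : is_closed nS (closure HB) by exact: (clos_closed bS).
move: x hx; apply: (mulr_closure cc) => x hx; move: y hy; apply: (mull_closure cc) => y hy.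
by apply: sub_clos_S; apply: HB_mul.
Qed.
Lemma cBH_1 : cBH 1. Proof. by rewrite cBHE; apply: sub_clos_S; apply: HB_1. Qed.
Lemma H_cBH h : h \in H -> cBH h.
Proof.
move=> Hh; apply: sub_clos_S; rewrite -[h]mul1r; apply: prodset_in => //.
apply: sub_clos_S; exact: rpred1.
Qed.
Lemma cB_cBH b : cB b -> cBH b.
Proof.
by move=> Bb; apply: sub_clos_S; rewrite -[b]mulr1; apply: prodset_in => //; apply: rpred1.
Qed.
Lemma HBgt_HB n x : HBgt n x -> HB x.
Proof. by apply: prodsetS => // b /Bgt_B. Qed.

Lemma HBgt_mull n x y : HB x -> HBgt n y -> HBgt n (x * y).
Proof. by apply: HX_mul => [b h|a b /= Ba hb]; [apply: B_H | apply: (Bgt_mull hTa)]. Qed.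
Lemma HBgt_mulr n x y : HBgt n x -> HB y -> HBgt n (x * y).
Proof. by apply: HX_mul => [b h|a b /= ha Bb]; [apply: (Bgt_H hTa) | apply: (Bgt_mulr hTa)]. Qed.

Lemma cHBgt_mull n x y : cBH x -> closure (HBgt n) y -> closure (HBgt n) (x * y).
Proof.
rewrite cBHE => hx hy; have cc : is_closed nS (closure (HBgt n)) by exact: (clos_closed bS).
move: x hx; apply: (mulr_closure cc) => x hx; move: y hy; apply: (mull_closure cc) => y hy.
by apply: sub_clos_S; apply: HBgt_mull.
Qed.
Lemma cHBgt_mulr n x y : closure (HBgt n) x -> cBH y -> closure (HBgt n) (x * y).
Proof.
rewrite cBHE => hx hy; have cc : is_closed nS (closure (HBgt n)) by exact: (clos_closed bS).
move: x hx; apply: (mulr_closure cc) => x hx; move: y hy; apply: (mull_closure cc) => y hy.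
by apply: sub_clos_S; apply: HBgt_mulr.
Qed.

Lemma Bgt_cBHgt n b : Bgt gr B n b -> cBHgt n b.
Proof.
move=> hb; rewrite -[b]mul1r; apply: prodset_in; first exact: cBH_1.
rewrite -[b]mulr1; apply: prodset_in; last exact: cBH_1.
by rewrite -[b]mulr1; apply: prodset_in => //; apply: rpred1.
Qed.

Lemma cBHgt_subspace n : subspace (cBHgt n).
Proof. by apply: prodset_subspace; apply: cBH_subspace. Qed.

(** The ideal generated by B^{>n} in the completion of B H is closed: elements s of
    the closure of H B^{>n} have coordinates over a basis of H depending
    continuously on s and lying in the closure of B^{>n}, which is the left ideal
    generated by B^{>n} as the closure of B is noetherian. *)
Theorem cBHgtE n : cBHgt n = closure (HBgt n).
Proof.
have sX := HBgt_subspace n; have sJ := closure_subspace (Bgt_subspace hTa n).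
have scX := closure_subspace sX.
apply/seteqP; split.
  apply: prodset_min => // x y hx; move: y; apply: prodset_min => [|z t hz ht].
    exact: subspace_mull_pre.
  apply: cHBgt_mull => //; apply: cHBgt_mulr => //; move: z hz.
  apply: prodset_min => // b h hb Hh; apply: sub_clos_S; exact: (Bgt_H hTa).
have JB : closure (Bgt gr B n) `<=` prodset cB (Bgt gr B n).
  have cBr := closure_closed_subring hK hS B; have [srB sB cBc] := cBr.
  apply: clos_min => [|b hb]; last first.
    by rewrite -[b]mul1r; apply: prodset_in => //; apply: (subring1 srB).
  have sP : subspace (prodset cB (Bgt gr B n)) by apply: prodset_subspace.
  apply: (noetherian_closed hK hS cBr hBn); split.
  - apply: prodset_min => // x y hx /Bgt_B By; apply: (subringM srB) => //.
    exact: sub_clos_S.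
  - exact: subspace0 sP.
  - by move=> x y; apply: (subspaceD sP).
  - move=> s x hs; move: x; apply: prodset_min; first exact: subspace_mull_pre.
    by move=> x y hx hy; rewrite /= mulrA; apply: prodset_in => //; apply: (subringM srB).
have [k [h [g [C [Hh lg bg eg]]]]] := H_coords.
have /choice[G hG] : forall i, exists G : S -> S, [/\ lin_on setT G,
    forall u x, tends_to nS u x -> tends_to nS (fun n => G (u n)) (G x) &
    forall a h b, cA a -> h \in H -> cB b -> G (a * h * b) = g i h *: (a * b)].
  move=> i; apply: (ctensor_extend (C := 1) (lg i)) => //.
  - exact: bg.
  - by move=> b _ c x y _ _; rewrite mulrDl scalerAl.
  - by move=> a _ c x y _ _; rewrite mulrDr scalerAr.
  - by move=> a b _ _; rewrite mul1r; apply: (normM hS).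
have GHB i x b : x \in H -> cB b -> G i (x * b) = g i x *: b.
  move=> Hx Bb; have [_ _ pG] := hG i; rewrite -[x]mul1r pG ?mul1r //.
  by apply: sub_clos_S; apply: rpred1.
have GJ i s : closure (HBgt n) s -> closure (Bgt gr B n) (G i s).
  have [lG tG _] := hG i; move: s; apply: (clos_image tG).
    exact: (clos_closed bS).
  move=> s; move: s; apply: (prodset_min (Z := [set s | closure (Bgt gr B n) (G i s)])).
    split=> [|c x y hx hy]; first by rewrite /= (lin_on0 (subspace_setT S) lG); apply: subspace0 sJ.
    by rewrite /= lG //; apply: (proj2 sJ).
  move=> x b Hx hb; rewrite /= GHB //; last by apply: sub_clos_S; apply: (Bgt_B hb).
  by apply: sub_clos_S; apply: (subspaceZ (Bgt_subspace hTa n)).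
have Ge s : closure (HBgt n) s -> s = \sum_i h i * G i s.
  move=> hs; apply/eqP; rewrite -subr_eq0; apply/eqP; pose E s := s - \sum_i h i * G i s.
  have lE : lin_on setT E.
    move=> c x y _ _; rewrite /E scalerBr addrACA -opprD scaler_sumr -big_split.
    congr (_ - _); apply: eq_bigr => i _ /=; have [lG _ _] := hG i.
    by rewrite lG // mulrDr scalerAr.
  move: s hs; apply: (clos_image (f := E) (Z := [set 0])) => //.
    move=> u x ux; apply: (tendsB habs bS) => //.
    apply: (tends_sum habs bS) => i _; apply: (tendsMl hS).
    by have [_ tG _] := hG i; apply: tG.
  exact: (closed_zero habs bS).
  move=> s; move: s; apply: (prodset_min (Z := [set s | [set (0 : S)] (E s)])).
    split=> [|c x y hx hy]; first exact: (lin_on0 (subspace_setT S) lE).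
    by rewrite /= lE // hx hy scaler0 addr0.
  move=> x b Hx hb; rewrite /= /E {1}(eg x Hx) mulr_suml -sumrB big1 // => i _.
  rewrite GHB //; last by apply: sub_clos_S; apply: (Bgt_B hb).
  by rewrite -scalerAl -scalerAr subrr.
move=> s hs; rewrite (Ge s hs); have sI := cBHgt_subspace n.
apply: (subspace_sum sI) => i _; move: (G i s) (JB _ (GJ i s hs)).
apply: prodset_min; first exact: subspace_mull_pre.
move=> x y hx hy; rewrite /= mulrA; apply: prodset_in.
  by apply: cBH_mul; [apply: H_cBH | apply: cB_cBH].
rewrite -[y]mulr1; apply: prodset_in; last exact: cBH_1.
by rewrite -[y]mulr1; apply: prodset_in => //; apply: rpred1.
Qed.

Lemma cBHgt_closed n : is_closed nS (cBHgt n).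
Proof. by rewrite cBHgtE; apply: (clos_closed bS). Qed.
Lemma cBHgt_cBH n : cBHgt n `<=` cBH.
Proof. by rewrite cBHgtE cBHE; apply: closS => x; apply: HBgt_HB. Qed.
Lemma cBHgt_mull n x y : cBH x -> cBHgt n y -> cBHgt n (x * y).
Proof. by rewrite cBHgtE; apply: cHBgt_mull. Qed.
Lemma cBHgt_mulr n x y : cBHgt n x -> cBH y -> cBHgt n (x * y).
Proof. by rewrite cBHgtE; apply: cHBgt_mulr. Qed.

(** The sum of this closed ideal and of a finite-dimensional subspace is
    closed, so it suffices to span H B modulo H B^{>n}. *)
Lemma cBH_finite n : exists (t : nat) (u : nat -> S), (forall i, cBH (u i)) /\
  cBH `<=` plus_span (cBHgt n) u t.
Proof.
have sI := cBHgt_subspace n; have [kH [h [Hh hh]]] := td_Hfin hTa.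
have [kB [gB [hB hgB]]] := B_low hTa n.
pose J : finType := ('I_kH * 'I_kB)%type.
pose f (i : 'I_#|J|) : S := h (enum_val i).1 * gB (enum_val i).2.
have sY := plus_span_subspace (ext0 f) #|J| sI.
have cf i : cBH (f i).
  apply: cBH_mul; first by apply: H_cBH; apply: Hh.
  have [j [Bg _]] := hB (enum_val i).2; apply: cB_cBH; exact: sub_clos_S.
exists #|J|, (ext0 f); split.
  by apply: ext0_prop => //; apply: subspace0 cBH_subspace.
have [cY _] := plus_span_coords habs (dv_complete hK) bS (ext0 f) #|J| sI (@cBHgt_closed n).
rewrite {1}cBHE; apply: (clos_min cY); apply: prodset_min => // x b Hx Bb.
have [c ->] := hh x Hx; rewrite mulr_suml; apply: (subspace_sum sY) => i _.
rewrite -scalerAl; apply: (subspaceZ sY).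
have [c' hc'] := hgB b Bb; rewrite -(subrK (\sum_j c' j *: gB j) b) mulrDr.
apply: (subspaceD sY).
  apply: sub_plus_span; rewrite cBHgtE; apply: sub_clos_S.
  by apply: prodset_in; [exact: Hh | exact: hc'].
rewrite mulr_sumr; apply: (subspace_sum sY) => j _; rewrite -scalerAr; apply: (subspaceZ sY).
have -> : h i * gB j = f (enum_rank ((i, j) : J)) by rewrite /f enum_rankK.
set r := enum_rank _; exists (fun i => (i == r :> nat)%:R).
rewrite (bigD1 r) //= eqxx scale1r ext0E big1 ?addr0 ?subrr; first exact: subspace0 sI.
move=> r' nr; rewrite -[_ == _ :> nat]/(r' == r) (negPf nr); exact: scale0r.
Qed.

(** * Completed Verma modules are cyclic *)

Section HatDeltaCyclic.
Variables (W : lmodType (subalg H)) (n : nat) (D : hatDelta abs nS gr B W n) (w0 : W).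
Hypothesis hw0 : forall w, exists h : subalg H, w = h *: w0.

Let scBH := cBH_subspace.
Let ccBH : is_closed nS cBH := clos_closed bS (X := _).

Let F (y : S) : hd_N D := hd_tau (hd_pi D y) w0.
Let m0 : D := hd_sigma 1 (F 1).

Let bN : banach abs (@hd_nN _ _ _ _ _ _ _ _ _ _ D). Proof. by case: (hd_tauP D). Qed.
Let bM : banach abs (@hd_nmod _ _ _ _ _ _ _ _ _ _ D). Proof. by case: (hd_sigmaP D). Qed.

Lemma hd_pi_le y : cBH y -> hd_nQ (hd_pi D y) <= nS y.
Proof.
move=> hy; rewrite (hd_pi_norm D hy); apply: ge_inf.
  by exists 0 => _ [z _ <-]; apply: (norm_ge0 bS).
by exists 0; rewrite ?addr0 //; apply: subspace0 (cBHgt_subspace n).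
Qed.

Lemma hd_F_lin : lin_on cBH F.
Proof.
by move=> k x y hx hy; rewrite /F (hd_pi_lin D) //; case: (hd_tauP D) => _ [l1 _] _ _ _; apply: l1.
Qed.

Lemma hd_F_act x y : cBH x -> cBH y -> hd_act x (F y) = F (x * y).
Proof. by move=> hx hy; rewrite /F (hd_act_tau D). Qed.

Lemma hd_F_bounded : exists C, forall y, cBH y -> hd_nN (F y) <= C * nS y.
Proof.
case: (hd_tauP D) => _ _ [C bC] _ _; exists (`|C| * hd_nW D w0) => y hy.
apply: le_trans (bC _ _) _; rewrite -mulrA [hd_nW D w0 * _]mulrC.
apply: le_trans (_ : `|C| * (hd_nQ (hd_pi D y) * hd_nW D w0) <= _).
  apply: ler_wpM2r; last exact: ler_norm.
  by rewrite mulr_ge0 ?(norm_ge0 (hd_nQP D)) ?(norm_ge0 (hd_nWP D)).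
apply: ler_wpM2l => //; apply: ler_wpM2r; first exact: (norm_ge0 (hd_nWP D)).
exact: hd_pi_le.
Qed.

(** The image of BH is finite-dimensional, hence closed, and it contains the
    pure tensors, which span a dense subspace. *)
Lemma hd_F_surj nu : exists2 y, cBH y & F y = nu.
Proof.
have [_ [l1 l2] _ bal _] := hd_tauP D.
pose N0 := [set nu | exists2 y, cBH y & F y = nu].
have s0 := subspace_zero (hd_N D).
suff : N0 nu by [].
have sN0 : subspace N0.
  split; first by exists 0; [apply: subspace0 scBH | apply: (lin_on0 scBH hd_F_lin)].
  move=> k _ _ [x hx <-] [y hy <-]; exists (k *: x + y); first exact: (proj2 scBH).
  by rewrite hd_F_lin.
have [t [u [hu spu]]] := cBH_finite n.
have eN0 : N0 = plus_span [set 0] (fun i => F (u i)) t.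
  apply/seteqP; split=> v.
    move=> [y hy <-]; have [c hc] := spu y hy; exists c; apply/eqP; rewrite subr_eq0; apply/eqP.
    have hsum : cBH (\sum_(i < t) c i *: u i).
      by apply: (subspace_sum scBH) => i _; apply: (subspaceZ scBH).
    have -> : F y = F (\sum_(i < t) c i *: u i).
      apply/eqP; rewrite -subr_eq0 -(lin_onB scBH hd_F_lin) //; apply/eqP.
      have hz : cBH (y - \sum_(i < t) c i *: u i) by apply: (subspaceB scBH).
      have := (hd_pi_ker D hz).2 hc; rewrite /F => ->.
      exact: (lin_on0 (subspace_setT _) (fun k x y _ _ => l1 w0 k x y)).
    rewrite (lin_on_sum _ scBH hd_F_lin); last by move=> i _; apply: (subspaceZ scBH).
    by apply: eq_bigr => i _; rewrite (lin_onZ _ scBH hd_F_lin).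
  move=> [c]; move/eqP; rewrite subr_eq0 => /eqP->.
  apply: (subspace_sum sN0) => i _; apply: (subspaceZ sN0).
  by exists (u i).
apply: (ctensor_span habs (hd_tauP D) sN0).
  rewrite eN0.
  by have [] := plus_span_coords habs (dv_complete hK) bN (fun i => F (u i)) t s0 (closed_zero habs bN).
move=> q w; have [y hy ->] := hd_pi_surj q; have [h ->] := hw0 w.
have hyh : cBH (y * val h) by apply: cBH_mul => //; apply: H_cBH; apply: subalg_valP.
exists (y * val h) => //; rewrite /F -(hd_QrP D) //.
exact: (bal (hd_pi D y) h (w0 : restr W) I).
Qed.

Lemma hd_F_m0 y : cBH y -> F y = 0 -> y *: m0 = 0.
Proof.
move=> hy Fy; have [_ [_ l2] _ bal _] := hd_sigmaP D.
rewrite (hd_mod_sigma y 1 (F 1)) mulr1 -[y]mul1r.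
have -> := bal 1 y (F 1) hy; rewrite hd_F_act ?mulr1 ?Fy //; last exact: cBH_1.
exact: (lin_on0 (subspace_setT _) (fun k x y _ _ => l2 1 k x y)).
Qed.

Let actm (s : S) : restr D := s *: m0.
Let L := [set s : S | s *: m0 = 0].

Let actm_lin : lin_on setT actm.
Proof. by move=> k x y _ _; rewrite /actm scalerDl -mulr_algl -scalerA. Qed.

Let actm_bounded : exists C, forall s, hd_nmod (actm s) <= C * nS s.
Proof.
have [C bC] := hd_mod_bounded D; exists (C * hd_nmod (m0 : restr D)) => s.
by apply: le_trans (bC _ _) _; rewrite -mulrA [nS s * _]mulrC.
Qed.

(** The module of D is S m0: the cyclic module S / Ann(m0) receives a bounded map
    from D by the universal property, and the composite D -> S / Ann(m0) -> D is
    the identity on pure tensors. *)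
Theorem hatDelta_cyclic : exists m : D,
  (forall v : D, exists s, v = s *: m) /\ forall b, Bgt gr B n b -> b *: m = 0.
Proof.
exists m0; split; last first.
  move=> b hb; have hI := Bgt_cBHgt hb.
  have hb' : cBH b by exact: (cBHgt_cBH hI).
  apply: hd_F_m0 => //; rewrite /F ((hd_pi_ker D hb').2 hI).
  have [_ [l1 _] _ _ _] := hd_tauP D.
  exact: (lin_on0 (subspace_setT _) (fun k x y _ _ => l1 w0 k x y)).
have [C0 bC0] := actm_bounded.
have sT := subspace_setT S.
have cL : is_closed nS L.
  have := closed_kernel habs bS bM sT (@closed_setT _ _ _ nS) actm_lin (fun x _ => bC0 x).
  suff -> : [set x | [set: S] x /\ actm x = 0] = L by [].
  by apply/seteqP; split=> x // [].
have sL : subspace L := ann_subspace (m0 : (D : lmodType S)).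
have hP := submodule_setT (S : lmodType K); have hL := subspace_submodule sL.
pose X : lmodType K := subquotient hP hL; pose rho : S -> X := sq_pi hP hL.
have lrho : lin_on setT rho by move=> k x y _ _; apply: sq_pi_lin.
have srho v : exists2 x, setT x & rho x = v by have [x Px ->] := sq_surj v; exists x.
have rho0 x : rho x = 0 <-> x *: m0 = 0 by exact: sq_pi_eq0.
have krho : is_closed nS [set x | [set: S] x /\ rho x = 0].
  suff -> : [set x | [set: S] x /\ rho x = 0] = L by [].
  by apply/seteqP; split=> x; [case=> _ /rho0 | move=> Lx; split=> //; apply/rho0].
have bX := banach_qnorm habs bS sT (@closed_setT _ _ _ nS) lrho srho krho.
have nrho x : qnorm nS setT rho (rho x) <= nS x by apply: (qnorm_le bS srho).
(* bounded lifts along BH -> N *)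
have [w0' w0gt w0lt] := uniformizer hK.
have [CF bF] := hd_F_bounded.
have [CY CY0 hCY] := open_mapping habs w0gt w0lt bS bN scBH ccBH (subspace_setT _)
  (@closed_setT _ _ _ _) hd_F_lin bF (fun _ _ => I) (fun nu _ => hd_F_surj nu).
have /choice[Y hY] : forall nu : hd_N D, exists y, [/\ cBH y, F y = nu & nS y <= CY * hd_nN nu].
  by move=> nu; apply: hCY.
have YE x y nu : cBH y -> F y = nu -> rho (x * Y nu) = rho (x * y).
  move=> hy Fy; have [hYn FY _] := hY nu.
  apply/eqP; rewrite -subr_eq0 -(lin_onB sT lrho) // -mulrBr; apply/eqP/rho0.
  rewrite -scalerA hd_F_m0 ?scaler0 //; first exact: (subspaceB scBH).
  by rewrite (lin_onB scBH hd_F_lin) // FY Fy subrr.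
have [bMod [ls1 ls2] bsig bal univ] := hd_sigmaP D.
have [|||g [[lg [Cg bg] gs] _]] := univ X _ bX (fun x nu => rho (x * Y nu)).
- split=> [nu k x y|x k nu nu']; first by rewrite mulrDl -scalerAl lrho.
  have [h1 F1 _] := hY nu; have [h2 F2 _] := hY nu'.
  rewrite (YE x (k *: Y nu + Y nu')) ?hd_F_lin ?F1 ?F2 //; last exact: (proj2 scBH).
  by rewrite mulrDr -scalerAr lrho.
- exists CY => x nu; have [_ _ h] := hY nu; apply: le_trans (nrho _) _.
  apply: le_trans (normM hS _ _) _; rewrite mulrCA; apply: ler_wpM2l => //.
  exact: (norm_ge0 bS).
- move=> x t nu ht; have [h1 F1 _] := hY nu.
  rewrite (YE x (t * Y nu)) ?mulrA //; first exact: cBH_mul.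
  by rewrite -hd_F_act // F1.
have [iota [liota iotaE]] : exists iota : X -> restr D, linear iota /\ forall x, setT x -> iota (rho x) = actm x.
  by apply: (descend sT lrho srho actm_lin) => x _ /rho0.
have biota v : hd_nmod (iota v) <= `|C0| * qnorm nS setT rho v.
  by apply: (qnorm_map_bound bS srho iotaE (fun x _ => bC0 x)).
have [g1 [_ uniq]] := univ (restr D) _ bMod (@hd_sigma _ _ _ _ _ _ _ _ _ _ D) (conj ls1 ls2) bsig bal.
have e1 : g1 = id by apply: uniq; split=> //; exists 1 => x; rewrite mul1r.
have e2 : g1 = iota \o g.
  apply: uniq; split=> [k x y||x nu] /=.
  - by rewrite lg liota.
  - exists (`|C0| * Cg) => x /=; apply: le_trans (biota _) _; rewrite -mulrA.
    by apply: ler_wpM2l.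
  have [h1 F1 _] := hY nu; rewrite gs iotaE // /actm -scalerA.
  rewrite [Y nu *: m0](hd_mod_sigma (Y nu) 1 (F 1)) mulr1 -[Y nu]mul1r.
  have -> := bal 1 (Y nu) (F 1) h1; rewrite hd_F_act ?mulr1 ?F1 //; last exact: cBH_1.
  by rewrite (hd_mod_sigma x 1 nu) mulr1.
move=> v; have [s _ es] := srho (g v); exists s.
have : g1 v = (iota \o g) v by rewrite e2.
by rewrite e1 /= -es iotaE.
Qed.
End HatDeltaCyclic.

(** * Construction of completed Verma modules *)

Section HatDeltaExists.
Variables (W : lmodType (subalg H)) (w0 : W) (n : nat).
Hypothesis hw0 : forall w, exists h : subalg H, w = h *: w0.

Let scBH := cBH_subspace.
Let ccBH : is_closed nS cBH := clos_closed bS (X := _).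
Let sI := cBHgt_subspace n.
Let cI : is_closed nS (cBHgt n). Proof. exact: cBHgt_closed. Qed.
Let I_cBH : cBHgt n `<=` cBH. Proof. exact: cBHgt_cBH. Qed.
Let mulcBH x y : cBH x -> cBH y -> cBH (x * y). Proof. exact: cBH_mul. Qed.
Let cBH1 : cBH 1. Proof. exact: cBH_1. Qed.
Let HcBH h : h \in H -> cBH h. Proof. exact: H_cBH. Qed.
Let sH := alg_subspace H.

Let toH (x : S) : subalg H := insubd 0 x.
Let toH_val h : toH (val h) = h. Proof. exact: valKd. Qed.
Let val_toH x : x \in H -> val (toH x) = x. Proof. by move=> hx; rewrite insubdK. Qed.
Let pW (x : S) : restr W := toH x *: w0.

Let pW_lin : lin_on [set` H] pW.
Proof.
move=> k x y /= hx hy; rewrite /pW.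
have -> : toH (k *: x + y) = k *: toH x + toH y.
  apply/val_inj; transitivity (k *: val (toH x) + val (toH y)).
    by rewrite !val_toH // rpredD ?rpredZ.
  by rewrite -val_subalgZ.
by rewrite scalerDl -mulr_algl -scalerA.
Qed.
Let pW_surj (w : restr W) : exists2 x, [set` H] x & pW x = w.
Proof. by have [h ->] := hw0 w; exists (val h); [apply: subalg_valP | rewrite /pW toH_val]. Qed.
Let AnnW : set S := [set x | x \in H /\ pW x = 0].
Let AnnW_subspace : subspace AnnW.
Proof.
split; first by split; [apply: rpred0 | apply: (lin_on0 sH pW_lin)].
move=> k x y [hx ex] [hy ey]; split; first by rewrite rpredD ?rpredZ.
by rewrite pW_lin // ex ey scaler0 addr0.
Qed.
Let H_closed : is_closed nS [set` H].
Proof. exact: (findim_closed habs (dv_complete hK) bS sH (td_Hfin hTa)). Qed.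
Let AnnW_closed : is_closed nS [set x | [set` H] x /\ pW x = 0].
Proof.
apply: (findim_closed habs (dv_complete hK) bS AnnW_subspace).
by apply: findim_sub (td_Hfin hTa) => // x [].
Qed.
Let nW := qnorm nS [set` H] pW.
Let bW : banach abs nW.
Proof. exact: (banach_qnorm habs bS sH H_closed pW_lin pW_surj AnnW_closed). Qed.

Let hP := subspace_submodule scBH.
Let hI := subspace_submodule sI.
Let Q : lmodType K := subquotient hP hI.
Let pi : S -> Q := sq_pi hP hI.
Let pi_lin : lin_on cBH pi. Proof. by move=> k x y hx hy; apply: sq_pi_lin. Qed.
Let pi_surj q : exists2 x, cBH x & pi x = q.
Proof. by have [x Px ->] := sq_surj q; exists x. Qed.
Let pi_ker x : cBH x -> (pi x = 0 <-> cBHgt n x).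
Proof. by move=> hx; apply: sq_pi_eq0. Qed.
Let nQ := qnorm nS cBH pi.
Let bQ : banach abs nQ.
Proof.
apply: (banach_qnorm habs bS scBH ccBH pi_lin pi_surj).
suff -> : [set x | cBH x /\ pi x = 0] = cBHgt n by [].
apply/seteqP; split=> x; first by case=> hx /(pi_ker hx).
by move=> Ix; split; [apply: I_cBH | apply/pi_ker => //; apply: I_cBH].
Qed.

Let rep (q : Q) : S := sq_rep q.
Let rep_cBH q : cBH (rep q). Proof. exact: sq_repI. Qed.

(* N is the quotient of BH by the closure of the left ideal generated by
   BH^{>n} and the annihilator of w0 in H *)
Let sumI : set S := [set z | exists a b, [/\ cBHgt n a, prodset cBH AnnW b & z = a + b]].
Let Y2 := closure sumI.
Let sAnn : subspace (prodset cBH AnnW). Proof. exact: prodset_subspace. Qed.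
Let sumI_subspace : subspace sumI.
Proof.
split; first by exists 0, 0; rewrite addr0; split=> //; [apply: subspace0 sI | apply: subspace0 sAnn].
move=> k _ _ [a [b [ha hb ->]]] [a' [b' [ha' hb' ->]]].
exists (k *: a + a'), (k *: b + b'); split; [exact: (proj2 sI) | exact: (proj2 sAnn) |].
by rewrite scalerDr addrACA.
Qed.
Let sY : subspace Y2. Proof. exact: (closure_subspace sumI_subspace). Qed.
Let cY : is_closed nS Y2. Proof. exact: (clos_closed bS). Qed.
Let I_Y2 : cBHgt n `<=` Y2.
Proof.
move=> x hx; apply: sub_clos_S; exists x, 0; rewrite addr0; split=> //.
exact: subspace0 sAnn.
Qed.
Let Ann_Y2 x h : cBH x -> AnnW h -> Y2 (x * h).
Proof.
move=> hx hh; apply: sub_clos_S; exists 0, (x * h); rewrite add0r; split=> //.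
  exact: subspace0 sI.
exact: prodset_in.
Qed.
Let sumI_cBH : sumI `<=` cBH.
Proof.
move=> _ [a [b [ha hb ->]]]; apply: (subspaceD scBH); first exact: I_cBH.
move: b hb; apply: prodset_min => // x h hx [hh _].
by apply: mulcBH => //; apply: HcBH.
Qed.
Let Y2_cBH : Y2 `<=` cBH. Proof. exact: (clos_min ccBH sumI_cBH). Qed.
Let Y2_mull x y : cBH x -> Y2 y -> Y2 (x * y).
Proof.
move=> hx; apply: (mull_closure cY) => _ [a [b [ha hb ->]]].
rewrite mulrDr; apply: (subspaceD sY); first by apply/I_Y2/cBHgt_mull.
move: b hb; apply: prodset_min => [|y' h hy hh]; first exact: subspace_mull_pre.
by rewrite /= mulrA; apply: Ann_Y2 => //; apply: mulcBH.
Qed.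

Let hY := subspace_submodule sY.
Let N : lmodType K := subquotient hP hY.
Let rho : S -> N := sq_pi hP hY.
Let rho_lin : lin_on cBH rho. Proof. by move=> k x y hx hy; apply: sq_pi_lin. Qed.
Let rho_surj q : exists2 x, cBH x & rho x = q.
Proof. by have [x Px ->] := sq_surj q; exists x. Qed.
Let rho_ker x : cBH x -> (rho x = 0 <-> Y2 x).
Proof. by move=> hx; apply: sq_pi_eq0. Qed.
Let rho_eq x y : cBH x -> cBH y -> (rho x = rho y <-> Y2 (x - y)).
Proof. by move=> hx hy; apply: sq_pi_eq. Qed.
Let nN := qnorm nS cBH rho.
Let bN : banach abs nN.
Proof.
apply: (banach_qnorm habs bS scBH ccBH rho_lin rho_surj).
suff -> : [set x | cBH x /\ rho x = 0] = Y2 by [].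
apply/seteqP; split=> x; first by case=> hx /(rho_ker hx).
by move=> Yx; split; [apply: Y2_cBH | apply/rho_ker => //; apply: Y2_cBH].
Qed.
Let nN_le x : cBH x -> nN (rho x) <= nS x. Proof. exact: (qnorm_le bS rho_surj). Qed.
Let repN (v : N) : S := sq_rep v.
Let repN_cBH v : cBH (repN v). Proof. exact: sq_repI. Qed.

Let Qr (q : Q) (h : subalg H) : Q := pi (rep q * val h).
Let QrP x h : cBH x -> Qr (pi x) h = pi (x * val h).
Proof.
move=> hx; have hh : cBH (val h) by apply: HcBH; apply: subalg_valP.
apply/sq_pi_eq; try exact: mulcBH.
rewrite -mulrBl; apply: cBHgt_mulr => //.
exact: sq_piP.
Qed.

Let hrep (w : restr W) : {x | [set` H] x & pW x = w}.
Proof. by apply/cid2/pW_surj. Qed.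
Let repW (w : restr W) : S := s2val (hrep w).
Let repW_H w : repW w \in H. Proof. exact: (s2valP (hrep w)). Qed.
Let repWK w : pW (repW w) = w. Proof. exact: (s2valP' (hrep w)). Qed.

Let tau (q : Q) (w : restr W) : N := rho (rep q * repW w).
Let tauE y h w : cBH y -> h \in H -> pW h = w -> tau (pi y) w = rho (y * h).
Proof.
move=> hy hh ew; apply/rho_eq; try by apply: mulcBH => //; apply: HcBH.
have -> : rep (pi y) * repW w - y * h = (rep (pi y) - y) * repW w + y * (repW w - h).
  by rewrite mulrBl mulrBr addrA subrK.
apply: (subspaceD sY).
  apply: I_Y2; apply: cBHgt_mulr; last exact: HcBH.
  exact: sq_piP.
apply: Ann_Y2 => //; split; first by apply: (subspaceB sH) => //; apply: repW_H.
by rewrite (lin_onB sH pW_lin) ?repWK ?ew ?subrr //; apply: repW_H.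
Qed.

Let pW_act h x : x \in H -> pW (val h * x) = (h *: (pW x : W) : restr W).
Proof.
move=> hx; have e : toH (val h * x) = h * toH x.
  apply/val_inj; transitivity (val h * val (toH x)); last by [].
  by rewrite !val_toH // rpredM ?subalg_valP.
by rewrite /pW e -[RHS]/(h *: (toH x *: w0)) scalerA.
Qed.

Let pW1 : pW 1 = w0.
Proof.
have e1 : toH 1 = 1 by apply/val_inj; rewrite [LHS]val_toH ?rpred1.
by rewrite /pW e1 scale1r.
Qed.

Let tauP : is_ctensor abs setT nQ nW nN Qr (fun h (w : restr W) => (h *: (w : W) : restr W)) tau.
Proof.
have cH h : h \in H -> cBH h by exact: HcBH.
split=> //.
- split=> [w k q q'|q k w w'].
    have [y hy <-] := pi_surj q; have [y' hy' <-] := pi_surj q'.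
    rewrite -[LHS]/(tau (k *: pi y + pi y') w) -pi_lin // !(@tauE _ (repW w)) ?repWK //; last exact: (proj2 scBH).
    by rewrite mulrDl -scalerAl rho_lin //; apply: mulcBH => //; apply: cH.
  have [y hy <-] := pi_surj q.
  have hk : k *: repW w + repW w' \in H by rewrite rpredD ?rpredZ.
  have ek : pW (k *: repW w + repW w') = k *: w + w'.
    by rewrite pW_lin ?repWK //; apply: repW_H.
  rewrite (tauE hy hk ek).
  rewrite (@tauE _ (repW w)) ?repWK // (@tauE _ (repW w')) ?repWK //.
  by rewrite mulrDr -scalerAr rho_lin //; apply: mulcBH => //; apply: cH.
- exists 1 => q w; rewrite mul1r.
  rewrite -[nQ q]mul1r mulrAC.
  apply: (qnorm_bound bS pi_surj) => [|y hy ey]; first by rewrite mul1r (norm_ge0 bW).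
  rewrite mul1r mulrC; apply: (qnorm_bound bS pW_surj) => [|h hh eh]; first exact: (norm_ge0 bS).
  rewrite -ey (@tauE _ h) //; apply: le_trans (nN_le _) (normM hS _ _).
  by apply: mulcBH => //; apply: cH.
- move=> q h w _; have [y hy <-] := pi_surj q.
  have hh : cBH (val h) by apply: cH; apply: subalg_valP.
  rewrite QrP // (@tauE _ (repW w)) ?repWK //; last exact: mulcBH.
  rewrite (@tauE _ (val h * repW w)) ?mulrA //; first by rewrite rpredM ?subalg_valP.
  by rewrite pW_act ?repWK.
move=> V nV bV f [f1 f2] [Cf bf] balf.
have f1l w : lin_on setT (f^~ w) by move=> k x y _ _; apply: f1.
pose G (y : S) : V := f (pi y) w0.
have Gl : lin_on cBH G by move=> k x y hx hy; rewrite /G pi_lin //; apply: f1.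
have bG y : cBH y -> nV (G y) <= (`|Cf| * nW w0) * nS y.
  move=> hy; apply: le_trans (bf _ _) _; rewrite -mulrA [nW w0 * _]mulrC.
  apply: le_trans (_ : `|Cf| * (nQ (pi y) * nW w0) <= _).
    by apply: ler_wpM2r; [rewrite mulr_ge0 ?(norm_ge0 bQ) ?(norm_ge0 bW) | apply: ler_norm].
  apply: ler_wpM2l => //; apply: ler_wpM2r; first exact: (norm_ge0 bW).
  exact: (qnorm_le bS pi_surj).
have cG := closed_kernel habs bS bV scBH ccBH Gl bG.
have balG y h : cBH y -> h \in H -> G (y * h) = f (pi y) (pW h).
  move=> hy hh; rewrite /G -(val_toH hh) -QrP // balf //; congr f.
  by rewrite /pW toH_val.
have GY y : Y2 y -> G y = 0.
  move=> hy; suff [] : [set y | cBH y /\ G y = 0] y by [].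
  apply: (clos_min cG _ hy) => _ [a [b [ha hb ->]]].
  have sZ : subspace [set y | cBH y /\ G y = 0].
    split; first by split; [apply: subspace0 scBH | apply: (lin_on0 scBH Gl)].
    by move=> k x z [hx ex] [hz ez]; split; [apply: (proj2 scBH) | rewrite Gl // ex ez scaler0 addr0].
  apply: (subspaceD sZ).
    have ha' := I_cBH ha; split=> //; rewrite /G (pi_ker ha').2 //.
    exact: (lin_on0 (subspace_setT _) (f1l w0)).
  move: b hb; apply: prodset_min => // x h hx [hh eh].
  split; first by apply: mulcBH => //; apply: cH.
  rewrite balG // eh; exact: (lin_on0 (subspace_setT _) (fun k u v _ _ => f2 (pi x) k u v)).
have [g [lg gE]] := descend scBH rho_lin rho_surj Gl (fun x hx e => GY x ((rho_ker hx).1 e)).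
have bg v := qnorm_map_bound bS rho_surj gE bG v.
exists g; split; first split=> //.
- by exists (`| `|Cf| * nW w0 |).
- move=> q w; have [y hy <-] := pi_surj q.
  rewrite (@tauE _ (repW w)) ?repWK // gE; last by apply: mulcBH => //; apply: cH.
  by rewrite balG // repWK.
move=> g' [lg' _ g'E]; apply/funext => v; have [y hy <-] := rho_surj v.
rewrite gE // -[y in RHS]mulr1 -(@tauE y 1 w0) ?rpred1 // g'E //.
Qed.

Let act (x : S) (v : N) : N := rho (x * repN v).
Let actE x y : cBH x -> cBH y -> act x (rho y) = rho (x * y).
Proof.
move=> hx hy; apply/rho_eq; try by apply: mulcBH.
by rewrite -mulrBr; apply: Y2_mull => //; exact: (sq_piP hP hY hy).
Qed.
Let act_lin x : cBH x -> linear (act x).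
Proof.
move=> hx k u v; have [y hy <-] := rho_surj u; have [z hz <-] := rho_surj v.
rewrite -rho_lin // !actE //; last exact: (proj2 scBH).
by rewrite mulrDr -scalerAr rho_lin //; apply: mulcBH.
Qed.
Let act_bounded x : cBH x -> bounded_map nN nN (act x).
Proof.
move=> hx; exists (nS x) => v; apply: (qnorm_bound bS rho_surj); first exact: (norm_ge0 bS).
move=> y hy <-; rewrite actE //; apply: le_trans (nN_le _) (normM hS _ _).
exact: mulcBH.
Qed.
Let act_tau x y w : cBH x -> cBH y -> act x (tau (pi y) w) = tau (pi (x * y)) w.
Proof.
move=> hx hy; rewrite !(@tauE _ (repW w)) ?repWK //; last exact: mulcBH.
rewrite actE ?mulrA //; apply: mulcBH => //; apply: HcBH; exact: repW_H.
Qed.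

(* the module is S / L, with L the closed left ideal generated by Y2 *)
Let pL := prodset setT Y2.
Let L := closure pL.
Let sL : subspace L.
Proof. by apply: closure_subspace; apply: prodset_subspace. Qed.
Let cL : is_closed nS L. Proof. exact: (clos_closed bS). Qed.
Let L_mull x y : L y -> L (x * y).
Proof.
apply: (mull_closure cL) => {}y hy; apply: sub_clos_S; move: y hy.
have sP : subspace pL by apply: prodset_subspace.
apply: prodset_min => [|a b _ hb]; first exact: subspace_mull_pre.
by rewrite /= mulrA; apply: prodset_in.
Qed.
Let L_Y2 x y : Y2 y -> L (x * y).
Proof. by move=> hy; apply: sub_clos_S; apply: prodset_in. Qed.

Let hL : submodule (S := S) (M := S^o) L.
Proof. by split; [apply: subspace0 sL | apply: (subspaceD sL) | apply: L_mull]. Qed.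
Let hT' := submodule_setT (S^o : lmodType S).
Let Mt : lmodType S := subquotient hT' hL.
Let sg (x : S) : restr Mt := sq_pi hT' hL (x : S^o).
Let sg_lin : lin_on setT sg.
Proof.
move=> k x y _ _; have -> : k *: x = k%:A * x by rewrite mulr_algl.
transitivity (sg (k%:A * x) + sg y).
  exact: (@sq_piD _ _ _ _ hT' hL (k%:A * x : S) y).
have e2 : sg (k%:A * x) = (k%:A : S) *: (sg x : Mt).
  exact: (@sq_piZ _ _ _ _ hT' hL (k%:A : S) x).
by rewrite e2.
Qed.
Let sg_surj q : exists2 x, setT x & sg x = q.
Proof. by have [x Px ->] := sq_surj q; exists x. Qed.
Let sg_ker x : sg x = 0 <-> L x. Proof. exact: sq_pi_eq0. Qed.
Let sg_eq x y : sg x = sg y <-> L (x - y). Proof. exact: sq_pi_eq. Qed.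
Let sgZ (x y : S) : x *: (sg y : Mt) = sg (x * y). Proof. by rewrite -[LHS]sq_piZ. Qed.
Let nM : restr Mt -> Rl := qnorm nS setT sg.
Let bMt : banach abs nM.
Proof.
apply: (banach_qnorm habs bS (subspace_setT S) (@closed_setT _ _ _ nS) sg_lin sg_surj).
suff -> : [set x | [set: S] x /\ sg x = 0] = L by [].
by apply/seteqP; split=> x; [case=> _ /sg_ker | move=> Lx; split=> //; apply/sg_ker].
Qed.
Let nM_le x : nM (sg x) <= nS x. Proof. exact: (qnorm_le bS sg_surj). Qed.

Let sigma (s : S) (v : N) : restr Mt := sg (s * repN v).
Let sigmaE s y : cBH y -> sigma s (rho y) = sg (s * y).
Proof.
by move=> hy; apply/sg_eq; rewrite -mulrBr; apply: L_Y2; exact: (sq_piP hP hY hy).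
Qed.

Let sigmaP : is_ctensor abs cBH nS nN nM *%R act sigma.
Proof.
have sT := subspace_setT S.
split=> //.
- split=> [v k s t|s k u v].
    by rewrite /sigma mulrDl -scalerAl sg_lin.
  have [y hy <-] := rho_surj u; have [z hz <-] := rho_surj v.
  rewrite -rho_lin // !sigmaE //; last exact: (proj2 scBH).
  by rewrite mulrDr -scalerAr sg_lin.
- exists 1 => s v; rewrite mul1r; apply: (qnorm_bound bS rho_surj); first exact: (norm_ge0 bS).
  by move=> y hy <-; rewrite sigmaE //; apply: le_trans (nM_le _) (normM hS _ _).
- move=> s t v ht; have [y hy <-] := rho_surj v.
  by rewrite actE // !sigmaE ?mulrA //; apply: mulcBH.
move=> V nV bV f [f1 f2] [Cf bf] balf.
have f2l s : lin_on setT (f s) by move=> k x y _ _; apply: f2.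
pose G (s : S) : V := f s (rho 1).
have Gl : lin_on setT G by move=> k x y _ _; apply: f1.
have bG s : nV (G s) <= (`|Cf| * nN (rho 1)) * nS s.
  apply: le_trans (bf _ _) _; rewrite -mulrA [nN _ * _]mulrC.
  by apply: ler_wpM2r; [rewrite mulr_ge0 ?(norm_ge0 bS) ?(norm_ge0 bN) | apply: ler_norm].
have cG := closed_kernel habs bS bV sT (@closed_setT _ _ _ nS) Gl (fun x _ => bG x).
have balG s y : cBH y -> G (s * y) = f s (rho y).
  by move=> hy; rewrite /G balf // actE // mulr1.
have GL s : L s -> G s = 0.
  move=> hs; suff [] : [set s | [set: S] s /\ G s = 0] s by [].
  apply: (clos_min cG _ hs).
  have sZ : subspace [set s | [set: S] s /\ G s = 0].
    split; first by split=> //; apply: (lin_on0 sT Gl).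
    by move=> k x z [hx ex] [hz ez]; split=> //; rewrite Gl // ex ez scaler0 addr0.
  apply: prodset_min => // x y _ hy; split=> //.
  have hy' := Y2_cBH hy; rewrite balG // (rho_ker hy').2 //.
  exact: (lin_on0 (subspace_setT _) (f2l x)).
have [g [lg gE]] := descend sT sg_lin sg_surj Gl (fun x _ e => GL x ((sg_ker x).1 e)).
have bg v := qnorm_map_bound bS sg_surj gE (fun x _ => bG x) v.
exists g; split; first split=> //.
- by exists (`| `|Cf| * nN (rho 1) |).
- move=> s v; have [y hy <-] := rho_surj v.
  by rewrite sigmaE // gE // balG.
move=> g' [lg' _ g'E]; apply/funext => v; have [s _ <-] := sg_surj v.
by rewrite gE // -[s in RHS]mulr1 -sigmaE // g'E.
Qed.

Let Mt_bounded : exists C : Rl, forall (x : S) (v : Mt), nM (x *: v : Mt) <= C * (nS x * nM v).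
Proof.
exists 1 => x v; rewrite mul1r; apply: (qnorm_bound bS sg_surj); first exact: (norm_ge0 bS).
move=> y _ <-; rewrite sgZ; apply: le_trans (nM_le _) (normM hS _ _).
Qed.
Let Mt_sigma (x y : S) (v : N) : x *: (sigma y v : Mt) = sigma (x * y) v.
Proof. by rewrite sgZ mulrA. Qed.

Let pi_norm x : cBH x -> nQ (pi x) = inf [set nS (x + y) | y in cBHgt n].
Proof.
move=> hx; congr inf; apply/seteqP; split=> r.
  move=> [z [hz ez] <-]; exists (z - x); last by rewrite addrC subrK.
  apply/(pi_ker _).1; first exact: (subspaceB scBH).
  by rewrite (lin_onB scBH pi_lin) // ez subrr.
move=> [y hy <-]; have hy' := I_cBH hy.
exists (x + y) => //; split; first exact: (subspaceD scBH).
by rewrite (lin_onD pi_lin) // (pi_ker hy').2 // addr0.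
Qed.
Let pi_surj' q : exists2 x, cBH x & q = pi x.
Proof. by have [x hx <-] := pi_surj q; exists x. Qed.

Let D : hatDelta abs nS gr B W n :=
  HatDelta bW bQ pi_lin pi_surj' pi_ker pi_norm QrP tauP
    (fun x hx => conj (act_lin hx) (act_bounded hx)) act_tau sigmaP Mt_bounded Mt_sigma.

(** The generator of the module constructed above is the class of 1 in S / L,
    where L is the closed left ideal generated by B^{>n} and by the
    annihilator of w0 in H. As the annihilator of m is a closed left ideal, it
    contains L. *)
Theorem hatDelta_exists : exists (D : hatDelta abs nS gr B W n) (m0 : D),
  forall (M : lmodType S) (m : M), (forall b, Bgt gr B n b -> b *: m = 0) ->
    (forall h : subalg H, h *: w0 = 0 -> val h *: m = 0) ->
    exists f : {linear D -> M}, f m0 = m.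
Proof.
exists D, (sg 1 : Mt) => M m hm hw.
have annc : is_closed nS [set s : S | s *: m = 0] by apply: (ann_closed hK hS hSn).
have sann := ann_subspace m.
have annL : L `<=` [set s : S | s *: m = 0].
  apply: (clos_min annc); apply: prodset_min => // x y _ hy.
  suff : y *: m = 0 by rewrite /= -scalerA => ->; rewrite scaler0.
  move: y hy; apply: (clos_min annc) => _ [a [b [ha hb ->]]].
  apply: (subspaceD sann).
    move: a ha; rewrite cBHgtE; apply: (clos_min annc).
    by apply: prodset_min => // h c Hh hc; rewrite /= -scalerA hm ?scaler0.
  move: b hb; apply: prodset_min => // x' h _ [hh eh]; rewrite /= -scalerA.
  have := hw (toH h) eh; rewrite val_toH // => ->; exact: scaler0.
have [|f hf] := @linear_pack _ Mt M (fun q => (sq_rep q : S) *: m).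
  move=> k u v; rewrite scalerA -scalerDl; apply/eqP; rewrite -subr_eq0 -scalerBl; apply/eqP/annL.
  have [x _ ex] := sg_surj u; have [y _ ey] := sg_surj v.
  apply/sg_eq; rewrite -[LHS]/(sq_pi hT' hL (sq_rep (k *: u + v))) sq_repK.
  rewrite -[RHS]/(sq_pi hT' hL ((k * sq_rep u + sq_rep v) : S^o)) sq_piD // (sq_repK v).
  by congr (_ + _); rewrite -{1}(sq_repK u) -sq_piZ.
exists f; rewrite hf; apply/eqP; rewrite -subr_eq0 -{2}[m]scale1r -scalerBl; apply/eqP/annL.
exact: (@sq_piP _ _ _ _ hT' hL (1 : S) I).
Qed.
End HatDeltaExists.

(** * The equivalence *)

Section Equivalence.
Variable M : lmodType S.

Definition hatDelta_image : Prop :=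
  exists (r : nat) (W : 'I_r -> lmodType (subalg H)) (n : 'I_r -> nat)
      (D : forall i, hatDelta abs nS gr B (W i) (n i)) (f : forall i, {linear D i -> M}),
    (forall i, irreducible (W i)) /\ (forall m : M, exists v : forall i, D i, m = \sum_i f i (v i)).

Definition verma_weights : Prop :=
  exists (n : nat) (W : 'I_n -> lmodType (subalg H)) (c : 'I_n -> K),
    [/\ forall i, irreducible (W i) /\ is_c gr A B d (W i) (c i),
        forall l, mod_weights d M l -> exists i (k : nat), l = c i + k%:R,
        forall l, findim (mod_wspace d (M := M) l)
      & mod_wdecomp nS d M].

Lemma gen_by_wt (E : set S) (L : set K) (N : set M) :
  gen_by E (wtsum d (M := M) L) N -> gen_by E [set v : M | exists2 l, L l & wt d l v] N.
Proof.
move=> h; apply: (gen_by_trans h) => v [F [x [hF ev]]].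
exists (size F), (fun i => x (tnth (in_tuple F) i)); split=> [i|_ [s Es <-]].
  by have [Ll wl] := hF _ (mem_tnth i (in_tuple F)); exists (tnth (in_tuple F) i).
exists (fun _ => s); split=> //.
rewrite -scaler_sumr; congr (_ *: _); rewrite ev.
exact: (big_tnth _ _ F xpredT x).
Qed.

Definition killed : set M := [set v | exists n, forall b, Bgt gr B n b -> b *: v = 0].

Lemma Bgt_ann_H n (h : S) (v : M) : h \in H -> (forall b, Bgt gr B n b -> b *: v = 0) ->
  forall b, Bgt gr B n b -> b *: (h *: v) = 0.
Proof.
move=> Hh hv b hb; rewrite scalerA; move: (b * h) (Bgt_H hTa hb Hh).
apply: (prodset_min (Z := [set x | x *: v = 0])).
  exact: ann_subspace.
by move=> h' b' _ hb'; rewrite /= -scalerA hv ?scaler0.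
Qed.

Lemma killed_HB h j b v : h \in H -> Bup gr B j b -> killed v -> killed ((h * b) *: v).
Proof.
move=> Hh [Bb _] [n hn]; exists n; rewrite -scalerA; apply: Bgt_ann_H => //.
by move=> b' hb'; rewrite scalerA; apply: hn; apply: (Bgt_mulr hTa).
Qed.

Lemma gen_by_killed : gen_by setT killed [set: M] -> gen_by cA killed [set: M].
Proof.
move=> h; apply: (gen_by_trans h) => v [n hn].
apply: gen_by_trans (killed_generated hn) _ => _ [h' [j [b [Hh hb ->]]]].
exists 1%N, (fun _ => (h' * b) *: v); split=> [i|_ [s Es <-]].
  by apply: killed_HB hb _ => //; exists n.
by exists (fun _ => s); split=> //; rewrite big_ord1.
Qed.

Lemma gen_by_killed_wt : gen_by setT (killed `&` [set v | exists l, wt d l v]) [set: M] ->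
  gen_by cA [set v : M | exists l, wt d l v] [set: M].
Proof.
move=> h; apply: (gen_by_trans h) => v [[n hn] [l wv]].
apply: gen_byS (killed_generated hn) => // _ [h' [j [b [Hh hb ->]]]].
exists (l + (- j%:Z)%:~R + 0%:~R); rewrite -scalerA.
apply: (wt_gr hTa (H_gr0 hTa Hh)); apply: (wt_gr hTa _ wv); by case: hb.
Qed.

(** Generators can be chosen in the dense subspace of sums of weight vectors,
    and then be split into weight vectors. *)
Lemma wt_generators : finite_over M [set: S] ->
  dense_in (can_nbhs nS (M := M)) (mod_wsum d (M := M)) ->
  gen_by setT [set v : M | exists l, wt d l v] [set: M].
Proof.
move=> hM dM; have h := dense_generators hK hS hM dM.
rewrite mod_wsumE in h; apply: gen_byS (gen_by_wt h) => // v [l _ wv].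
by exists l.
Qed.

(** M is generated by weight vectors y_i, each killed by some B^{>n}. As 1 =
    sum_t e_t in H with simple left ideals H e_t, the vectors e_t y_i generate
    M too, and each is the image of the generator of a completed Verma module
    of H e_t. *)
Lemma hatO_hatDelta : in_hatO nS A d M ->
  hatDelta_image.
Proof.
move=> [hM hMA wM]; have [k [y [wy gy]]] := wt_generators hM (wdecomp_dense wM).
have /choice[n hn] : forall i, exists n, forall b, Bgt gr B n b -> b *: y i = 0.
  by move=> i; have [l wl] := wy i; apply: (nilpotent_wt hMA wl).
have [d' [d0 [q [e [c [ed hd' e1 he]]]]]] := simple_data hTa.
pose J : finType := ('I_k * 'I_q)%type.
pose yy (i : 'I_#|J|) := y (enum_val i).1; pose ee (i : 'I_#|J|) := e (enum_val i).2.
pose W (i : 'I_#|J|) : lmodType (subalg H) := cyclic_quotient (ee i).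
pose nn (i : 'I_#|J|) := n (enum_val i).1.
have hD i : exists (D : hatDelta abs nS gr B (W i) (nn i)) (m0 : D) (f : {linear D -> M}),
    f m0 = val (ee i) *: yy i.
  have [D [m0 hD]] := hatDelta_exists (nn i) (@cyclic_genP _ _ (ee i)).
  exists D, m0; apply: hD.
    by apply: Bgt_ann_H; [apply: subalg_valP | apply: hn].
  move=> h /cyclic_gen_eq0 e0; rewrite scalerA.
  have -> : val h * val (ee i) = 0 by rewrite -[LHS]/(val (h * ee i)) e0.
  exact: scale0r.
have /fin_all_exists[D /fin_all_exists[m0 /fin_all_exists[f hf]]] := hD.
exists #|J|, W, nn, D, f; split=> [i|m].
  by apply: cyclic_irreducible; have [] := he (enum_val i).2.
have [a [_ ->]] := gy m I; exists (fun i => a (enum_val i).1 *: m0 i).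
under [RHS]eq_bigr => i _ do rewrite linearZ hf.
rewrite -(big_enum_val (fun t : J => a t.1 *: (val (e t.2) *: y t.1))) /=.
rewrite -(pair_bigA _ (fun i t => a i *: (val (e t) *: y i))) /=; apply: eq_bigr => i _.
have es : \sum_t val (e t) = 1 by rewrite -raddf_sum -e1.
by rewrite -scaler_sumr -scaler_suml es scale1r.
Qed.

(** The images of the cyclic generators are killed by some B^{>n}, so M is
    generated over the closure of A by killed vectors, and these are sums of
    weight vectors of weights c(W) + k. *)
Lemma hatDelta_weights :
  hatDelta_image ->
  verma_weights.
Proof.
move=> [r [W [n [D [f [irr surj]]]]]].
have /fin_all_exists[m0 hm0] : forall i, exists m : D i,
    (forall v : D i, exists s : S, v = s *: m) /\ forall b, Bgt gr B (n i) b -> b *: m = 0.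
  move=> i; have [w0 hw0] := irreducible_cyclic (irr i).
  exact: (hatDelta_cyclic (D i) hw0).
have kgen : gen_by setT killed [set: M].
  exists r, (fun i => f i (m0 i)); split=> [i|m _].
    by exists (n i) => b hb; have [_ h] := hm0 i; rewrite -linearZ h // linear0.
  have [v ->] := surj m; have /fin_all_exists[s hs] : forall i, exists s : S, v i = s *: m0 i.
    by move=> i; have [h _] := hm0 i; apply: h.
  by exists s; split=> //; apply: eq_bigr => i _; rewrite hs linearZ.
have [d' [d0 [q [e [c [ed hd' e1 he]]]]]] := simple_data hTa.
pose L (l : K) := exists i (k : nat), l = c i + k%:R.
have hL l : L l -> L (l + 1) by move=> [i [k ->]]; exists i, k.+1; rewrite -natr1 addrA.
have gwt : gen_by cA [set v : M | exists2 l, L l & wt d l v] [set: M].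
  apply: gen_by_wt; apply: gen_byS (gen_by_killed kgen) => // v [k hk].
  apply: (@killed_wtsum _ _ _ _ _ _ _ _ hTa M L d' d0 q e c hL ed hd' e1 _ k.+1) => [i|j b kj hb].
    by have [_ _ h] := he i; split=> //; exists i, 0%N; rewrite addr0.
  by apply: hk; apply: Bgt_in hb.
have gw := generated_weights hL gwt.
exists q, (fun i => cyclic_quotient (e i)), c; split.
- by move=> i; have [h1 h2 _] := he i; split=> //; apply: cyclic_irreducible.
- move=> l [v]; rewrite -/(mod_wspace d l) mod_wspaceE => wv v0.
  by have [_ h] := gw l; apply: (h v).
- by move=> l; rewrite mod_wspaceE; have [] := gw l.
apply: generated_wdecomp; apply: gen_byS gwt => // v [l _ wv].
by exists l.
Qed.

(** The elements of B^j lower weights by j, and the weights of M are bounded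
    below in each class modulo the integers. *)
Lemma weights_nilpotent :
  verma_weights ->
  loc_nilpotent gr B (mod_wsum d (M := M)) /\ dense_in (can_nbhs nS (M := M)) (mod_wsum d (M := M)).
Proof.
move=> [n [W [c [_ hw _ wd]]]]; split; last exact: wdecomp_dense.
apply: loc_nilpotent_wtsum => l y wy.
have /choice[N hN] : forall i, exists N, forall j k : nat, l - j%:R = c i + k%:R -> (j <= N)%N.
  move=> i; have [[N eN]|no] := pselect (exists N : nat, l = c i + N%:R); last first.
    exists 0%N => j k e; case: no; exists (k + j)%N.
    by rewrite natrD addrA -e subrK.
  exists N => j k e; have : (c i + N%:R) = c i + (k + j)%:R.
    by rewrite -eN natrD addrA -e subrK.
  by move=> /addrI /(natr_inj char0) ->; apply: leq_addl.
exists (\max_i N i)%N => b hb; suff : [set b | b *: y = 0] b by [].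
move: b hb; apply: Bgt_min => [|j nj b hb].
  exact: ann_subspace.
apply: contrapT => /= by0; have wb : wt d (l - j%:R) (b *: y).
  by have := wt_gr hTa (proj2 hb) wy; rewrite mulrNz.
have [|i [k e]] := hw (l - j%:R).
  by exists (b *: y) => //; rewrite -/(mod_wspace d (l - j%:R)) mod_wspaceE.
move: nj; rewrite ltnNge => /negP; apply; apply: leq_trans (hN i j k e) _.
exact: leq_bigmax.
Qed.

(** M is generated by weight vectors y. Each is killed by some B^{>n}, so S y
    is generated over the closure of A by the vectors h b y with b
    homogeneous, which are weight vectors. *)
Lemma nilpotent_hatO : finite_over M [set: S] ->
  loc_nilpotent gr B (mod_wsum d (M := M)) /\ dense_in (can_nbhs nS (M := M)) (mod_wsum d (M := M)) ->
  in_hatO nS A d M.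
Proof.
move=> hM [nM dM].
have gw : gen_by cA [set v : M | exists l, wt d l v] [set: M].
  apply: gen_by_killed_wt; apply: gen_byS (wt_generators hM dM) => // v [l wv].
  split; last by exists l.
  by apply: nM; rewrite mod_wsumE; apply: (@wtsum_in _ _ _ _ _ l).
split=> //; last exact: generated_wdecomp.
have [k [g [_ gen]]] := gw; exists k, g => m.
by have [a ha] := gen m I; exists a.
Qed.
End Equivalence.
End Setting.

Theorem proposition3p1p35 (Rl : realType) (p : nat) (hp : prime p)
    (K : fieldType) (abs : K -> Rl) (hK : complete_dv_ext_of_Qp abs p)
    (S : algType K) (nS : S -> Rl) (hS : banach_alg abs nS)
    (hSn : noetherian [set: S])
    (R : subalgClosed S) (gr : int -> set S) (A B H : subalgClosed S) (d : S)
    (hT : banach_tri_decomp abs nS R gr A B H d)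
    (hA : noetherian (closure_of nS A)) (hB : noetherian (closure_of nS B))
    (M : lmodType S) (hM : finite_over M [set: S]) :
  [<->
    in_hatO nS A d M;

    exists (r : nat) (W : 'I_r -> lmodType (subalg H)) (n : 'I_r -> nat)
        (D : forall i, hatDelta abs nS gr B (W i) (n i))
        (f : forall i, {linear D i -> M}),
      (forall i, irreducible (W i)) /\
      (forall m : M, exists v : forall i, D i, m = \sum_i f i (v i));

    exists (n : nat) (W : 'I_n -> lmodType (subalg H)) (c : 'I_n -> K),
      [/\ forall i, irreducible (W i) /\ is_c gr A B d (W i) (c i),
          forall l, mod_weights d M l -> exists i (k : nat), l = c i + k%:R,
          forall l, findim (mod_wspace d (M := M) l)
        & mod_wdecomp nS d M];

    loc_nilpotent gr B (mod_wsum d (M := M)) /\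
    dense_in (can_nbhs nS (M := M)) (mod_wsum d (M := M)) ].
Proof.
have s1 := hatO_hatDelta hp hK hS hT hSn hA hB (M := M).
have s2 := hatDelta_weights hp hK hS hT hSn hA hB (M := M).
have s3 := weights_nilpotent hp hK hT (M := M).
have s4 := nilpotent_hatO hp hK hS hT hSn hM.
by tfae.
Qed.
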